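(* Let $u=v^{a,b}$ with $a,b>-1$, let $w=v^{\alpha,\beta}$ with $\alpha,\beta>-1$, and let $u_1,u_2$ be the weights associated to $u$ defined in the context. Fix constants $c_2\ge c_1>1$ and write $m\approx n$ for integers with $c_1m\le n\le c_2m$. Assume that the maps $V_n^m(w):C^0_{u_1}\to C^0_{u_1}$ are uniformly bounded with respect to $m\approx n$ (i.e. $\|V_n^m(w,f)u_1\|_\infty\le \mathcal{C}\|fu_1\|_\infty$ for all $f\in C^0_{u_1}$ with $\mathcal{C}$ independent of $n,m,f$). Then for every $r>0$, all $f\in B_r(u_1)$, all $m\approx n$ and all $t\in(-1,1)$, $$\mathcal{E}_{n,m}^u(w,f,t)\,u_2(t)\le \mathcal{C}\,|f(t)-V_n^m(w,f,t)|\,u_1(t)+\mathcal{C}\,\frac{\log n}{n^r}\,\|f\|_{B_r(u_1)},$$ where $\mathcal{C}>0$ is independent of $n,m,f,t$.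
   Context: For real exponents $p,q$ put $v^{p,q}(x):=(1-x)^p(1+x)^q$, $x\in(-1,1)$. For real $c$, $c_+:=\max\{0,c\}$ and $c_-:=\max\{0,-c\}$. Weights: for $u=v^{a,b}$ set $u_+:=v^{a_+,b_+}$, $u_-:=v^{a_-,b_-}$ (so $u=u_+/u_-$), and $$u_1(x):=u_+(x),\qquad u_2(x):=\frac{u_-(x)}{1+(u_+u_-)(-1)\,|\log(1+x)|+(u_+u_-)(1)\,|\log(1-x)|},$$ where $u_+u_-=v^{|a|,|b|}$ is evaluated at $\pm1$ with the convention $0^0=1$ (so $(u_+u_-)(1)\ne0$ iff $a=0$, and $(u_+u_-)(-1)\neq0$ iff $b=0$). Space $C^0_v$ ($v=v^{\gamma,\delta}$, $\gamma,\delta\ge 0$): all functions $f$ continuous on $(-1,1)$ such that $\lim_{x\to 1}f(x)v(x)=0$ if $\gamma>0$ and $\lim_{x\to -1}f(x)v(x)=0$ if $\delta>0$; at an endpoint where the exponent is $0$, $f$ is required to be continuous up to that endpoint. Norm: $\|fv\|_\infty=\max_{x\in[-1,1]}|f(x)|v(x)$ (with $fv$ extended continuously to $[-1,1]$). $\mathbb{P}_n$ is the space of algebraic polynomials of degree at most $n$, and $E_n(f)_v:=\inf_{P\in\mathbb{P}_n}\|(f-P)v\|_\infty$. For $r>0$, $B_r(v):=\{f\in C^0_v:\ \sum_{n=1}^\infty (n+1)^{r-1}E_n(f)_v<\infty\}$ with norm $\|f\|_{B_r(v)}:=\|fv\|_\infty+\sum_{n=1}^\infty (n+1)^{r-1}E_n(f)_v$.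 De la Vallée Poussin (VP) operator: let $p_j(w,\cdot)$ be the orthonormal Jacobi polynomials with respect to $w$ on $[-1,1]$ (positive leading coefficients), $x_1,\dots,x_n$ the zeros of $p_n(w,\cdot)$, and $\lambda_k:=\big(\sum_{j=0}^{n-1}p_j(w,x_k)^2\big)^{-1}$. For integers $0<m<n$, $$V_n^m(w,f,x)=\sum_{k=1}^n f(x_k)\,\lambda_k\sum_{j=0}^{n+m-1}\mu_{n,j}^m\,p_j(w,x)\,p_j(w,x_k),$$ where $\mu_{n,j}^m=1$ for $0\le j\le n-m$ and $\mu_{n,j}^m=\frac{n+m-j}{2m}$ for $n-m<j<n+m$. Finite Hilbert transform (principal value): $$\mathcal{H}^uf(t):=\lim_{\epsilon\to0}\int_{x\in[-1,1],\,|x-t|\ge\epsilon}\frac{f(x)}{x-t}u(x)\,dx,\qquad -1<t<1.$$ VP quadrature rule and its error: $$\mathcal{H}^u_{n,m}(w,f,t):=\mathcal{H}^u[V_n^m(w,f)](t),\qquad \mathcal{E}^u_{n,m}(w,f,t):=\big|\mathcal{H}^uf(t)-\mathcal{H}^u_{n,m}(w,f,t)\big|.$$ *)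

(* Defs.v *)
From HB Require Import structures.
From mathcomp Require Import all_boot all_order all_algebra.
From mathcomp Require Import all_classical all_reals all_analysis.

Set Implicit Arguments.
Unset Strict Implicit.
Unset Printing Implicit Defensive.

Import Order.TTheory GRing.Theory Num.Theory.
Import numFieldNormedType.Exports.

Local Open Scope classical_set_scope.
Local Open Scope ring_scope.

Section Weights.
Context {R : realType}.

Definition ppart (c : R) : R := Num.max 0 c.
Definition npart (c : R) : R := Num.max 0 (- c).

(* Real powers follow the conventions 0 `^ 0 = 1 and 0 `^ p = 0 for p <> 0;
   the former is the one needed in the denominator of [u2], the latter only
   matters (for p < 0) on the null set {-1, 1}. *)
Definition jweight (p q x : R) : R := (1 - x) `^ p * (1 + x) `^ q.

Definition uplus (a b : R) : R -> R := jweight (ppart a) (ppart b).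
Definition uminus (a b : R) : R -> R := jweight (npart a) (npart b).

Definition u1 (a b : R) : R -> R := uplus a b.

Definition u2 (a b x : R) : R :=
  uminus a b x /
  (1 + uplus a b (-1) * uminus a b (-1) * `|ln (1 + x)|
     + uplus a b 1 * uminus a b 1 * `|ln (1 - x)|).

End Weights.

(* The weight is v = jweight g d with g, d >= 0.  Functions on (-1,1) are
   total functions R -> R whose values outside (-1,1) are never relevant. *)
Section Spaces.
Context {R : realType}.

Definition C0 (g d : R) (f : R -> R) : Prop :=
  [/\ {in `]-1, 1[, continuous f},
      0 < g -> f x * jweight g d x @[x --> 1^'-] --> 0,
      0 < d -> f x * jweight g d x @[x --> (-1)^'+] --> 0,
      g = 0 -> cvg (f x @[x --> 1^'-]) &
      d = 0 -> cvg (f x @[x --> (-1)^'+])].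

(* For f in C0 g d, the product f v extends continuously to [-1,1] and this
   supremum is the maximum of the extension of |f| v over [-1,1]. *)
Definition wnorm (g d : R) (f : R -> R) : R :=
  sup [set `|f x| * jweight g d x | x in `]-1, 1[].

Definition best_approx (g d : R) (n : nat) (f : R -> R) : R :=
  inf [set wnorm g d (fun x => f x - P.[x])
      | P in [set P : {poly R} | (size P <= n.+1)%N]].

Definition besov_sum (g d r : R) (f : R -> R) : \bar R :=
  (\sum_(1 <= n <oo) (n.+1%:R `^ (r - 1) * best_approx g d n f)%:E)%E.

Definition besov (r g d : R) (f : R -> R) : Prop :=
  C0 g d f /\ (besov_sum g d r f < +oo)%E.

Definition besov_norm (r g d : R) (f : R -> R) : R :=
  wnorm g d f + fine (besov_sum g d r f).

End Spaces.

Section VallePoussin.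
Context {R : realType}.

(* These conditions determine the sequence p uniquely for alpha, beta > -1. *)
Definition orthonormal_jacobi (alpha beta : R) (p : nat -> {poly R}) : Prop :=
  [/\ forall j, size (p j) = j.+1,
      forall j, 0 < lead_coef (p j) &
      forall i j, \int[lebesgue_measure]_(x in `[-1, 1])
        ((p i).[x] * (p j).[x] * jweight alpha beta x) = (i == j)%:R].

Definition christoffel (p : nat -> {poly R}) (n : nat) (x : R) : R :=
  (\sum_(j < n) (p j).[x] ^+ 2)^-1.

Definition VPcoef (n m j : nat) : R :=
  if (j <= n - m)%N then 1 else (n%:R + m%:R - j%:R) / (2 * m%:R).

(* The outer sum ranges over the (finitely many, simple) zeros of p n. *)
Definition VP (p : nat -> {poly R}) (n m : nat) (f : R -> R) (x : R) : R :=
  \sum_(y \in [set y | root (p n) y])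
    (f y * christoffel p n y *
     \sum_(j < n + m) (VPcoef n m j * (p j).[x] * (p j).[y])).

Definition comparable_indices (c1 c2 : R) (n m : nat) : Prop :=
  (0 < m)%N /\ c1 * m%:R <= n%:R <= c2 * m%:R.

End VallePoussin.

Section Hilbert.
Context {R : realType}.

Definition truncated_hilbert (a b : R) (f : R -> R) (t e : R) : R :=
  \int[lebesgue_measure]_(x in `[-1, 1] `&` [set x | e <= `|x - t|])
    (f x / (x - t) * jweight a b x).

Definition hilbert_exists (a b : R) (f : R -> R) (t : R) : Prop :=
  cvg (truncated_hilbert a b f t e @[e --> 0^'+]).

Definition hilbert (a b : R) (f : R -> R) (t : R) : R :=
  lim (truncated_hilbert a b f t e @[e --> 0^'+]).

Definition VP_quadrature (a b : R) (p : nat -> {poly R}) (n m : nat)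
    (f : R -> R) (t : R) : R :=
  hilbert a b (VP p n m f) t.

Definition VP_error (a b : R) (p : nat -> {poly R}) (n m : nat)
    (f : R -> R) (t : R) : R :=
  `|hilbert a b f t - VP_quadrature a b p n m f t|.

End Hilbert.

(* Main.v *)
Require Import Defs.
From mathcomp Require Import all_boot all_order all_algebra.
From mathcomp Require Import all_classical all_reals all_analysis.
From mathcomp Require Import measurable_realfun.
From mathcomp Require Import ring lra zify.
Import Order.TTheory GRing.Theory Num.Theory.
Import numFieldNormedType.Exports.
Local Open Scope classical_set_scope.
Local Open Scope ring_scope.

(** For F = f - V f one has H^u f - H^u (V f) = H^u F.  As V reproduces the
    polynomials of degree n - m (Gauss quadrature) and is bounded, |F| u1 is at most
    A = O(n^-r ||f||), and since V f has degree less than 2n, for every N >= M = 2n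
    there is a polynomial of degree N at weighted distance O(A (M/N)^r) from F.
    Such a function F is Hoelder continuous, with a constant polynomial in M: compare
    F with a polynomial of a well chosen degree N and use a crude Markov inequality,
    the weight being removed at the cost of further powers of N.  Within distance h of
    t, where h is 1 - |t| divided by a power of M, the Hoelder bound makes the
    principal value converge with value O(A); the remaining integral of
    |F u(x)| / |x - t| costs a factor ln((1 - |t|)/h) = O(ln n), and what it loses
    as t approaches an endpoint is compensated by u2(t) or, when u
    vanishes there, by the decay of F u1. *)

Set Implicit Arguments.
Unset Strict Implicit.
Unset Printing Implicit Defensive.

(** * Chebyshev expansions and a Markov inequality *)

(** Losing arbitrary powers of M is affordable: the exponent K of such a loss enters the final bound
    only through ln (M^K) = K ln M, since h = (1 - |t|) / (2 M^K). Hence no sharp weighted Markov or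
    Bernstein inequality is needed; the bound |T_k'| <= k^2 and the repeated removal of a factor 1 -
    x^2 suffice. Balancing the approximation rate r against the loss K yields the Hoelder exponent r
    / (K + r). Its smallness costs only a constant: the Hoelder constant grows like M^(K eta) + (1 -
    |t|)^(-eta), and both terms are neutralised by (2 h)^eta. The obstacle is uniformity in t near
    an endpoint where the exponent of u is positive. There u2 carries neither a vanishing power nor
    a logarithm, whereas the kernel alone would produce ln (1 / (1 - |t|)). The decay of F u1 takes
    over within a negative power of M of the endpoint, which turns this logarithm into O(ln M). The
    existence of both principal values is part of the claim: the one for V f comes from V f being a
    polynomial, the one for f by adding those of F and V f. *)

Lemma expand_poly (F : fieldType) (e : nat -> {poly F}) :
  (forall j, size (e j) = j.+1) ->
  forall n (q : {poly F}), (size q <= n)%N ->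
  exists c : nat -> F, q = \sum_(j < n) c j *: e j.
Proof.
move=> he; elim=> [|n IH] q hq.
  exists (fun=> 0); rewrite big_ord0.
  by apply/eqP; rewrite -size_poly_eq0 -leqn0.
have len : lead_coef (e n) != 0 by rewrite lead_coef_eq0 -size_poly_eq0 he.
set k := q`_n / lead_coef (e n).
have hsz : (size (q - k *: e n)%R <= n)%N.
  apply/leq_sizeP => j; rewrite leq_eqVlt => /predU1P[<-|hj].
    rewrite coefB coefZ /k lead_coefE he /= divfK ?subrr //.
    by move: len; rewrite lead_coefE he.
  rewrite coefB coefZ !nth_default ?mulr0 ?subrr ?he //.
  exact: leq_trans hq hj.
have [c hc] := IH _ hsz.
exists (fun j => if (j == n)%N then k else c j).
rewrite big_ord_recr /= eqxx.
under eq_bigr => i _ do rewrite (ltn_eqF (ltn_ord i)).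
by rewrite -hc subrK.
Qed.

Section Chebyshev.
Context {R : realType}.
Implicit Types (x : R) (q : {poly R}).

(* The pair (T_n, U_(n-1)) of Chebyshev polynomials of both kinds, built from
   the addition formulas of cos and sin. *)
Fixpoint cheb (n : nat) : {poly R} * {poly R} :=
  if n is n'.+1 then
    let TU := cheb n' in
    ('X * TU.1 - (1 - 'X * 'X) * TU.2, TU.1 + 'X * TU.2)
  else (1, 0).

(** The second identity keeps the factor [sin x] on the left, so that it holds at the multiples of
    pi as well. *)
Lemma cheb_cos n x :
  (cheb n).1.[cos x] = cos (n%:R * x) /\
  sin x * (cheb n).2.[cos x] = sin (n%:R * x).
Proof.
elim: n => [|n [IHT IHU]] /=.
  by rewrite !hornerE /= ?mul0r cos0 sin0 ?mulr0.
rewrite -[n.+1%:R]natr1 [(n%:R + 1) * x]mulrDl [1 * x]mul1r cosD sinD -IHT -IHU !hornerE; split.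
  have -> : 1 - cos x * cos x = sin x ^+ 2 by rewrite -(cos2Dsin2 x); ring.
  ring.
by ring.
Qed.

(** The two identities are proved together because each induction step uses the other: T_n' = n
    U_(n-1), and the first-order relation satisfied by U_(n-1). *)
Lemma cheb_deriv n :
  (cheb n).1^`() = n%:R *: (cheb n).2 /\
  (1 - 'X * 'X) * (cheb n).2^`() = 'X * (cheb n).2 - n%:R *: (cheb n).1.
Proof.
elim: n => [|n [IHT IHU]] /=.
  by rewrite -polyC1 derivC deriv0 mulr0n !scale0r !mulr0 subrr.
split.
  rewrite !(derivD, derivB, derivM, derivN, derivX) (_ : 1^`() = 0) ?IHT;
    last by rewrite -polyC1 derivC.
  have -> : (0 + - (1 * 'X + 'X * 1)) * (cheb n).2 + (1 - 'X * 'X) * (cheb n).2^`()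
     = - (2 * 'X * (cheb n).2)
       + ('X * (cheb n).2 - n%:R *: (cheb n).1) by rewrite IHU; ring.
  rewrite -[n.+1%:R]natr1 -!mul_polyC !polyCD; ring.
rewrite !(derivD, derivM, derivX) IHT -[n.+1%:R]natr1.
rewrite mulrDr mulrDr mul1r [_ * ('X * _^`())]mulrCA IHU -!mul_polyC !polyCD.
ring.
Qed.

Lemma size_cheb n : size (cheb n).1 = n.+1.
Proof.
(* The top coefficient of the second polynomial is read off after multiplication by 'X, which avoids
   the index n - 1 and makes n = 0 harmless. Its nonnegativity prevents a cancellation in the
   leading coefficient of T_(n+1). *)
suff [h1 h2 h3 h4] : [/\ (size (cheb n).1 <= n.+1)%N, (size (cheb n).2 <= n)%N,
     0 < (cheb n).1`_n & 0 <= ('X * (cheb n).2)`_n].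
  apply/eqP; rewrite eqn_leq h1 ltnNge; apply/negP => /leq_sizeP/(_ n (leqnn _)).
  by move=> h; rewrite h ltxx in h3.
elim: n => [|n [h1 h2 h3 h4]] /=.
  by rewrite size_poly1 size_poly0 coefC /= ltr01 mulr0 coef0; split.
set T := (cheb n).1 in h1 h3 *; set U := (cheb n).2 in h2 h4 *.
have sXU : (size ('X * U)%R <= n.+1)%N.
  by apply: leq_trans (size_polyMleq _ _) _; rewrite size_polyX.
have sXXU : (size ('X * ('X * U))%R <= n.+2)%N.
  by apply: leq_trans (size_polyMleq _ _) _; rewrite size_polyX.
have sXT : (size ('X * T)%R <= n.+2)%N.
  by apply: leq_trans (size_polyMleq _ _) _; rewrite size_polyX.
have eT : 'X * T - (1 - 'X * 'X) * U = 'X * T - U + 'X * ('X * U) by ring.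
split.
- rewrite eT; apply: leq_trans (size_polyD _ _) _; rewrite geq_max sXXU andbT.
  apply: leq_trans (size_polyD _ _) _; rewrite geq_max sXT size_polyN.
  exact: leq_trans h2 (leqW (leqnSn _)).
- by apply: leq_trans (size_polyD _ _) _; rewrite geq_max h1.
- suff -> : ('X * T - (1 - 'X * 'X) * U)`_n.+1 = T`_n + ('X * U)`_n.
    exact: ltr_wpDr h4 h3.
  rewrite eT coefD coefB !coefXM /= [U`_n.+1]nth_default ?subr0 //.
  exact: leq_trans h2 _.
- rewrite coefXM /= coefD; apply/ltW; exact: ltr_wpDr.
Qed.

(** Each step of the recurrence adds a value of T_n, of modulus at most 1 on [-1, 1], so no division
    by [sin] is involved. *)
Lemma cheb2_bound n x : `|x| <= 1 -> `|(cheb n).2.[x]| <= n%:R.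
Proof.
move=> hx; elim: n => [|n IH] /=; first by rewrite horner0 normr0.
rewrite !hornerE -[n.+1%:R]natr1 addrC; apply: le_trans (ler_normD _ _) _.
apply: lerD; first by rewrite normrM (le_trans _ IH) // ler_piMl.
have /andP[? ?] : -1 <= x <= 1 by rewrite -ler_norml.
by rewrite -[x]acosK ?in_itv /= ?(cheb_cos n _).1 ?cos_max //; apply/andP.
Qed.

(** Angles whose cosines are the n zeros of T_n. *)
Let node n k : R := k.*2.+1%:R * (pi / n.*2%:R).

(** Multiplied by 2 sin h, with h = j pi / (2n), the sum telescopes to sin (j pi) = 0; the range of
    j makes sin h positive. *)
Lemma sum_cos_node n j : (0 < j < n.*2)%N ->
  \sum_(k < n) cos (j%:R * node n k) = 0.
Proof.
move=> /andP[j0 jn].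
have n0 : (0 < n)%N by case: n jn.
pose h : R := j%:R * (pi / n.*2%:R).
have n20 : n.*2%:R != 0 :> R by rewrite pnatr_eq0 double_eq0 -lt0n.
have hs : 0 < sin h.
  apply: sin_gt0_pi; rewrite /h ?mulr_gt0 ?invr_gt0 ?ltr0n ?pi_gt0 ?double_gt0 //.
  rewrite mulrCA -[ltRHS]mulr1 ltr_pM2l ?pi_gt0 //.
  by rewrite ltr_pdivrMr ?mul1r ?ltr_nat // ltr0n double_gt0.
have step k : 2 * sin h * cos (j%:R * node n k)
    = sin (k.+1.*2%:R * h) - sin (k.*2%:R * h).
  have -> : j%:R * node n k = k.*2%:R * h + h by rewrite /node /h -[k.*2.+1%:R]natr1; ring.
  have -> : k.+1.*2%:R * h = k.*2%:R * h + h + h.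
    by rewrite doubleS -[k.*2.+2%:R]natr1 -[k.*2.+1%:R]natr1; ring.
  set y := _ + h; have -> : k.*2%:R * h = y - h by rewrite /y addrK.
  by rewrite sinB sinD; ring.
have : 2 * sin h * \sum_(k < n) cos (j%:R * node n k) = 0.
  rewrite mulr_sumr; under eq_bigr do rewrite step.
  rewrite -(big_mkord xpredT (fun k => sin (k.+1.*2%:R * h) - sin (k.*2%:R * h))).
  rewrite (telescope_sumr (fun k => sin (k.*2%:R * h))) //.
  have -> : n.*2%:R * h = j%:R * pi by rewrite /h; field.
  rewrite double0 mul0r sin0 subr0 mulr_natl.
  elim: (j) => [|i IH]; first by rewrite sin0.
  by rewrite mulrS sinD sinpi IH mul0r mulr0 addr0.
by move=> /eqP; rewrite !mulf_eq0 pnatr_eq0 /= (gt_eqF hs) => /eqP.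
Qed.

Lemma cos_node_orthogonal n i j : (i < n)%N -> (j < n)%N -> i != j ->
  \sum_(k < n) cos (i%:R * node n k) * cos (j%:R * node n k) = 0.
Proof.
wlog ij : i j / (i < j)%N.
  move=> H hi hj; case: (ltngtP i j) => // h _; first by apply: H => //; lia.
  under eq_bigr do rewrite mulrC.
  by apply: H => //; lia.
move=> hi hj _.
have e k : cos (i%:R * node n k) * cos (j%:R * node n k) =
   2^-1 * (cos ((i + j)%:R * node n k) + cos ((j - i)%:R * node n k)).
  rewrite natrD natrB ?(ltnW ij) // mulrDl mulrBl cosD cosB.
  by field.
under eq_bigr do rewrite e.
rewrite -mulr_sumr big_split /= !sum_cos_node ?addr0 ?mulr0 //; lia.
Qed.

Lemma cos_node_sqr n j : (j < n)%N ->
  n%:R / 2 <= \sum_(k < n) cos (j%:R * node n k) ^+ 2.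
Proof.
case: j => [|j] hj.
  under eq_bigr do rewrite mul0r cos0 expr1n.
  by rewrite sumr_const card_ord ler_pdivrMr // ler_peMr ?ler0n // ler1n.
have e k : cos (j.+1%:R * node n k) ^+ 2 =
   2^-1 * (1 + cos ((j.+1).*2%:R * node n k)).
  by rewrite -addnn natrD mulrDl cosD -!expr2 sin2cos2; field.
under eq_bigr do rewrite e.
rewrite -mulr_sumr big_split /= sum_cos_node ?addr0; last lia.
by rewrite sumr_const card_ord mulrC.
Qed.

(* Discrete orthogonality of the Chebyshev polynomials at the zeros of T_n isolates
   each coefficient. *)
Lemma cheb_coef_bound n (c : nat -> R) A : 0 <= A ->
  (forall x, -1 <= x <= 1 -> `|(\sum_(j < n) c j *: (cheb j).1).[x]| <= A) ->
  forall j, (j < n)%N -> `|c j| <= 2 * A.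
Proof.
move=> A0 hA j jn.
set q := \sum_(j < n) _ in hA.
have n0 : (0 < n)%N by apply: leq_ltn_trans jn.
have qc t : q.[cos t] = \sum_(i < n) c i * cos (i%:R * t).
  by rewrite horner_sum; apply: eq_bigr => i _; rewrite hornerZ (cheb_cos _ _).1.
have e : \sum_(k < n) q.[cos (node n k)] * cos (j%:R * node n k)
   = c j * \sum_(k < n) cos (j%:R * node n k) ^+ 2.
  under eq_bigr do rewrite qc mulr_suml.
  rewrite exchange_big /= (bigD1 (Ordinal jn)) //= [X in _ + X]big1 ?addr0.
    by rewrite mulr_sumr; apply: eq_bigr => k _; rewrite expr2 mulrA.
  move=> i hi; under eq_bigr do rewrite -mulrA.
  by rewrite -mulr_sumr cos_node_orthogonal ?mulr0.
have h1 : `|c j| * (n%:R / 2) <= n%:R * A.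
  apply: (@le_trans _ _ (`|c j| * `|\sum_(k < n) cos (j%:R * node n k) ^+ 2|)).
    by rewrite ler_wpM2l //; apply: le_trans (ler_norm _); exact: cos_node_sqr.
  rewrite -normrM -e; apply: le_trans (ler_norm_sum _ _ _) _.
  apply: (@le_trans _ _ (\sum_(k < n) A)).
    apply: ler_sum => k _; rewrite normrM -[A]mulr1.
    by apply: ler_pM => //; [apply: hA; rewrite cos_geN1 cos_le1|exact: cos_max].
  by rewrite sumr_const card_ord mulr_natl.
have : n%:R * `|c j| <= n%:R * (2 * A) by nra.
by rewrite ler_pM2l // ltr0n.
Qed.

(** The Chebyshev expansion is differentiated term by term: n coefficients of size at most 2A, each
    with |T_k'| = k |U_(k-1)| <= n^2. The cube exceeds the sharp square, but any power will do
    here. *)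
Lemma markov_poly n q A x : 0 <= A -> (size q <= n)%N -> -1 <= x <= 1 ->
  (forall x, -1 <= x <= 1 -> `|q.[x]| <= A) ->
  `|q^`().[x]| <= 2 * n%:R ^+ 3 * A.
Proof.
move=> A0 hq hx hA.
have [c hc] := expand_poly size_cheb hq.
rewrite hc in hA *.
have hb := cheb_coef_bound A0 hA.
rewrite raddf_sum /= horner_sum; apply: le_trans (ler_norm_sum _ _ _) _.
apply: (@le_trans _ _ (\sum_(k < n) 2 * n%:R ^+ 2 * A)).
  apply: ler_sum => k _.
  rewrite poly.derivZ (cheb_deriv k).1 !hornerZ !normrM normr_nat.
  have -> : 2 * n%:R ^+ 2 * A = 2 * A * (n%:R * n%:R) by ring.
  have hk : k%:R <= n%:R :> R by rewrite ler_nat ltnW.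
  apply: ler_pM => //; first exact: hb.
  apply: ler_pM => //; apply: le_trans hk; apply: cheb2_bound.
  by rewrite ler_norml.
by rewrite sumr_const card_ord -mulr_natr exprS le_eqVlt; apply/orP; left; apply/eqP; ring.
Qed.

End Chebyshev.

Lemma poly_lipschitz (R : realType) (q : {poly R}) D x y :
  (forall z, -1 <= z <= 1 -> `|q^`().[z]| <= D) ->
  -1 <= x <= 1 -> -1 <= y <= 1 -> `|q.[x] - q.[y]| <= D * `|x - y|.
Proof.
wlog xy : x y / y <= x.
  move=> H hD hx hy; case: (leP y x) => h; first exact: H.
  by rewrite distrC [`|x - y|]distrC; apply: H => //; exact: ltW.
move=> hD hx hy.
have hd z : z \in `]y, x[ -> is_derive z 1 (horner q) q^`().[z].
  by move=> _; exact: is_derive_poly.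
have [|c hc ->] := MVT_segment xy hd.
  by apply: continuous_subspaceT; exact: continuous_horner.
rewrite normrM ler_wpM2r //; apply: hD.
by move: hc; rewrite in_itv /=; lra.
Qed.

(* The polynomial q (1 - x^2) vanishes at both endpoints, so that its value at x is
   at most the distance of x to an endpoint times the Markov bound. *)
Lemma unweight_step (R : realType) n (q : {poly R}) A x : 0 <= A -> (size q <= n)%N ->
  (forall x, -1 < x < 1 -> `|q.[x]| * (1 - x ^+ 2) <= A) ->
  -1 <= x <= 1 -> `|q.[x]| <= 2 * (n.+2)%:R ^+ 3 * A.
Proof.
move=> A0 hq hA hx.
set P := q * (1 - 'X^2); set D := 2 * _ * A.
have sP : (size P <= n.+2)%N.
  have [q0|q0] := eqVneq q 0; first by rewrite /P q0 mul0r size_poly0.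
  apply: leq_trans (size_polyMleq _ _) _.
  have -> : size (1 - 'X^2 : {poly R}) = 3%N.
    by rewrite -opprB size_polyN -polyC1 size_XnsubC.
  by lia.
have PE z : P.[z] = q.[z] * (1 - z ^+ 2) by rewrite /P !hornerE.
have hP z : -1 <= z <= 1 -> `|P.[z]| <= A.
  move=> hz; rewrite PE normrM.
  have [z1|z1] := eqVneq z 1; first by rewrite z1 expr1n subrr normr0 mulr0.
  have [z2|z2] := eqVneq z (-1); first by rewrite z2 sqrrN expr1n subrr normr0 mulr0.
  have hz' : -1 < z < 1 by rewrite !lt_neqAle z1 [-1 == z]eq_sym z2.
  by rewrite [`|1 - _|]ger0_norm; [exact: hA | nra].
have hD z : -1 <= z <= 1 -> `|P^`().[z]| <= D.
  by move=> hz; apply: markov_poly A0 sP hz hP.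
have P'E z : P^`().[z] = q^`().[z] * (1 - z ^+ 2) - 2 * z * q.[z].
  rewrite /P !(derivM, derivB, derivXn, derivD, derivN) -polyC1 derivC /= expr1.
  rewrite !hornerE /= ; ring.
have P1 : P.[1] = 0 by rewrite PE; ring.
have PN1 : P.[-1] = 0 by rewrite PE; ring.
have D0 : 0 <= D by rewrite !mulr_ge0 ?exprn_ge0.
(* At an endpoint P' = -2 x q, so the Markov bound for P' controls q directly. *)
have [x1|x1] := eqVneq x 1.
  have := hD 1; rewrite P'E x1 => /(_ ltac:(lra)).
  have -> : q^`().[1] * (1 - 1 ^+ 2) - 2 * 1 * q.[1] = - (2 * q.[1]) by ring.
  by rewrite normrN normrM normr_nat; have := normr_ge0 q.[1]; lra.
have [x2|x2] := eqVneq x (-1).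
  have := hD (-1); rewrite P'E x2 => /(_ ltac:(lra)).
  have -> : q^`().[-1] * (1 - (-1) ^+ 2) - 2 * -1 * q.[-1] = 2 * q.[-1] by ring.
  by rewrite normrM normr_nat; have := normr_ge0 q.[-1]; lra.
have hx' : -1 < x < 1 by rewrite !lt_neqAle x1 [-1 == x]eq_sym x2.
have hx2 : 0 <= 1 - x ^+ 2 by nra.
have i1 : -1 <= (1 : R) <= 1 by lra.
have i2 : -1 <= (-1 : R) <= 1 by lra.
have q0 := normr_ge0 q.[x].
(* With the nearer endpoint, the other factor of 1 - x^2 is at least 1. *)
have [x0|x0] := leP 0 x.
  have := poly_lipschitz hD hx i1.
  rewrite P1 subr0 PE normrM (ger0_norm hx2).
  rewrite distrC [X in D * X]ger0_norm; last lra.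
  move=> h; have h' : (1 - x) * (`|q.[x]| * (1 + x)) <= (1 - x) * D by nra.
  by rewrite ler_pM2l in h'; nra.
have := poly_lipschitz hD hx i2.
rewrite PN1 subr0 PE normrM (ger0_norm hx2) opprK.
rewrite [X in D * X]ger0_norm; last lra.
move=> h; have h' : (1 + x) * (`|q.[x]| * (1 - x)) <= (1 + x) * D by nra.
by rewrite ler_pM2l in h'; nra.
Qed.

(** Factors 1 - x^2 are removed one at a time, each at the price of a cube of the degree. The
    induction hypothesis is applied to q (1 - X^2), two degrees higher, whence the shift by
    [k.*2]. *)
Lemma unweight (R : realType) k n (q : {poly R}) A x : 0 <= A -> (size q <= n)%N ->
  (forall x, -1 < x < 1 -> `|q.[x]| * (1 - x ^+ 2) ^+ k <= A) -> -1 < x < 1 ->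
  `|q.[x]| <= (2 * (n + k.*2)%:R ^+ 3) ^+ k * A.
Proof.
move=> A0; elim: k n q x => [|k IH] n q x hq hA hx.
  by rewrite expr0 mul1r; have := hA x hx; rewrite expr0 mulr1.
have B0 m : 0 <= 2 * m%:R ^+ 3 :> R by rewrite mulr_ge0 ?exprn_ge0.
have sq : (size (q * (1 - 'X^2))%R <= n.+2)%N.
  have [->|q0] := eqVneq q 0; first by rewrite mul0r size_poly0.
  apply: leq_trans (size_polyMleq _ _) _.
  have -> : size (1 - 'X^2 : {poly R}) = 3%N.
    by rewrite -opprB size_polyN -polyC1 size_XnsubC.
  by lia.
have qE z : (q * (1 - 'X^2)).[z] = q.[z] * (1 - z ^+ 2) by rewrite !hornerE.
apply: (le_trans (unweight_step (A := (2 * (n + k.+1.*2)%:R ^+ 3) ^+ k * A) _ hq _ _)).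
- by rewrite mulr_ge0 ?exprn_ge0.
- move=> z hz; have z2 : 0 <= 1 - z ^+ 2 by nra.
  rewrite -(ger0_norm z2) -normrM -qE.
  have -> : (n + k.+1.*2 = n.+2 + k.*2)%N by lia.
  apply: IH => // y hy; have y2 : 0 <= 1 - y ^+ 2 by nra.
  by rewrite qE normrM (ger0_norm y2) -mulrA -exprS; exact: hA.
- by lra.
- rewrite [X in _ <= X * _]exprS -[leRHS]mulrA ler_wpM2r ?mulr_ge0 ?exprn_ge0 //.
  by rewrite ler_wpM2l // lerXn2r ?nnegrE ?ler0n // ler_nat; lia.
Qed.

(** * Polynomial bounds under a Jacobi weight *)

Lemma jweight_ge0 (R : realType) (g d x : R) : 0 <= jweight g d x.
Proof. by rewrite mulr_ge0 ?powR_ge0. Qed.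

Lemma jweight_gt0 (R : realType) (g d x : R) : -1 < x < 1 -> 0 < jweight g d x.
Proof. by move=> ?; rewrite mulr_gt0 ?powR_gt0 //; lra. Qed.

Lemma powR_ratio (R : realType) (s y z : R) : 0 < y -> y <= 2 * z -> z <= 2 * y ->
  y `^ s <= 2 `^ `|s| * z `^ s.
Proof.
move=> y0 yz zy; have z0 : 0 < z by lra.
have [s0|s0] := leP 0 s.
  by rewrite ger0_norm // -powRM ?ge0_ler_powR ?nnegrE; do ?lra.
rewrite -[s]opprK normrN (powRN y) (powRN z).
rewrite ler_pdivlMr ?powR_gt0 // mulrC ler_pdivrMr ?powR_gt0 // gtr0_norm; last lra.
by rewrite -powRM ?ge0_ler_powR ?nnegrE; do ?lra.
Qed.

(** Lets a real exponent be replaced by a larger integer one, as [unweight] requires. *)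
Lemma powR_natr_le (R : realType) (g y : R) k : 0 < y <= 2 -> 0 <= g <= k%:R ->
  y ^+ k <= 2 ^+ k * y `^ g.
Proof.
move=> hy hg; have y0 : 0 < y by lra.
rewrite -powR_mulrn ?(ltW y0) // -[X in y `^ X](subrK g) powRD; last by rewrite (gt_eqF y0) implybT.
rewrite ler_wpM2r ?powR_ge0 //.
apply: (@le_trans _ _ (2 `^ (k%:R - g))).
  by rewrite ge0_ler_powR ?nnegrE; lra.
by rewrite -powR_mulrn ?ler_powR //; lra.
Qed.

(** For an integer k above both exponents the weight dominates 4^(-k) (1 - x^2)^k, so [unweight]
    bounds q on the open interval; a Markov inequality then handles the derivative. *)
Lemma jweight_poly_bound (R : realType) (g d : R) : 0 <= g -> 0 <= d ->
  exists C K, 0 < C /\ forall n (q : {poly R}) A, (0 < n)%N -> 0 <= A ->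
    (size q <= n.+1)%N ->
    (forall x, -1 < x < 1 -> `|q.[x]| * jweight g d x <= A) ->
    forall x, -1 <= x <= 1 ->
      `|q.[x]| <= C * n%:R ^+ K * A /\ `|q^`().[x]| <= C * n%:R ^+ K * A.
Proof.
move=> g0 d0.
have [k [gk dk]] : exists k : nat, g <= k%:R /\ d <= k%:R.
  exists (Num.truncn (g + d)).+1.
  have : g + d < (Num.truncn (g + d)).+1%:R by apply: truncnS_gt.
  by move=> h; split; lra.
set B : R := (8 * (2 + k.*2)%:R ^+ 3) ^+ k.
have B1 : 0 < B by rewrite exprn_gt0 // mulr_gt0 // exprn_gt0.
(* The factors: B n^(3k) from [unweight]; 128 n^3 >= 2 (n + 3)^3 from the passage to the closed
   interval; 16 n^3 >= 2 (n + 1)^3 from [markov_poly]. *)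
exists (16 * 128 * B), (k * 3 + 6)%N; split; first by rewrite mulr_gt0.
move=> n q A n0 A0 hq hA.
have n1 : 1 <= n%:R :> R by rewrite ler1n.
pose A1 := B * n%:R ^+ (k * 3) * A.
pose A' := 128 * n%:R ^+ 3 * A1.
have A10 : 0 <= A1 by rewrite !mulr_ge0 ?exprn_ge0 // ltW.
have A'0 : 0 <= A' by rewrite !mulr_ge0 ?exprn_ge0 // ltW.
have hb x : -1 < x < 1 -> `|q.[x]| <= A1.
  move=> hx.
  apply: (le_trans (unweight (k := k) (A := 4 ^+ k * A) _ hq _ hx)).
  - by rewrite mulr_ge0 ?exprn_ge0.
  - move=> y hy; have -> : 1 - y ^+ 2 = (1 - y) * (1 + y) by ring.
    rewrite exprMn; apply: (@le_trans _ _ (`|q.[y]| * (4 ^+ k * jweight g d y))).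
      rewrite ler_wpM2l // /jweight.
      have -> : 4 ^+ k * ((1 - y) `^ g * (1 + y) `^ d) =
        (2 ^+ k * (1 - y) `^ g) * (2 ^+ k * (1 + y) `^ d) :> R.
        have -> : 4 = 2 * 2 :> R by ring.
        by rewrite exprMn; ring.
      by apply: ler_pM; rewrite ?exprn_ge0 ?powR_natr_le //; lra.
    by rewrite mulrCA ler_wpM2l ?exprn_ge0 // hA.
  - rewrite mulrA -exprMn /A1 ler_wpM2r // /B mulnC exprM -exprMn.
    rewrite lerXn2r ?nnegrE ?mulr_ge0 ?exprn_ge0 //.
    have -> : 2 * (n.+1 + k.*2)%:R ^+ 3 * 4 = 8 * (n.+1 + k.*2)%:R ^+ 3 :> R by ring.
    rewrite -mulrA -exprMn ler_wpM2l // lerXn2r ?nnegrE ?mulr_ge0 //.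
    rewrite -natrM ler_nat mulnDl; apply: leq_add; last by rewrite leq_pmulr.
    by rewrite mul2n -addnn -addn1 leq_add2l.
(* As 1 - x^2 <= 1, one further [unweight_step] extends the bound from the open interval to the
   endpoints. *)
have hb' x : -1 <= x <= 1 -> `|q.[x]| <= A'.
  move=> hx; apply: (le_trans (unweight_step A10 hq _ hx)).
    move=> y hy; apply: le_trans (hb y hy); rewrite ler_piMr //.
    by have := sqr_ge0 y; lra.
  rewrite ler_wpM2r //.
  have -> : 128 * n%:R ^+ 3 = 2 * (4 * n%:R) ^+ 3 :> R by ring.
  rewrite ler_wpM2l // lerXn2r ?nnegrE ?mulr_ge0 // -natrM ler_nat; clear - n0; lia.
have e3 : 1 <= n%:R ^+ 3 :> R by rewrite exprn_ege1.
move=> x hx'.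
split.
  apply: le_trans (hb' _ hx') _.
  have -> : 16 * 128 * B * n%:R ^+ (k * 3 + 6) * A = 16 * n%:R ^+ 3 * A'.
    by rewrite /A' /A1 exprD -[6%N]/(3 + 3)%N exprD; ring.
  by rewrite ler_peMl //; lra.
apply: (le_trans (markov_poly A'0 hq hx' hb')).
have -> : 16 * 128 * B * n%:R ^+ (k * 3 + 6) * A = 2 * (2 * n%:R) ^+ 3 * A'.
  by rewrite /A' /A1 exprMn exprD -[6%N]/(3 + 3)%N exprD; ring.
rewrite ler_wpM2r // ler_wpM2l // lerXn2r ?nnegrE ?mulr_ge0 //.
by rewrite -natr1; lra.
Qed.

(** * Integrals of powers *)

Section PowerIntegrals.
Context {R : realType}.
Implicit Types (f G k K : R -> R) (a b c d r s t C : R).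
Notation mu := (@lebesgue_measure R).

(* An improper integral of a nonnegative function is bounded by the
   oscillation of an antiderivative on the open interval. *)
Lemma ge0_integral_osc_le f G a b C : 0 <= C ->
  (forall x, a < x < b -> {for x, continuous f}) ->
  (forall x, a < x < b -> 0 <= f x) ->
  (forall x, a < x < b -> is_derive x (1 : R) G (f x)) ->
  (forall x y, a < x -> x < y -> y < b -> G y - G x <= C) ->
  (\int[mu]_(x in `]a, b[) (f x)%:E <= C%:E)%E.
Proof.
move=> C0 cf f0 dG hC.
have [ab|ba] := ltP a b; last first.
  by rewrite set_itv_ge ?integral_set0 ?lee_fin // bnd_simp -leNgt.
pose e (n : nat) := (b - a) / n.+3%:R.
pose F n := `[a + e n, b - e n]%classic : set R.
have e0 n : 0 < e n by rewrite divr_gt0 ?subr_gt0.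
have en n : e n < (b - a) / 2.
  by rewrite ltr_pM2l ?subr_gt0 // ltf_pV2 ?posrE ?ltr0n // ltr_nat.
have sub n x : x \in `[a + e n, b - e n] -> a < x < b.
  by rewrite !in_itv /=; have := e0 n; lra.
have cF n : {within F n, continuous f}.
  by apply: continuous_in_subspaceT => x; rewrite inE => /sub; exact: cf.
have mF n : measurable (F n) by exact: measurable_itv.
have ndF : nondecreasing_seq F.
  move=> n m nm; apply/subsetPset => x; rewrite /F /= !in_itv /=.
  have : e m <= e n by rewrite ler_pM2l ?subr_gt0 // lef_pV2 ?posrE ?ltr0n // ler_nat.
  by move=> ? ?; lra.
have bF : \bigcup_n F n = `]a, b[%classic.
  apply/seteqP; split=> [x [n _ /sub]|x]; first by rewrite /= in_itv.
  rewrite /= in_itv /= => /andP[ax xb].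
  have m0 : 0 < Num.min (x - a) (b - x) by rewrite lt_min !subr_gt0 ax.
  pose n := Num.truncn ((b - a) / Num.min (x - a) (b - x)).
  have hn : (b - a) / Num.min (x - a) (b - x) < n.+3%:R.
    by apply: (lt_le_trans (truncnS_gt _)); rewrite ler_nat !ltnS leqW.
  have hen : e n < Num.min (x - a) (b - x).
    by rewrite ltr_pdivrMr // mulrC -ltr_pdivrMr.
  exists n => //; rewrite /F /= in_itv /=.
  by move: hen; rewrite lt_min; lra.
rewrite -bF.
have h : (\int[mu]_(x in F n) (f x)%:E @[n --> \oo] -->
          \int[mu]_(x in \bigcup_n F n) (f x)%:E)%E.
  apply: ge0_nondecreasing_set_cvg_integral => //.
    move=> n; apply/measurable_EFinP.
    exact: subspace_continuous_measurable_fun.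
  by move=> n x /sub /f0; rewrite lee_fin.
apply: (cvge_to_le h).
near=> n.
have hab : a + e n < b - e n by have := en n; lra.
have cG x : a < x < b -> {for x, continuous G}.
  by move=> hx; apply/differentiable_continuous/derivable1_diffP; have [] := dG x hx.
have en0 := e0 n.
rewrite (continuous_FTC2 hab (cF n) (F := G)).
- by rewrite -EFinB lee_fin; apply: hC; lra.
- split => [x /subset_itv_oo_cc/sub /dG[] //| |].
    by apply: cvg_at_right_filter; apply: cG; lra.
  by apply: cvg_at_left_filter; apply: cG; lra.
- by move=> x /subset_itv_oo_cc/sub hx; rewrite derive1E; have [] := dG x hx.
Unshelve. all: by end_near. Qed.

(** With s = 1 or s = -1 the affine form runs through x - t, t - x, 1 + x and 1 - x, so powers of
    all these distances are integrated once and for all. *)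
Definition zone r s c d : set R := [set x | c < r + s * x < d].

Lemma zoneE r s c d : s = 1 \/ s = -1 ->
  zone r s c d = if s == 1 then `]c - r, d - r[%classic else `]r - d, r - c[%classic.
Proof.
have n1 : (-1 == 1 :> R) = false by apply/negbTE/eqP; lra.
by case=> ->; rewrite ?eqxx ?n1; apply/seteqP;
  split=> x /=; rewrite /zone /= in_itv /= => ?; lra.
Qed.

Lemma measurable_zone r s c d : s = 1 \/ s = -1 -> measurable (zone r s c d).
Proof. by move=> hs; rewrite zoneE //; case: ifP. Qed.

Lemma zone_integral_osc_le k K r s c d C : s = 1 \/ s = -1 -> 0 <= C ->
  (forall x, c < x < d -> {for x, continuous k}) ->
  (forall x, c < x < d -> 0 <= k x) ->
  (forall x, c < x < d -> is_derive x (1 : R) K (k x)) ->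
  (forall x y, c < x -> x < y -> y < d -> K y - K x <= C) ->
  (\int[mu]_(x in zone r s c d) (k (r + s * x))%:E <= C%:E)%E.
Proof.
move=> hs C0 ck k0 dK hC; rewrite zoneE //.
have ca x : {for x, continuous (fun x => r + s * x)}.
  by apply: continuousD; [exact: cst_continuous | exact: mulrl_continuous].
have da x : is_derive x (1 : R) (fun x => r + s * x) s.
  have h := is_deriveD (is_derive_cst r x 1) (is_deriveZ s (is_derive_id x 1)).
  by rewrite scaler1 add0r in h.
have n1 : (-1 == 1 :> R) = false by apply/negbTE/eqP; lra.
case: hs => hs; rewrite {1}hs ?eqxx ?n1.
- apply: (@ge0_integral_osc_le _ (fun x => K (r + s * x))) => //.
  + move=> x hx; apply: continuous_comp; first exact: ca.
    by apply: ck; rewrite hs; lra.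
  + by move=> x hx; apply: k0; rewrite hs; lra.
  + move=> x hx; have dk := dK (r + s * x) ltac:(rewrite hs; lra).
    have := @is_derive1_comp _ K (fun x => r + s * x) x _ _ dk (da x).
    by rewrite hs mulr1.
  + by move=> x y ax xy yb; rewrite hs hC //; lra.
- apply: (@ge0_integral_osc_le _ (fun x => - K (r + s * x))) => //.
  + move=> x hx; apply: continuous_comp; first exact: ca.
    by apply: ck; rewrite hs; lra.
  + by move=> x hx; apply: k0; rewrite hs; lra.
  + move=> x hx; have dk := dK (r + s * x) ltac:(rewrite hs; lra).
    have := is_deriveN (@is_derive1_comp _ K (fun x => r + s * x) x _ _ dk (da x)).
    by rewrite hs mulrN1 opprK.
  + by move=> x y ax xy yb; rewrite hs -opprD opprB hC //; lra.
Qed.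

Lemma is_derive_powR_div s (x : R) : 0 < x -> s != -1 ->
  is_derive x (1 : R) (fun y => y `^ (s + 1) / (s + 1)) (x `^ s).
Proof.
move=> x0 s1; have s10 : s + 1 != 0 by rewrite addr_eq0.
have h := is_deriveZ (s + 1)^-1 (is_derive1_powR (s + 1) x0).
have -> : x `^ s = (s + 1)^-1 *: ((s + 1) * x `^ (s + 1 - 1)).
  by rewrite /GRing.scale /= mulKf // addrK.
rewrite (_ : (fun y => _) = (s + 1)^-1 \*: (fun y => y `^ (s + 1))) //.
by apply/funext => y; rewrite /= mulrC.
Qed.

Lemma continuous_powR s (x : R) : 0 < x -> {for x, continuous (fun y => y `^ s)}.
Proof.
move=> x0; apply/differentiable_continuous/derivable1_diffP.
by have [] := is_derive1_powR s x0.
Qed.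

(** The bound is free of c, so the zone may reach the singularity at 0. For exponents below -1 it is
    instead d that disappears, and the exponent -1 leaves a logarithm; these regimes later separate
    the signs of the exponent of u at an endpoint. *)
Lemma zone_powR_gt s r t c d : t = 1 \/ t = -1 -> -1 < s -> 0 <= c -> 0 <= d ->
  (\int[mu]_(x in zone r t c d) ((r + t * x) `^ s)%:E
     <= (d `^ (s + 1) / (s + 1))%:E)%E.
Proof.
move=> ht s1 c0 d0; have s10 : 0 < s + 1 by lra.
apply: (zone_integral_osc_le (K := fun y => y `^ (s + 1) / (s + 1))
  (k := fun y => y `^ s)) => //.
- by rewrite divr_ge0 ?powR_ge0 ?ltW.
- by move=> x hx; apply: continuous_powR; lra.
- by move=> x _; exact: powR_ge0.
- by move=> x hx; apply: is_derive_powR_div; [lra | apply/eqP; lra].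
- move=> x y cx xy yd; apply: (@le_trans _ _ (y `^ (s + 1) / (s + 1))).
    by rewrite gerBl; apply: divr_ge0; [exact: powR_ge0 | exact: ltW].
  by rewrite ler_pM2r ?invr_gt0 // ge0_ler_powR ?nnegrE; lra.
Qed.

Lemma zone_powR_lt s r t c d : t = 1 \/ t = -1 -> s < -1 -> 0 < c ->
  (\int[mu]_(x in zone r t c d) ((r + t * x) `^ s)%:E
     <= (c `^ (s + 1) / - (s + 1))%:E)%E.
Proof.
move=> ht s1 c0; have s10 : 0 < - (s + 1) by lra.
apply: (zone_integral_osc_le (K := fun y => y `^ (s + 1) / (s + 1))
  (k := fun y => y `^ s)) => //.
- by rewrite divr_ge0 ?powR_ge0 ?ltW.
- by move=> x hx; apply: continuous_powR; lra.
- by move=> x _; exact: powR_ge0.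
- by move=> x hx; apply: is_derive_powR_div; [lra | apply/eqP; lra].
- move=> x y cx xy yd; set e := - (s + 1) in s10 *.
  have e1 : s + 1 = - e by rewrite opprK.
  clearbody e; rewrite !e1.
  have h z : z / - e = - (z / e) by rewrite invrN mulrN.
  rewrite !h opprK addrC; apply: (@le_trans _ _ (x `^ (- e) / e)).
    by rewrite gerBl; apply: divr_ge0; [exact: powR_ge0 | exact: ltW].
  rewrite ler_pM2r ?invr_gt0 // !powRN lef_pV2 ?posrE ?powR_gt0 //; last lra.
  by rewrite ge0_ler_powR ?nnegrE; lra.
Qed.

Lemma zone_inv r t c d : t = 1 \/ t = -1 -> 0 < c -> c <= d ->
  (\int[mu]_(x in zone r t c d) ((r + t * x) `^ (-1))%:E <= (ln (d / c))%:E)%E.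
Proof.
move=> ht c0 cd; have d0 : 0 < d by lra.
apply: (zone_integral_osc_le (K := @ln R) (k := fun y => y `^ (-1))) => //.
- by rewrite ln_ge0 // ler_pdivlMr // mul1r.
- by move=> x hx; apply: continuous_powR; lra.
- by move=> x _; exact: powR_ge0.
- by move=> x hx; rewrite powR_inv1; [apply: is_derive1_ln; lra | lra].
- move=> x y cx xy yd; rewrite -ln_div ?posrE; do ?lra.
  rewrite ler_ln ?posrE ?divr_gt0; do ?lra.
  apply: ler_pM; rewrite ?invr_ge0 ?lef_pV2 ?posrE; lra.
Qed.

End PowerIntegrals.

Section IntegralBounds.
Context {R : realType}.
Implicit Types (f g : R -> R) (E S : set R) (C K M : R).
Notation mu := (@lebesgue_measure R).
Notation I11 := (`]-1, 1[%classic : set R).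

Lemma int_le_setU E S f C1 C2 : measurable E -> measurable S ->
  measurable_fun E f -> (forall x, E x -> 0 <= f x) ->
  (\int[mu]_(x in E `&` S) (f x)%:E <= C1%:E)%E ->
  (\int[mu]_(x in E `&` ~` S) (f x)%:E <= C2%:E)%E ->
  (\int[mu]_(x in E) (f x)%:E <= (C1 + C2)%:E)%E.
Proof.
move=> mE mS mf f0 h1 h2.
have EE : E = (E `&` S) `|` (E `&` ~` S) by rewrite -setIUr setUv setIT.
rewrite [X in (\int[mu]_(x in X) _)%E]EE ge0_integral_setU.
- by rewrite EFinD leeD.
- exact: measurableI.
- by apply: measurableI => //; exact: measurableC.
- by rewrite -EE; apply/measurable_EFinP.
- by move=> x; rewrite -EE lee_fin; exact: f0.
- by rewrite disj_set2E setIACA setICr setI0.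
Qed.

Lemma int_le_dom E S f g C : measurable E -> measurable S -> E `<=` S ->
  measurable_fun E f -> measurable_fun S g ->
  (forall x, S x -> 0 <= g x) ->
  (forall x, E x -> 0 <= f x <= g x) ->
  (\int[mu]_(x in S) (g x)%:E <= C%:E)%E ->
  (\int[mu]_(x in E) (f x)%:E <= C%:E)%E.
Proof.
move=> mE mS ES mf mg g0 fg; apply: le_trans.
apply: (@le_trans _ _ (\int[mu]_(x in E) (g x)%:E)%E).
  apply: ge0_le_integral => //.
  - by move=> x /fg/andP[]; rewrite lee_fin.
  - exact/measurable_EFinP.
  - by apply/measurable_EFinP; exact: measurable_funS mg.
  - by move=> x /fg/andP[]; rewrite lee_fin.
apply: ge0_subset_integral => //; first exact/measurable_EFinP.
Qed.

Lemma measurable_zone_powR r (t : R) s S : measurable_fun S (fun x : R => (r + t * x) `^ s).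
Proof.
apply: measurable_funTS.
apply: (@measurableT_comp _ _ _ _ _ _ (fun y : R => y `^ s)) => //.
by apply: measurable_funD => //; apply: measurable_funM.
Qed.

Lemma int_le_powR E f r (t : R) s c d K M : t = 1 \/ t = -1 -> measurable E ->
  measurable_fun E f -> 0 <= M ->
  (\int[mu]_(x in zone r t c d) ((r + t * x) `^ s)%:E <= K%:E)%E ->
  (forall x, E x -> c < r + t * x < d) ->
  (forall x, E x -> 0 <= f x <= M * (r + t * x) `^ s) ->
  (\int[mu]_(x in E) (f x)%:E <= (M * K)%:E)%E.
Proof.
move=> ht mE mf M0 hK hE hf.
apply: (@int_le_dom _ (zone r t c d) _ (fun x => M * (r + t * x) `^ s)) => //.
- exact: measurable_zone.
- by apply: measurable_funM => //; exact: measurable_zone_powR.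
- by move=> x _; rewrite mulr_ge0 ?powR_ge0.
under eq_integral do rewrite EFinM.
rewrite ge0_integralZl_EFin //.
- by rewrite EFinM lee_wpmul2l ?lee_fin.
- exact: measurable_zone.
- by move=> x _; rewrite lee_fin powR_ge0.
- by apply/measurable_EFinP; exact: measurable_zone_powR.
Qed.

Lemma measurable_jweight p q S : measurable_fun S (@jweight R p q).
Proof.
apply: measurable_funTS; apply: measurable_funM;
  apply: (@measurableT_comp _ _ _ _ _ _ (fun y : R => y `^ _)) => //.
  by apply: measurable_funB.
by apply: measurable_funD.
Qed.

Lemma powR_le_side (q y : R) : 1 <= y <= 2 -> y `^ q <= 2 `^ `|q|.
Proof.
move=> hy; have := @powR_ratio R q y 1; rewrite powR1 !mulr1.
by apply; lra.
Qed.

(** The interval is cut at 0: on each half one factor has its base in [1, 2], and the other is a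
    power with exponent above -1. *)
Lemma int_jweight (p q : R) : -1 < p -> -1 < q -> exists2 W : R, 0 <= W &
  (\int[mu]_(x in I11) (jweight p q x)%:E <= W%:E)%E.
Proof.
move=> p1 q1.
have z0 (r : R) : 0 <= 2 `^ `|r| by exact: powR_ge0.
have mO : measurable I11 by exact: measurable_itv.
have m0 : measurable (`]0, 1[%classic : set R) by exact: measurable_itv.
exists (2 `^ `|q| * (2 `^ (p + 1) / (p + 1)) + 2 `^ `|p| * (2 `^ (q + 1) / (q + 1))).
  have h (y : R) : -1 < y -> 0 <= 2 `^ (y + 1) / (y + 1).
    by move=> ?; apply: divr_ge0; [exact: powR_ge0 | lra].
  by rewrite addr_ge0 // mulr_ge0 // h.
apply: (@int_le_setU _ `]0, 1[%classic) => //.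
- exact: measurable_jweight.
- by move=> x _; exact: jweight_ge0.
- apply: (int_le_powR (t := -1) (r := 1) (M := 2 `^ `|q|) (c := 0) (d := 2) _ _ _ _
    (zone_powR_gt _ _ p1 _ _)) => //; try by right.
  + exact: measurableI.
  + exact: measurable_jweight.
  + by move=> x []; rewrite /= !in_itv /=; lra.
  + move=> x []; rewrite /= !in_itv /= => h1 h2; rewrite jweight_ge0 mulN1r mulrC /jweight /=.
    by rewrite ler_wpM2l ?powR_ge0 // powR_le_side //; lra.
- apply: (int_le_powR (t := 1) (r := 1) (M := 2 `^ `|p|) (c := 0) (d := 2) _ _ _ _
    (zone_powR_gt _ _ q1 _ _)) => //; try by left.
  + by apply: measurableI => //; exact: measurableC.
  + exact: measurable_jweight.
  + by move=> x []; rewrite /= !in_itv /= => h1 /negP; rewrite negb_and -!leNgt; lra.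
  + move=> x []; rewrite /= !in_itv /= => h1 /negP; rewrite negb_and -!leNgt => h2.
    rewrite jweight_ge0 mul1r /jweight /= ler_wpM2r ?powR_ge0 // powR_le_side //; lra.
Qed.

End IntegralBounds.

(** * Principal values *)

Section PrincipalValue.
Context {R : realType}.
Implicit Types (f g phi psi : R -> R) (E S : set R) (C A t e h eta : R).
Notation mu := (@lebesgue_measure R).
Notation I11 := (`]-1, 1[%classic : set R).

Lemma measurable_dist_le t e : measurable [set x : R | e <= `|x - t|].
Proof.
rewrite (_ : [set _ | _] = `]-oo, t - e] `|` `[t + e, +oo[)%classic.
  by apply: measurableU; exact: measurable_itv.
apply/seteqP; split=> x /=; rewrite !in_itv /= ?andbT.
  by rewrite real_ler_normr ?num_real // => /orP[h|h]; [right|left]; lra.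
by rewrite real_ler_normr ?num_real // => -[h|h]; apply/orP; [right|left]; lra.
Qed.

Lemma measurable_dist_lt t e : measurable [set x : R | e < `|x - t|].
Proof.
rewrite (_ : [set _ | _] = `]-oo, (t - e)%R[ `|` `](t + e)%R, +oo[)%classic.
  by apply: measurableU; exact: measurable_itv.
apply/seteqP; split=> x /=; rewrite !in_itv /= ?andbT.
  by rewrite real_ltr_normr ?num_real // => /orP[h|h]; [right|left]; lra.
by rewrite real_ltr_normr ?num_real // => -[h|h]; apply/orP; [right|left]; lra.
Qed.

(** The inverse is rewritten as (x - t) |x - t|^(-2), with the second factor split according to the
    sign of x - t; this reduces the claim to real powers. Both sides are 0 at x = t. *)
Lemma measurable_inv_sub t E : measurable_fun E (fun x : R => (x - t)^-1).
Proof.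
have e : (fun x : R => (x - t)^-1) =
    (fun x => (x - t) * ((- t + 1 * x) `^ (- (2%:R)) * (0 < x - t)%R%:R
      + (t + (-1) * x) `^ (- (2%:R)) * (x - t < 0)%R%:R)).
  apply/funext => x; case: (ltrgt0P (x - t)) => h.
  - rewrite mulr1 mulr0 addr0 powR_invn; last lra.
    have -> : - t + 1 * x = x - t by lra.
    by field; rewrite gt_eqF.
  - rewrite mulr1 mulr0 add0r powR_invn; last lra.
    have -> : t + -1 * x = - (x - t) by lra.
    by field; rewrite lt_eqF.
  - by rewrite h invr0 mul0r.
rewrite e; apply: measurable_funTS.
have mb : measurable_fun setT (fun x : R => x - t) by apply: measurable_funB.
apply: measurable_funM => //; apply: measurable_funD; apply: measurable_funM.
- exact: measurable_zone_powR.
- rewrite (_ : (fun _ => _) = \1_(`]t, +oo[%classic : set R)) //.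
  by apply/funext => x; rewrite indicE subr_gt0 mem_setE in_itv /= andbT.
- exact: measurable_zone_powR.
- rewrite (_ : (fun _ => _) = \1_(`]-oo, t[%classic : set R)) //.
  by apply/funext => x; rewrite indicE subr_lt0 mem_setE in_itv.
Qed.

(** The two sides of t give the final factor 2, and the point t contributes 0. Zones being open, 2 e
    stands in for e. *)
Lemma int_le_near psi E A t e eta : 0 < e -> 0 < eta -> 0 <= A ->
  measurable E -> measurable_fun E psi ->
  (forall x, E x -> `|x - t| <= e) ->
  (forall x, E x -> `|psi x| <= A * `|x - t| `^ (eta - 1)) ->
  (\int[mu]_(x in E) `|psi x|%:E <= (A * ((2 * e) `^ eta / eta) * 2)%:E)%E.
Proof.
move=> e0 eta0 A0 mE mpsi hE hpsi.
have mn : measurable_fun E (fun x => `|psi x|) by exact: measurableT_comp.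
have B0 : 0 <= A * ((2 * e) `^ eta / eta).
  by rewrite mulr_ge0 ?divr_ge0 ?powR_ge0 ?(ltW eta0).
have -> : A * ((2 * e) `^ eta / eta) * 2 =
  A * ((2 * e) `^ eta / eta) + (A * ((2 * e) `^ eta / eta) + 0) by ring.
have e1 : -1 < eta - 1 by lra.
have hz (r s : R) : s = 1 \/ s = -1 -> (\int[mu]_(x in zone r s 0 (2 * e))
    ((r + s * x) `^ (eta - 1))%:E <= ((2 * e) `^ eta / eta)%:E)%E.
  by move=> hs; have := @zone_powR_gt R _ r _ 0 (2 * e) hs e1; rewrite subrK; apply; lra.
have mS : measurable (`]t, +oo[%classic : set R) by exact: measurable_itv.
have mS' : measurable (`]-oo, t[%classic : set R) by exact: measurable_itv.
apply: (@int_le_setU _ _ `]t, +oo[%classic) => //.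
- apply: (int_le_powR (t := 1) (r := - t) _ _ _ _ (hz _ _ _)) => //; try by left.
  + exact: measurableI.
  + by apply: measurable_funS mn => // x [].
  + move=> x [/hE]; rewrite /= in_itv /= andbT ler_norml; lra.
  + move=> x [/hpsi]; rewrite /= in_itv /= andbT => h tx.
    rewrite normr_ge0 /= mul1r addrC.
    by rewrite (ger0_norm (_ : 0 <= x - t)) in h => //; lra.
have mD : measurable (E `&` ~` `]t, +oo[%classic).
  by apply: measurableI => //; exact: measurableC.
have mnD : measurable_fun (E `&` ~` `]t, +oo[%classic) (fun x => `|psi x|).
  by apply: measurable_funS mn => // x [].
apply: (@int_le_setU _ _ `]-oo, t[%classic) => //.
- apply: (int_le_powR (t := -1) (r := t) _ _ _ _ (hz _ _ _)) => //; try by right.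
  + exact: measurableI.
  + by apply: measurable_funS mnD => // x [].
  + by move=> x [[/hE]]; rewrite /= !in_itv /= andbT ler_norml; lra.
  + move=> x [[/hpsi]]; rewrite /= !in_itv /= andbT => h _ tx.
    rewrite normr_ge0 /= mulN1r.
    by rewrite distrC (ger0_norm (_ : 0 <= t - x)) in h => //; lra.
apply: (@le_trans _ _ (\int[mu]_(x in [set t]) `|psi x|%:E)%E); last first.
  by rewrite integral_set1.
apply: ge0_subset_integral => //.
- apply: measurableI => //; exact: measurableC.
- exact: measurable_fun_set1.
- by move=> x [[_]]; rewrite /= !in_itv /= andbT => /negP h1 /negP h2; lra.
Qed.

Lemma Rintegral_setI_oo g E : measurable E -> measurable_fun (I11 `&` E) g ->
  \int[mu]_(x in `[-1, 1] `&` E) g x = \int[mu]_(x in I11 `&` E) g x.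
Proof.
move=> mE mg; rewrite !Rintegral_mkcondr /Rintegral; congr fine.
have mgE : measurable_fun I11 (g \_ E).
  by apply/measurable_restrict => //; exact: measurable_itv.
rewrite -(@integral_itv_obnd_cbnd R (-1) (BRight 1)); last first.
  exact/measurable_EFinP/measurable_fun_itv_bndo_bndcP.
rewrite -integral_itv_bndo_bndc //; exact/measurable_EFinP.
Qed.

(** The cancellation behind every principal value: the antiderivatives [ln (t - y)] and [ln (y - t)]
    produce ln (e / h) and ln (h / e). *)
Lemma Rintegral_inv_itv t e h : 0 < e -> e < h ->
  \int[mu]_(x in `[t - h, t - e]) (x - t)^-1
  + \int[mu]_(x in `[t + e, t + h]) (x - t)^-1 = 0.
Proof.
move=> e0 eh.
have ci (c d : R) : ~~ (c <= t <= d) -> {within `[c, d], continuous (fun x => (x - t)^-1)}.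
  move=> hcd; apply: continuous_in_subspaceT => x; rewrite inE /= in_itv /= => hx.
  apply: (@continuous_comp _ _ _ (fun x => x - t) (fun y => y^-1)).
    by apply: continuousB; [exact: cvg_id | exact: cst_continuous].
  apply: inv_continuous; apply: contra hcd => /eqP h0.
  by have -> : t = x by lra.
have d1 x : t < x -> is_derive x (1 : R) (fun y => ln (y - t)) (x - t)^-1.
  move=> tx; have hd := is_deriveB (is_derive_id x (1 : R)) (is_derive_cst t x (1 : R)).
  have := @is_derive1_comp _ (@ln R) (fun y => y - t) x _ _ (is_derive1_ln (_ : 0 < x - t)) hd.
  by rewrite subr0 mulr1; apply; lra.
have d2 x : x < t -> is_derive x (1 : R) (fun y => ln (t - y)) (x - t)^-1.
  move=> tx; have hd := is_deriveB (is_derive_cst t x (1 : R)) (is_derive_id x (1 : R)).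
  have := @is_derive1_comp _ (@ln R) (fun y => t - y) x _ _ (is_derive1_ln (_ : 0 < t - x)) hd.
  by rewrite sub0r mulrN1 -invrN opprB; apply; lra.
have dc (G : R -> R) x l : is_derive x (1 : R) G l -> {for x, continuous G}.
  by case=> ? _; apply/differentiable_continuous/derivable1_diffP.
rewrite /Rintegral (continuous_FTC2 (F := fun y => ln (t - y))) //; first last.
- move=> x; rewrite in_itv /= => hx; rewrite derive1E.
  by have [|_ ->] := d2 x; first lra.
- split => [x| |].
  + by rewrite in_itv /= => hx; have [|] := d2 x; first lra.
  + by apply: cvg_at_right_filter; apply: (dc _ _ _ (d2 (t - h) _)); lra.
  + by apply: cvg_at_left_filter; apply: (dc _ _ _ (d2 (t - e) _)); lra.
- by apply: ci; lra.
- by lra.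
rewrite (continuous_FTC2 (F := fun y => ln (y - t))) //; first last.
- move=> x; rewrite in_itv /= => hx; rewrite derive1E.
  by have [|_ ->] := d1 x; first lra.
- split => [x| |].
  + by rewrite in_itv /= => hx; have [|] := d1 x; first lra.
  + by apply: cvg_at_right_filter; apply: (dc _ _ _ (d1 (t + e) _)); lra.
  + by apply: cvg_at_left_filter; apply: (dc _ _ _ (d1 (t + h) _)); lra.
- by apply: ci; lra.
- by lra.
rewrite -!EFinB /=.
have -> : t - (t - e) = e by lra.
have -> : t - (t - h) = h by lra.
have -> : t + e - t = e by lra.
have -> : t + h - t = h by lra.
lra.
Qed.

(** The weight is absorbed into phi, and the open interval keeps the values at -1 and 1 out of
    consideration. *)
Definition truncated phi t e : R :=
  \int[mu]_(x in I11 `&` [set x | e <= `|x - t|]) (phi x / (x - t)).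

Lemma integrable_div_dist phi t e E : 0 < e -> measurable E -> E `<=` I11 ->
  (forall x, E x -> e <= `|x - t|) ->
  mu.-integrable I11 (EFin \o phi) ->
  mu.-integrable E (EFin \o (fun x => phi x / (x - t))).
Proof.
move=> e0 mE EI hE iphi.
have mI : measurable I11 by exact: measurable_itv.
have iE : mu.-integrable E (EFin \o phi) by exact: integrableS iphi.
apply: (@le_integrable _ _ _ mu E mE _ (fun x => e^-1%:E * (phi x)%:E)%E).
- apply/measurable_EFinP; apply: measurable_funM; last exact: measurable_inv_sub.
  by apply/measurable_EFinP; exact: measurable_int iE.
- move=> x /hE hx; rewrite /= lee_fin !normrM mulrC ler_wpM2r //.
  rewrite !normfV (gtr0_norm e0) lef_pV2 ?posrE //; exact: lt_le_trans hx.
- exact: integrableZl.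
Qed.

(** Within distance h of t the constant [phi t] is subtracted: its own contribution cancels by
    symmetry, and the remaining quotient psi is O(|x - t|^(eta - 1)), hence absolutely
    integrable. *)
Lemma principal_value phi t h A eta : -1 < t - h -> t + h < 1 -> 0 < h ->
  0 < eta -> 0 <= A -> mu.-integrable I11 (EFin \o phi) ->
  (forall x, `|x - t| <= h -> `|phi x - phi t| <= A * `|x - t| `^ eta) ->
  exists2 L, truncated phi t e @[e --> 0^'+] --> L &
    `|L| <= \int[mu]_(x in I11 `&` [set x | h < `|x - t|]) `|phi x / (x - t)|
            + A * ((2 * h) `^ eta / eta) * 2.
Proof.
move=> th1 th2 h0 eta0 A0 iphi hphi.
have mI : measurable I11 by exact: measurable_itv.
have mphi : measurable_fun I11 phi.
  by apply/measurable_EFinP; exact: measurable_int iphi.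
pose psi x := (phi x - phi t) / (x - t).
pose N := `[t - h, t + h]%classic : set R.
have NE x : N x -> `|x - t| <= h by rewrite /N /= in_itv /= ler_norml; lra.
have NI x : N x -> I11 x by rewrite /N /= !in_itv /=; lra.
have mN : measurable N by exact: measurable_itv.
have mpsi : measurable_fun N psi.
  apply: measurable_funM; last exact: measurable_inv_sub.
  by apply: measurable_funB => //; apply: measurable_funS mphi.
have bpsi x : N x -> `|psi x| <= A * `|x - t| `^ (eta - 1).
  move=> Nx; have [->|xt] := eqVneq x t.
    by rewrite /psi !subrr mul0r normr0 mulr_ge0 ?powR_ge0.
  have d0 : 0 < `|x - t| by rewrite normr_gt0 subr_eq0.
  rewrite /psi normrM normfV ler_pdivrMr // -mulrA.
  have -> : `|x - t| `^ (eta - 1) * `|x - t| = `|x - t| `^ eta.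
    by rewrite mulrC mulr_powRB1.
  by apply: hphi; exact: NE.
have hpsi e E : 0 < e -> measurable E -> E `<=` N -> (forall x, E x -> `|x - t| <= e) ->
    mu.-integrable E (EFin \o psi) /\
    `|\int[mu]_(x in E) psi x| <= A * ((2 * e) `^ eta / eta) * 2.
  move=> e0 mE EN hE.
  have mE' : measurable_fun E psi by exact: measurable_funS mpsi.
  have hb := int_le_near e0 eta0 A0 mE mE' hE (fun x Ex => bpsi x (EN x Ex)).
  have iE : mu.-integrable E (EFin \o psi).
    apply/integrableP; split; first exact/measurable_EFinP.
    by apply: le_lt_trans hb _; rewrite ltry.
  split=> //; rewrite -lee_fin EFin_normr_Rintegral //.
  apply: le_trans hb; apply: le_abse_integral => //; exact/measurable_EFinP.
pose F := I11 `&` [set x | h < `|x - t|].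
have mF : measurable F by apply: measurableI => //; exact: measurable_dist_lt.
pose g x := phi x / (x - t).
have iF : mu.-integrable F (EFin \o g).
  apply: (integrable_div_dist h0) => //; first by move=> x [].
  by move=> x [_] /ltW.
(* The limit is explicit: the far integral plus the absolutely convergent integral of psi over |x -
   t| <= h. *)
exists (\int[mu]_(x in F) g x + \int[mu]_(x in N) psi x); last first.
  apply: le_trans (ler_normD _ _) _; apply: lerD.
    exact: le_normr_Rintegral.
  exact: (hpsi h N h0 mN (@subset_refl _ N) NE).2.
(* Truncation at e differs from the limit exactly by the integral of psi over |x - t| < e, which is
   O(e^eta). *)
have key e : 0 < e -> e < h ->
    `|\int[mu]_(x in F) g x + \int[mu]_(x in N) psi x - truncated phi t e|
       <= A * ((2 * e) `^ eta / eta) * 2.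
  move=> e0 eh.
  pose J1 := `[t - h, t - e]%classic : set R.
  pose J2 := `[t + e, t + h]%classic : set R.
  pose M := `](t - e), (t + e)[%classic : set R.
  have mJ1 : measurable J1 by exact: measurable_itv.
  have mJ2 : measurable J2 by exact: measurable_itv.
  have mM : measurable M by exact: measurable_itv.
  have mJ : measurable (J1 `|` J2) by exact: measurableU.
  have JN : J1 `|` J2 `<=` N by move=> x []; rewrite /J1 /J2 /N /= !in_itv /=; lra.
  have MN : M `<=` N by move=> x; rewrite /M /N /= !in_itv /=; lra.
  have NU : N = (J1 `|` J2) `|` M.
    apply/seteqP; split=> x; rewrite /J1 /J2 /N /M /= !in_itv /=; last first.
      by move=> [[]|]; lra.
    move=> hx; case: (leP x (t - e)) => h1; first by left; left; lra.
    by case: (leP (t + e) x) => h2; [left; right; lra | right; lra].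
  have DU : I11 `&` [set x | e <= `|x - t|] = F `|` (J1 `|` J2).
    apply/seteqP; split=> x; rewrite /F /J1 /J2 /= !in_itv /=; last first.
      clear - th1 th2 h0 e0 eh; move=> [[h1 h2]|[h1|h1]]; split; try lra.
      - by rewrite ler_normr; lra.
      - by rewrite ler_normr; lra.
    move=> [h1 h2]; case: (ltP h `|x - t|) => h3; first by left.
    right; move: h2 h3; rewrite ler_normr ler_norml => /orP[h2|h2] h3; [right|left]; lra.
  have disj1 : [disjoint J1 & J2].
    by apply/disj_setPS => x []; rewrite /J1 /J2 /= !in_itv /=; lra.
  have disj2 : [disjoint (J1 `|` J2) & M].
    by apply/disj_setPS => x [[]]; rewrite /J1 /J2 /M /= !in_itv /=; lra.
  have disj3 : [disjoint F & (J1 `|` J2)].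
    by apply/disj_setPS => x [[_ /= h1] /JN /NE]; lra.
  have [iN _] := hpsi h N h0 mN (@subset_refl _ N) NE.
  have hJ1 x : J1 x -> e <= `|x - t|.
    by rewrite /J1 /= in_itv /= ler_normr; lra.
  have hJ2 x : J2 x -> e <= `|x - t|.
    by rewrite /J2 /= in_itv /= ler_normr; lra.
  have ME x : M x -> `|x - t| <= e by rewrite /M /= in_itv /= ler_norml; lra.
  have [iM bM] := hpsi e M e0 mM MN ME.
  have iJ1 : mu.-integrable J1 (EFin \o psi).
    by apply: integrableS iN => // x hx; apply: JN; left.
  have iJ2 : mu.-integrable J2 (EFin \o psi).
    by apply: integrableS iN => // x hx; apply: JN; right.
  have igJ : mu.-integrable (J1 `|` J2) (EFin \o g).
    apply: (integrable_div_dist e0) => //; first by move=> x /JN /NI.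
    move=> x []; rewrite /J1 /J2 /= !in_itv /= ler_normr; lra.
  have igD : mu.-integrable (F `|` (J1 `|` J2)) (EFin \o g).
    rewrite -DU; apply: (integrable_div_dist e0) => //; last by move=> x [].
    by apply: measurableI => //; exact: measurable_dist_le.
  have splitJ J : measurable J -> mu.-integrable J (EFin \o psi) -> J `<=` N ->
      (forall x, J x -> e <= `|x - t|) ->
      \int[mu]_(x in J) g x = \int[mu]_(x in J) psi x + phi t * \int[mu]_(x in J) (x - t)^-1.
    move=> mJJ iJJ JJN hJ.
    have ic : mu.-integrable J (EFin \o (fun x => (x - t)^-1)).
      have i1 : mu.-integrable I11 (EFin \o (fun=> 1 : R)).
        apply: (@integrableS _ _ _ mu `[-1, 1]%classic) => //.
          exact: subset_itv_oo_cc.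
        apply: continuous_compact_integrable; first exact: segment_compact.
        by apply: continuous_subspaceT => x; exact: cst_continuous.
      have := integrable_div_dist e0 mJJ (fun x Jx => NI x (JJN x Jx)) hJ i1.
      by apply: eq_integrable => // x _; rewrite /= mul1r.
    rewrite -RintegralZl // -RintegralD //.
      by apply: eq_Rintegral => x _; rewrite /g /psi; ring.
    have := integrableZl mJJ (phi t) ic.
    by apply: eq_integrable => // x _; rewrite /= EFinM.
  have e1 : truncated phi t e = \int[mu]_(x in F) g x + \int[mu]_(x in J1 `|` J2) g x.
    by rewrite /truncated DU Rintegral_setU.
  have e2 : \int[mu]_(x in J1 `|` J2) g x = \int[mu]_(x in J1) g x + \int[mu]_(x in J2) g x.
    by rewrite Rintegral_setU.
  have e3 : \int[mu]_(x in N) psi x = \int[mu]_(x in J1) psi x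
      + \int[mu]_(x in J2) psi x + \int[mu]_(x in M) psi x.
    rewrite {1}NU Rintegral_setU -?NU // Rintegral_setU //.
    exact: integrableS iN.
  rewrite e1 e2 e3.
  have e4 : \int[mu]_(x in J1) g x
      = \int[mu]_(x in J1) psi x + phi t * \int[mu]_(x in J1) (x - t)^-1.
    by apply: splitJ => // x hx; apply: JN; left.
  have e5 : \int[mu]_(x in J2) g x
      = \int[mu]_(x in J2) psi x + phi t * \int[mu]_(x in J2) (x - t)^-1.
    by apply: splitJ => // x hx; apply: JN; right.
  have e6 := Rintegral_inv_itv t e0 eh.
  rewrite e4 e5.
  set i1 := \int[mu]_(x in J1) (x - t)^-1 in e6 *.
  set i2 := \int[mu]_(x in J2) (x - t)^-1 in e6 *.
  have -> : i2 = - i1 by apply/eqP; rewrite -addr_eq0 addrC e6.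
  by rewrite [X in `|X|](_ : _ = \int[mu]_(x in M) psi x) //; ring.
apply/cvgrPdist_le => eps eps0.
pose B := A * (2 `^ eta / eta) * 2.
have cB : B * e `^ eta @[e --> 0^'+] --> 0.
  by rewrite -[X in _ --> X](mulr0 B); apply: cvgMr; exact: powR_cvg0.
have hB := (cvgr0_norm_le _ cB) _ eps0.
near=> e.
have e0 : 0 < e by [].
have eh : e < h by near: e; exact: nbhs_right_lt.
apply: le_trans (key e e0 eh) _.
have -> : A * ((2 * e) `^ eta / eta) * 2 = B * e `^ eta.
  by rewrite /B powRM ?(ltW e0) //; ring.
apply: le_trans (ler_norm _) _; near: e; exact: hB.
Unshelve. all: by end_near. Qed.

End PrincipalValue.

(** * Gauss quadrature and the de la Vallee Poussin operator *)

(** The list s collects the roots in (-1, 1) of odd multiplicity; multiplying by one more factor for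
    each makes all multiplicities there even. Roots are split off one at a time until none is left
    in (-1, 1), where the intermediate value theorem concludes. *)
Lemma poly_sign_change (R : realType) (P : {poly R}) : P != 0 ->
  exists s : seq R, [/\ uniq s, all (root P) s &
    (forall x, -1 < x < 1 -> 0 <= (P * \prod_(z <- s) ('X - z%:P)).[x]) \/
    (forall x, -1 < x < 1 -> (P * \prod_(z <- s) ('X - z%:P)).[x] <= 0)].
Proof.
have [n] := ubnP (size P); elim: n P => // n IH P hP P0.
have [[z [hz rz]]|noroot] := pselect (exists z, -1 < z < 1 /\ root P z); last first.
  exists [::]; split=> //; rewrite big_nil mulr1.
  have ivt x y : -1 < x < 1 -> -1 < y < 1 -> 0 < P.[x] -> P.[y] < 0 -> False.
    move=> hx hy Px Py; apply: noroot; case: (leP x y) => xy.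
      have [||z hz rz] := @poly_ivt R (- P) x y => //.
        by rewrite !hornerN; lra.
      by exists z; rewrite -rootN; split => //; lra.
    have [||z hz rz] := @poly_ivt R P y x; [exact: ltW | lra |].
    by exists z; split => //; lra.
  have [h|h] := leP 0 P.[0].
    left=> x hx; rewrite leNgt; apply/negP => Px.
    have P00 : P.[0] != 0.
      by apply/negP => /eqP e; apply: noroot; exists 0; rewrite rootE e eqxx; split => //; lra.
    by apply: (ivt 0 x) => //; [lra | rewrite lt_neqAle eq_sym P00].
  right=> x hx; rewrite leNgt; apply/negP => Px.
  by apply: (ivt x 0) => //; lra.
have [Q PE] := factor_theorem P z rz.
have Q0 : Q != 0 by apply: contraNneq P0 => Q0; rewrite PE Q0 mul0r.
have sQ : (size Q < n)%N.
  by move: hP; rewrite PE size_Mmonic ?monicXsubC // size_XsubC addn2.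
have [s [us rs sgn]] := IH Q sQ Q0.
(* Splitting off z toggles the parity of its multiplicity: it leaves the list if present and enters
   it otherwise. *)
have [zs|zs] := boolP (z \in s).
  exists (rem z s); split; first exact: rem_uniq.
    apply/allP => y /mem_rem ys; rewrite PE rootM.
    by move/allP : rs => /(_ y ys) ->.
  have e : P * \prod_(i <- rem z s) ('X - i%:P) = Q * \prod_(i <- s) ('X - i%:P).
    by rewrite (perm_big _ (perm_to_rem zs)) /= big_cons PE mulrA.
  by rewrite e.
exists (z :: s); split; first by rewrite /= zs.
  rewrite /= rz; apply/allP => y ys; rewrite PE rootM.
  by move/allP : rs => /(_ y ys) ->.
have e x : (P * \prod_(i <- z :: s) ('X - i%:P)).[x]
    = (x - z) ^+ 2 * (Q * \prod_(i <- s) ('X - i%:P)).[x].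
  rewrite big_cons PE; rewrite !hornerM hornerXsubC; ring.
case: sgn => sgn; [left|right] => x hx; rewrite e.
  by rewrite mulr_ge0 ?sqr_ge0 ?sgn.
by rewrite mulr_ge0_le0 ?sqr_ge0 ?sgn.
Qed.

Lemma poly_roots_seq (F : idomainType) (q : {poly F}) : q != 0 ->
  exists s : seq F, forall x, root q x -> x \in s.
Proof.
have [n] := ubnP (size q); elim: n q => // n IH q hq q0.
have [[z rz]|noroot] := pselect (exists z, root q z); last first.
  by exists [::] => x rx; case: noroot; exists x.
have [Q qE] := factor_theorem q z rz.
have Q0 : Q != 0 by apply: contraNneq q0 => Q0; rewrite qE Q0 mul0r.
have sQ : (size Q < n)%N.
  by move: hq; rewrite qE size_Mmonic ?monicXsubC // size_XsubC addn2.
have [s hs] := IH Q sQ Q0.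
by exists (z :: s) => x; rewrite qE rootM root_XsubC inE orbC => /orP[->//|/hs ->]; rewrite orbT.
Qed.

Section JacobiFunctional.
Context {R : realType}.
Variables (al be : R).
Hypotheses (hal : -1 < al) (hbe : -1 < be).
Notation mu := (@lebesgue_measure R).
Notation I11 := (`]-1, 1[%classic : set R).
Notation C11 := (`[-1, 1]%classic : set R).
Implicit Types q : {poly R}.

Definition jacobi_int q : R :=
  \int[mu]_(x in `[-1, 1]) (q.[x] * jweight al be x).

Lemma poly_bounded q : exists2 B : R, 0 <= B & forall x : R, -1 <= x <= 1 -> `|q.[x]| <= B.
Proof.
exists (\sum_(i < size q) `|q`_i|); first exact: sumr_ge0.
move=> x hx; rewrite horner_coef; apply: le_trans (ler_norm_sum _ _ _) _.
apply: ler_sum => i _; rewrite normrM normrX ler_piMr //.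
by rewrite exprn_ile1 // ler_norml.
Qed.

Lemma integrable_oo_cc (f : R -> R) : measurable_fun setT f ->
  mu.-integrable I11 (EFin \o f) -> mu.-integrable `[-1, 1] (EFin \o f).
Proof.
move=> mf /integrableP[_ h]; apply/integrableP; split.
  by apply/measurable_EFinP; exact: measurable_funTS.
have mn S : measurable_fun S (fun x => `|(f x)%:E|%E).
  by apply: measurableT_comp => //; apply/measurable_EFinP; exact: measurable_funTS.
by rewrite -integral_itv_obnd_cbnd // -integral_itv_bndo_bndc.
Qed.

Lemma integrable_jweight (p q : R) : -1 < p -> -1 < q ->
  mu.-integrable I11 (EFin \o @jweight R p q).
Proof.
move=> p1 q1; have [W _ hW] := int_jweight p1 q1.
apply/integrableP; split; first by apply/measurable_EFinP; exact: (measurable_jweight p q).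
apply: le_lt_trans (ltry W); apply: le_trans hW; apply: ge0_le_integral => //.
- by apply/measurable_EFinP; apply: measurableT_comp => //; exact: (measurable_jweight p q).
- by apply/measurable_EFinP; exact: (measurable_jweight p q).
- by move=> x _; rewrite /= lee_fin ger0_norm ?jweight_ge0.
Qed.

Lemma integrable_poly_jweight q :
  mu.-integrable `[-1, 1] (EFin \o (fun x => q.[x] * jweight al be x)).
Proof.
have mh (S : set R) : measurable_fun S (horner q).
  by apply: measurable_funTS; apply: continuous_measurable_fun; exact: continuous_horner.
have [B B0 hB] := poly_bounded q.
have iw := integrable_oo_cc (@measurable_jweight R al be setT) (integrable_jweight hal hbe).
apply: (@le_integrable _ _ _ mu _ (measurable_itv `[-1, 1]) _
  (fun x => B%:E * (jweight al be x)%:E)%E).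
- apply/measurable_EFinP; apply: measurable_funM; [exact: mh | exact: measurable_jweight].
- move=> x; rewrite /= in_itv /= => hx; rewrite lee_fin !normrM ler_wpM2r //.
  by rewrite (ger0_norm B0) hB.
- exact: integrableZl.
Qed.

Lemma jacobi_int_linear c q1 q2 :
  jacobi_int (c *: q1 + q2) = c * jacobi_int q1 + jacobi_int q2.
Proof.
rewrite /jacobi_int -RintegralZl //; last exact: integrable_poly_jweight.
rewrite -RintegralD //.
- by apply: eq_Rintegral => x _; rewrite hornerD hornerZ; ring.
- have mcc : measurable (`[-1, 1]%classic : set R) by exact: measurable_itv.
  have : mu.-integrable `[-1, 1] (fun x => c%:E * (q1.[x] * jweight al be x)%:E)%E.
    by apply: integrableZl => //; exact: integrable_poly_jweight.
  by apply: eq_integrable => // x _; rewrite /= EFinM.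
- exact: integrable_poly_jweight.
Qed.

(** A zero integral would force q to vanish almost everywhere on (-1, 1), although its roots form a
    finite set. *)
Lemma jacobi_int_neq0 q : q != 0 -> (forall x, -1 < x < 1 -> 0 <= q.[x]) ->
  jacobi_int q != 0.
Proof.
move=> q0 hq; apply/negP => /eqP h0.
have mf (S : set R) : measurable_fun S (fun x => q.[x] * jweight al be x).
  apply: measurable_funM; last exact: (measurable_jweight al be).
  by apply: measurable_funTS; apply: continuous_measurable_fun; exact: continuous_horner.
have iq := integrable_poly_jweight q.
have mI : measurable I11 by exact: measurable_itv.
have : (\int[mu]_(x in I11) `|(q.[x] * jweight al be x)%:E| = 0)%E.
  have -> : (\int[mu]_(x in I11) `|(q.[x] * jweight al be x)%:E|
           = \int[mu]_(x in C11) (q.[x] * jweight al be x)%:E)%E.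
    rewrite -integral_itv_obnd_cbnd -?integral_itv_bndo_bndc; [|exact/measurable_EFinP..].
    apply: eq_integral => x; rewrite inE /= in_itv /= => hx.
    by rewrite ger0_norm // mulr_ge0 ?jweight_ge0 ?hq.
  rewrite -[LHS]fineK; first by rewrite -[X in X%:E]/(jacobi_int q) h0.
  exact: integrable_fin_num.
have mfE : measurable_fun I11 (fun x => (q.[x] * jweight al be x)%:E).
  exact/measurable_EFinP.
move/(ae_eq_integral_abs mu mI mfE) => [N [mN N0 hN]].
have [s hs] := poly_roots_seq q0.
have hsub : I11 `<=` N `|` [set` s].
  move=> x Ix; have [xs|xs] := boolP (x \in s); [by right | left].
  apply: hN => /= /(_ Ix) /eqP; rewrite eqe mulf_eq0 (gt_eqF (jweight_gt0 _ _ _)).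
    by rewrite orbF => /hs; rewrite (negbTE xs).
  by move: Ix; rewrite /= in_itv.
have cs : countable ([set` s] : set R).
  by apply: finite_set_countable; exact: finite_seq.
have ms : measurable ([set` s] : set R).
  by apply: countable_measurable => // x; exact: measurable_set1.
have : (mu I11 <= 0)%E.
  apply: (@le_trans _ _ (mu (N `|` [set` s]))).
    by rewrite le_measure ?inE //; exact: measurableU.
  have hU : (mu (N `|` [set` s]) <= mu N + mu [set` s])%E by exact: measureU2.
  apply: (le_trans hU).
  by rewrite N0 countable_lebesgue_measure0 ?adde0.
rewrite lebesgue_measure_itv /= lte_fin ifT; last lra.
by rewrite -EFinB lee_fin; lra.
Qed.

End JacobiFunctional.

Lemma size_sum_le (F : nzRingType) (I : eqType) (r : seq I) (q : I -> {poly F}) n :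
  (forall i, i \in r -> (size (q i) <= n)%N) -> (size (\sum_(i <- r) q i)%R <= n)%N.
Proof.
move=> h; rewrite big_seq; apply: (big_ind (fun s : {poly F} => (size s <= n)%N)).
- by rewrite size_poly0.
- by move=> s t hs ht; apply: leq_trans (size_polyD _ _) _; rewrite geq_max hs.
- exact: h.
Qed.

Section GaussQuadrature.
Context {R : realType}.
Variables (al be : R) (p : nat -> {poly R}).
Hypotheses (hal : -1 < al) (hbe : -1 < be) (hp : orthonormal_jacobi al be p).
Implicit Types q : {poly R}.
Notation L := (jacobi_int al be).

Lemma jacobi_int0 : L 0 = 0.
Proof. by have := jacobi_int_linear hal hbe (-1) 0 0; rewrite scaler0 addr0; lra. Qed.

Lemma jacobi_intD q1 q2 : L (q1 + q2) = L q1 + L q2.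
Proof. by rewrite -[q1 in LHS]scale1r jacobi_int_linear // mul1r. Qed.

Lemma jacobi_intZ c q : L (c *: q) = c * L q.
Proof. by rewrite -[_ *: _]addr0 jacobi_int_linear // jacobi_int0 addr0. Qed.

Lemma jacobi_int_sum I (r : seq I) (F : I -> {poly R}) :
  L (\sum_(i <- r) F i) = \sum_(i <- r) L (F i).
Proof. exact: (big_morph _ jacobi_intD jacobi_int0). Qed.

Lemma jacobi_orthonormal i j : L (p i * p j) = (i == j)%:R.
Proof.
by have [_ _ h] := hp; rewrite -h; apply: eq_Rintegral => x _; rewrite hornerM.
Qed.

Lemma size_jacobi j : size (p j) = j.+1.
Proof. by have [h _ _] := hp. Qed.

Lemma jacobi_neq0 j : p j != 0.
Proof. by rewrite -size_poly_eq0 size_jacobi. Qed.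

Lemma jacobi_int_low n q : (size q <= n)%N -> L (q * p n) = 0.
Proof.
move=> hq; have [c ->] := expand_poly size_jacobi hq.
rewrite mulr_suml jacobi_int_sum big1 // => i _.
rewrite -scalerAl jacobi_intZ jacobi_orthonormal.
by rewrite ltn_eqF ?mulr0.
Qed.

(** With fewer than n sign changes, the product D of the corresponding linear factors would have
    degree below n: then p_n D would have integral 0 by orthogonality, yet constant sign. The degree
    of p_n excludes more than n roots. *)
Lemma jacobi_roots n : exists xs : seq R,
  [/\ uniq xs, size xs = n & forall x, root (p n) x = (x \in xs)].
Proof.
have [s [us rs sgn]] := poly_sign_change (jacobi_neq0 n).
set D := \prod_(z <- s) _ in sgn.
have D0 : p n * D != 0.
  by rewrite mulf_neq0 ?jacobi_neq0 // /D prodf_seq_neq0; apply/allP => z _; rewrite polyXsubC_eq0.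
have sn : (n <= size s)%N.
  rewrite leqNgt; apply/negP => sn.
  have h0 : L (p n * D) = 0.
    by rewrite mulrC jacobi_int_low // /D size_prod_XsubC.
  case: sgn => sgn.
    by have := jacobi_int_neq0 hal hbe D0 sgn; rewrite h0 eqxx.
  have D0' : - (p n * D) != 0 by rewrite oppr_eq0.
  have e : L (- (p n * D)) = 0 by rewrite -scaleN1r jacobi_intZ h0 mulr0.
  suff /(jacobi_int_neq0 hal hbe D0') : forall x, -1 < x < 1 -> 0 <= (- (p n * D)).[x].
    by rewrite e eqxx.
  by move=> x hx; rewrite hornerN oppr_ge0; exact: sgn.
have ss : size s = n.
  apply/eqP; rewrite eqn_leq sn andbT -ltnS -(size_jacobi n).
  by apply: max_poly_roots; rewrite ?jacobi_neq0.
exists s; split=> // x; apply/idP/idP => [rx|/(allP rs) //].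
apply: contraT => xs.
have := max_poly_roots (jacobi_neq0 n) (_ : all (root (p n)) (x :: s)) (_ : uniq (x :: s)).
by rewrite /= rx rs xs us size_jacobi ss ltnn => /(_ erefl erefl).
Qed.

Definition lagrange_basis (xs : seq R) (x : R) : {poly R} :=
  (\prod_(z <- rem x xs) (x - z))^-1 *: \prod_(z <- rem x xs) ('X - z%:P).

Lemma lagrange_basisE xs x y : uniq xs -> x \in xs -> y \in xs ->
  (lagrange_basis xs x).[y] = (x == y)%:R.
Proof.
move=> us hx hy; rewrite /lagrange_basis hornerZ horner_prod.
rewrite [X in _ * X](_ : _ = \prod_(z <- rem x xs) (y - z)); last first.
  by apply: eq_bigr => z _; rewrite hornerXsubC.
have [<-|xy] := eqVneq x y.
  rewrite mulVf // prodf_seq_neq0; apply/allP => z hz; rewrite subr_eq0.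
  by apply: contraTneq hz => <-; rewrite mem_rem_uniqF.
have yr : y \in rem x xs by rewrite mem_rem_uniq // inE eq_sym xy hy.
by rewrite [X in _ * X](perm_big _ (perm_to_rem yr)) /= big_cons subrr mul0r mulr0.
Qed.

Lemma size_lagrange_basis xs x : x \in xs -> (size (lagrange_basis xs x) <= size xs)%N.
Proof.
move=> hx; apply: leq_trans (size_scale_leq _ _) _.
by rewrite size_prod_XsubC size_rem //; case: xs hx.
Qed.

Lemma lagrange_interpolation xs q : uniq xs -> (size q <= size xs)%N ->
  q = \sum_(x <- xs) q.[x] *: lagrange_basis xs x.
Proof.
move=> us hq; apply/eqP; rewrite -subr_eq0; set d := _ - _; apply: contraT => d0.
have sd : (size d <= size xs)%N.
  apply: leq_trans (size_polyD _ _) _; rewrite geq_max hq size_polyN.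
  apply: size_sum_le => x hx.
  by apply: leq_trans (size_scale_leq _ _) _; exact: size_lagrange_basis.
have := max_poly_roots d0 _ us; rewrite ltnNge sd => /(_ _); apply.
apply/allP => y hy; rewrite rootE /d hornerD hornerN horner_sum.
rewrite (perm_big _ (perm_to_rem hy)) /= big_cons hornerZ lagrange_basisE // eqxx mulr1.
rewrite big_seq big1 ?addr0 ?subrr // => z hz.
rewrite hornerZ lagrange_basisE //; last exact: mem_rem hz.
rewrite (_ : (z == y) = false) ?mulr0 //.
by apply: contraTF hz => /eqP ->; rewrite mem_rem_uniqF.
Qed.

(** Euclidean division by p_n: the quotient has degree below n and is orthogonal to p_n, while the
    remainder agrees with q at the nodes and equals its interpolant. *)
Lemma gauss_exact n xs q : uniq xs -> size xs = n ->
  (forall x, root (p n) x = (x \in xs)) -> (size q <= n + n)%N ->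
  L q = \sum_(x <- xs) L (lagrange_basis xs x) * q.[x].
Proof.
move=> us sx rx hq.
rewrite {1}(divp_eq q (p n)) jacobi_intD jacobi_int_low ?add0r; last first.
  by rewrite size_divp ?jacobi_neq0 // size_jacobi /= leq_subLR.
have sm : (size (q %% p n)%R <= size xs)%N.
  by rewrite sx -ltnS -(size_jacobi n) ltn_modp jacobi_neq0.
rewrite {1}(lagrange_interpolation us sm) jacobi_int_sum.
apply: eq_big_seq => x hx; rewrite jacobi_intZ mulrC; congr (_ * _).
rewrite [in RHS](divp_eq q (p n)) hornerD hornerM.
by have := hx; rewrite -rx => /rootP ->; rewrite mulr0 add0r.
Qed.

(** Exactness makes the matrix of the p_j(x_k) a left inverse of its transpose weighted by the
    quadrature coefficients. Square matrices commute with their inverses, and a diagonal entry of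
    the reversed product says that the weight times the sum of the p_j(y)^2 is 1. *)
Lemma gauss_weight n xs y : uniq xs -> size xs = n ->
  (forall x, root (p n) x = (x \in xs)) -> y \in xs ->
  L (lagrange_basis xs y) = christoffel p n y.
Proof.
move=> us sx rx hy.
pose g (k : 'I_n) := L (lagrange_basis xs xs`_k).
pose A : 'M[R]_n := \matrix_(j, k) (p j).[xs`_k].
pose B : 'M[R]_n := \matrix_(k, j) (g k * (p j).[xs`_k]).
have AB : A *m B = 1%:M.
  apply/matrixP => i j; rewrite !mxE -(jacobi_orthonormal i j).
  rewrite (gauss_exact us sx rx); last first.
    apply: leq_trans (size_polyMleq _ _) _; rewrite !size_jacobi.
    have hi := ltn_ord i; have hj := ltn_ord j; lia.
  rewrite (big_nth 0) big_mkord sx; apply: eq_bigr => k _.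
  by rewrite !mxE hornerM /g; ring.
have ky : (index y xs < n)%N by rewrite -sx index_mem.
have := congr1 (fun M : 'M[R]_n => M (Ordinal ky) (Ordinal ky)) (mulmx1C AB).
rewrite !mxE eqxx /= => h; rewrite /christoffel.
have : L (lagrange_basis xs y) * \sum_(j < n) (p j).[y] ^+ 2 = 1.
  apply: etrans h; rewrite mulr_sumr; apply: eq_bigr => j _.
  by rewrite !mxE /g /= nth_index //; ring.
move=> e; have S0 : \sum_(j < n) (p j).[y] ^+ 2 != 0.
  by apply: contra_eq_neq e => ->; rewrite mulr0 eq_sym oner_neq0.
by apply: (mulIf S0); rewrite e mulVf.
Qed.

Lemma VP_seq n : exists xs : seq R,
  [/\ uniq xs, size xs = n, (forall x, root (p n) x = (x \in xs)) &
   forall m f x, VP p n m f x = \sum_(y <- xs) (f y * christoffel p n y *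
     \sum_(j < n + m) (VPcoef n m j * (p j).[x] * (p j).[y]))].
Proof.
have [xs [us sx rx]] := jacobi_roots n; exists xs; split=> // m f x.
rewrite /VP (_ : [set y | root (p n) y] = [set` xs]); first by rewrite -fsbig_seq.
by apply/seteqP; split=> y /=; rewrite rx.
Qed.

Lemma VP_poly n m (f : R -> R) : exists2 q : {poly R}, (size q <= n + m)%N &
  VP p n m f = horner q.
Proof.
have [xs [us sx rx VPE]] := VP_seq n.
exists (\sum_(y <- xs) (f y * christoffel p n y) *:
     \sum_(j < n + m) (VPcoef n m j * (p j).[y]) *: p j).
  apply: size_sum_le => y _; apply: leq_trans (size_scale_leq _ _) _.
  apply: size_sum_le => j _; apply: leq_trans (size_scale_leq _ _) _.
  by rewrite size_jacobi.
apply/funext => x; rewrite VPE horner_sum; apply: eq_bigr => y _.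
rewrite hornerZ horner_sum; congr (_ * _); apply: eq_bigr => j _.
by rewrite hornerZ; ring.
Qed.

Lemma VPB n m (f g : R -> R) x :
  VP p n m (fun y => f y - g y) x = VP p n m f x - VP p n m g x.
Proof.
have [xs [us sx rx VPE]] := VP_seq n.
by rewrite !VPE -sumrB; apply: eq_bigr => y _; ring.
Qed.

(** The node sums are Gauss quadratures of q p_j, exact because the degree is at most (n - m) + (n +
    m - 1) = 2n - 1. Thus V q is a filtered Fourier sum of q, and the filter equals 1 at all degrees
    that occur in q. *)
Lemma VP_reproduce n m q : (0 < m)%N -> (m <= n)%N -> (size q <= (n - m).+1)%N ->
  VP p n m (horner q) = horner q.
Proof.
move=> m0 mn hq; apply/funext => x.
have [xs [us sx rx ->]] := VP_seq n.
transitivity (\sum_(j < n + m) VPcoef n m j * (p j).[x] * L (q * p j)).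
  under eq_bigr do rewrite mulr_sumr.
  rewrite exchange_big /=; apply: eq_bigr => j _.
  rewrite (gauss_exact us sx rx); last first.
    apply: leq_trans (size_polyMleq _ _) _; rewrite size_jacobi.
    have hj := ltn_ord j; lia.
  rewrite mulr_sumr; apply: eq_big_seq => y hy.
  by rewrite (gauss_weight us sx rx hy) hornerM; ring.
have [c hc] := expand_poly size_jacobi hq.
have Lq j : L (q * p j) = if (j <= n - m)%N then c j else 0.
  rewrite hc mulr_suml jacobi_int_sum; case: ifP => hj.
    have hj' : (j < (n - m).+1)%N by [].
    rewrite (bigD1 (Ordinal hj')) //= -scalerAl jacobi_intZ jacobi_orthonormal eqxx mulr1.
    rewrite big1 ?addr0 // => i hi; rewrite -scalerAl jacobi_intZ jacobi_orthonormal.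
    by rewrite (_ : (i == j :> nat) = false) ?mulr0 //; exact: negbTE hi.
  rewrite big1 // => i _; rewrite -scalerAl jacobi_intZ jacobi_orthonormal.
  by rewrite (_ : (i == j :> nat) = false) ?mulr0 //; have := ltn_ord i; lia.
rewrite [in RHS]hc horner_sum.
rewrite (big_ord_widen (n + m) (fun j => (c j *: p j).[x])); last lia.
rewrite [in RHS]big_mkcond; apply: eq_bigr => j _.
by rewrite Lq /VPcoef ltnS; case: ifP => _; rewrite ?mulr0 // hornerZ; ring.
Qed.

End GaussQuadrature.

(** * Weighted spaces *)

Section WeightedSpace.
Context {R : realType}.
Variables (g d : R).
Hypotheses (hg : 0 <= g) (hd : 0 <= d).
Implicit Types (f : R -> R) (q : {poly R}) (x M : R).

Lemma jweight_le x : -1 < x < 1 -> jweight g d x <= 2 `^ g * 2 `^ d.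
Proof.
by move=> hx; apply: ler_pM; rewrite ?powR_ge0 // ge0_ler_powR ?nnegrE; do ?lra.
Qed.

(** Needed before anything can be said of [wnorm], as the [sup] of an unbounded set is only a
    default value. Near an endpoint either the product tends to 0 or f has a limit there;
    compactness covers the rest. *)
Lemma C0_bounded f : C0 g d f ->
  exists M, forall x, -1 < x < 1 -> `|f x| * jweight g d x <= M.
Proof.
case=> cf f1 fN1 l1 lN1.
pose W := 2 `^ g * 2 `^ d : R.
have W0 : 0 <= W by rewrite mulr_ge0 ?powR_ge0.
pose G x := `|f x| * jweight g d x.
have near_end (F : set_system R) (FF : Filter F) : (\forall x \near F, -1 < x < 1) ->
    (f x * jweight g d x @[x --> F] --> 0) \/ (cvg (f x @[x --> F])) ->
    exists B, \forall x \near F, G x <= B.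
  move=> hF [h|h].
    exists 1; near=> x; rewrite /G -[jweight g d x]ger0_norm ?jweight_ge0 // -normrM.
    by near: x; exact: (cvgr0_norm_le _ h).
  have [l hl] := (cvg_ex _).1 h.
  exists ((`|l| + 1) * W); near=> x.
  apply: ler_pM => //; first exact: jweight_ge0.
    near: x; apply: (cvgr_norm_le _ hl); lra.
  by apply: jweight_le; near: x.
have [B1 h1] : exists B, \forall x \near 1^'-, G x <= B.
  apply: near_end.
    near=> x; apply/andP; split=> //; near: x; apply: nbhs_left_gt; lra.
  move: hg; rewrite le_eqVlt => /predU1P[g0|g0]; [right; exact: l1 | left; exact: f1].
have [B2 h2] : exists B, \forall x \near (-1)^'+, G x <= B.
  apply: near_end.
    near=> x; apply/andP; split=> //; near: x; apply: nbhs_right_lt; lra.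
  move: hd; rewrite le_eqVlt => /predU1P[d0|d0]; [right; exact: lN1 | left; exact: fN1].
have [e1 e10 he1] : exists2 e, 0 < e & forall x, 1 - e < x < 1 -> G x <= B1.
  move: h1; rewrite near_withinE => /nbhs_ballP[e /= e0 he]; exists e => // x hx.
  by apply: he; [rewrite /ball /= ltr_norml; lra | lra].
have [e2 e20 he2] : exists2 e, 0 < e & forall x, -1 < x < -1 + e -> G x <= B2.
  move: h2; rewrite near_withinE => /nbhs_ballP[e /= e0 he]; exists e => // x hx.
  by apply: he; [rewrite /ball /= ltr_norml; lra | lra].
pose e := Num.min (Num.min e1 e2) 1 / 2.
have [e0 ee1 ee2 e1'] : [/\ 0 < e, e < e1, e < e2 & e < 1].
  have : 0 < Num.min (Num.min e1 e2) 1 by rewrite !lt_min e10 e20 ltr01.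
  have : Num.min (Num.min e1 e2) 1 <= e1 by rewrite !ge_min lexx.
  have : Num.min (Num.min e1 e2) 1 <= e2 by rewrite !ge_min lexx orbT.
  have : Num.min (Num.min e1 e2) 1 <= 1 by rewrite !ge_min lexx orbT.
  by rewrite /e => *; split; lra.
have cm : {within `[-1 + e, 1 - e], continuous (fun x => `|f x|)}.
  apply: continuous_in_subspaceT => x; rewrite inE /= in_itv /= => hx.
  apply: continuous_comp; last exact: norm_continuous.
  by apply: cf; rewrite in_itv /=; lra.
have [|c _ hc] := EVT_max _ cm; first lra.
exists (Num.max (Num.max B1 B2) (`|f c| * W)) => x hx.
rewrite -/(G x) !le_max.
have [h|h] := ltP (1 - e) x; first by rewrite he1 //; lra.
have [h'|h'] := ltP x (-1 + e); first by rewrite he2 ?orbT //; lra.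
apply/orP; right; apply: ler_pM => //; [exact: jweight_ge0 | | exact: jweight_le].
by apply: hc; rewrite in_itv /=; lra.
Unshelve. all: by end_near. Qed.

Lemma wnorm_ub f x : C0 g d f -> -1 < x < 1 -> `|f x| * jweight g d x <= wnorm g d f.
Proof.
move=> /C0_bounded[M hM] hx; apply: ub_le_sup.
  by exists M => _ [y /= + <-]; rewrite in_itv; exact: hM.
by exists x => //=; rewrite in_itv.
Qed.

Lemma wnorm_le f M : (forall x, -1 < x < 1 -> `|f x| * jweight g d x <= M) ->
  wnorm g d f <= M.
Proof.
move=> hM; apply: ge_sup.
  by exists (`|f 0| * jweight g d 0), 0 => //=; rewrite in_itv /=; lra.
by move=> _ [y /= + <-]; rewrite in_itv; exact: hM.
Qed.

Lemma wnorm_ge0 f : C0 g d f -> 0 <= wnorm g d f.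
Proof.
move=> hf; apply: le_trans (wnorm_ub (x := 0) hf _); last lra.
by rewrite mulr_ge0 ?jweight_ge0.
Qed.

Lemma C0_poly q : C0 g d (horner q).
Proof.
have cq : continuous (horner q) by exact: continuous_horner.
have [B B0 hB] := poly_bounded q.
(* Here y measures the distance to the endpoint at hand and s is the exponent of the weight there; W
   absorbs q and the factor of the other endpoint. *)
have side (s : R) (F : set_system R) (FF : Filter F) (W : R) : 0 < s -> 0 <= W ->
    forall y : R -> R, (forall e, 0 < e -> \forall x \near F, 0 < y x < e) ->
    (\forall x \near F, `|q.[x] * jweight g d x| <= W * y x `^ s) ->
    q.[x] * jweight g d x @[x --> F] --> 0.
  move=> s0 W0 y hy hW; apply/cvgr0Pnorm_le => eps eps0.
  have e0 : 0 < (eps / (W + 1)) `^ s^-1 by apply: powR_gt0; apply: divr_gt0 => //; lra.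
  near=> x.
  have hx : `|q.[x] * jweight g d x| <= W * y x `^ s by near: x.
  have /andP[y0 ye] : 0 < y x < (eps / (W + 1)) `^ s^-1 by near: x; exact: hy.
  apply: le_trans hx _.
  have : y x `^ s <= eps / (W + 1).
    have -> : eps / (W + 1) = ((eps / (W + 1)) `^ s^-1) `^ s.
      by rewrite -powRrM mulVf ?gt_eqF // powRr1 // divr_ge0 ?(ltW eps0) //; lra.
    by rewrite ge0_ler_powR ?nnegrE ?powR_ge0 //; do ?lra.
  rewrite ler_pdivlMr; last lra.
  by have := powR_ge0 (y x) s; nra.
split.
- by move=> x _; exact: cq.
- move=> g0; apply: (side g _ _ (B * 2 `^ d) g0 _ (fun x => 1 - x)).
  + by rewrite mulr_ge0 ?powR_ge0.
  + move=> e e0; near=> x.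
    have h1 : 1 - e < x by near: x; apply: nbhs_left_gt; lra.
    have h2 : x < 1 by near: x; exact: nbhs_left_lt.
    lra.
  + near=> x.
    have h1 : -1 < x by near: x; apply: nbhs_left_gt; lra.
    have h2 : x < 1 by near: x; exact: nbhs_left_lt.
    rewrite normrM [`|jweight _ _ _|]ger0_norm ?jweight_ge0 // /jweight.
    rewrite -mulrA [2 `^ d * _]mulrC; apply: ler_pM => //.
    * by rewrite mulr_ge0 ?powR_ge0.
    * by apply: hB; lra.
    by rewrite ler_wpM2l ?powR_ge0 // ge0_ler_powR ?nnegrE; do ?lra.
- move=> d0; apply: (side d _ _ (B * 2 `^ g) d0 _ (fun x => 1 + x)).
  + by rewrite mulr_ge0 ?powR_ge0.
  + move=> e e0; near=> x.
    have h1 : x < -1 + e by near: x; apply: nbhs_right_lt; lra.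
    have h2 : -1 < x by near: x; exact: nbhs_right_gt.
    lra.
  + near=> x.
    have h1 : x < 1 by near: x; apply: nbhs_right_lt; lra.
    have h2 : -1 < x by near: x; exact: nbhs_right_gt.
    rewrite normrM [`|jweight _ _ _|]ger0_norm ?jweight_ge0 // /jweight.
    rewrite -mulrA; apply: ler_pM => //.
    * by rewrite mulr_ge0 ?powR_ge0.
    * by apply: hB; lra.
    by rewrite ler_wpM2r ?powR_ge0 // ge0_ler_powR ?nnegrE; do ?lra.
- by move=> _; apply: cvgP; apply: cvg_at_left_filter; exact: cq.
- by move=> _; apply: cvgP; apply: cvg_at_right_filter; exact: cq.
Unshelve. all: by end_near. Qed.

Lemma C0B f f' : C0 g d f -> C0 g d f' -> C0 g d (fun x => f x - f' x).
Proof.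
move=> [a1 a2 a3 a4 a5] [b1 b2 b3 b4 b5].
have e : (fun x => (f x - f' x) * jweight g d x)
    = (fun x => f x * jweight g d x - f' x * jweight g d x).
  by apply/funext => x; rewrite mulrBl.
split.
- by move=> x hx; apply: continuousB; [exact: a1 | exact: b1].
- move=> g0; rewrite e; have := cvgB (a2 g0) (b2 g0); rewrite subr0; exact.
- move=> d0; rewrite e; have := cvgB (a3 d0) (b3 d0); rewrite subr0; exact.
- by move=> g0; apply: is_cvgB; [exact: a4 | exact: b4].
- by move=> d0; apply: is_cvgB; [exact: a5 | exact: b5].
Qed.

Lemma C0B_poly f q : C0 g d f -> C0 g d (fun x => f x - q.[x]).
Proof. by move=> hf; apply: C0B => //; exact: C0_poly. Qed.

Lemma best_approx_le n f q : C0 g d f -> (size q <= n.+1)%N ->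
  best_approx g d n f <= wnorm g d (fun x => f x - q.[x]).
Proof.
move=> hf hq; apply: ge_inf; last by exists q.
exists 0 => _ [q' _ <-]; apply: wnorm_ge0; exact: C0B_poly.
Qed.

Lemma best_approx_ge n f M : (forall q : {poly R}, (size q <= n.+1)%N ->
  M <= wnorm g d (fun x => f x - q.[x])) -> M <= best_approx g d n f.
Proof.
move=> h; apply: lb_le_inf; last by move=> _ [q hq <-]; exact: h.
by exists (wnorm g d (fun x => f x - (0 : {poly R}).[x])), 0; rewrite //= size_poly0.
Qed.

Lemma best_approx_ge0 n f : C0 g d f -> 0 <= best_approx g d n f.
Proof.
by move=> hf; apply: best_approx_ge => q _; apply: wnorm_ge0; exact: C0B_poly.
Qed.

Lemma best_approx_anti n n' f : C0 g d f -> (n <= n')%N ->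
  best_approx g d n' f <= best_approx g d n f.
Proof.
move=> hf nn'; apply: best_approx_ge => q hq.
by apply: best_approx_le => //; exact: leq_trans hq _.
Qed.

Lemma best_approx_lt n f M : C0 g d f -> best_approx g d n f < M ->
  exists2 q : {poly R}, (size q <= n.+1)%N &
    forall x, -1 < x < 1 -> `|f x - q.[x]| * jweight g d x <= M.
Proof.
move=> hf hM; have e0 : 0 < M - best_approx g d n f by lra.
have hi : has_inf [set wnorm g d (fun x => f x - P.[x])
      | P in [set P : {poly R} | (size P <= n.+1)%N]].
  split; last by exists 0 => _ [q' _ <-]; apply: wnorm_ge0; exact: C0B_poly.
  by exists (wnorm g d (fun x => f x - (0 : {poly R}).[x])), 0; rewrite //= size_poly0.
have [_ [q hq <-] hlt] := inf_adherent e0 hi.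
exists q => // x hx; apply: le_trans (wnorm_ub (C0B_poly _ hf) hx) _.
apply: ltW; apply: lt_le_trans hlt _; rewrite -/(best_approx g d n f); lra.
Qed.

(** Since the errors decrease, each of the at least n/2 terms with n/2 <= k <= n is at least
    2^(-|r-1|) n^(r-1) E_n: on this block k + 1 and n differ by a factor of at most 2. *)
Lemma besov_decay r f n : besov r g d f -> (0 < n)%N ->
  best_approx g d n f * n%:R `^ r
    <= 2 `^ (1 + `|r - 1|) * fine (besov_sum g d r f).
Proof.
move=> [hf hs] n0.
have E0 k : 0 <= best_approx g d k f by exact: best_approx_ge0.
set u := fun k : nat => k.+1%:R `^ (r - 1) * best_approx g d k f.
have u0 k : 0 <= u k by rewrite mulr_ge0 ?powR_ge0.
have s0 : (0 <= besov_sum g d r f)%E by apply: nneseries_ge0 => k _ _; rewrite lee_fin; exact: u0.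
have hsum : \sum_(1 <= k < n.+1) u k <= fine (besov_sum g d r f).
  rewrite -lee_fin fineK ?ge0_fin_numE // -sumEFin.
  by apply: nneseries_lim_ge => k _ _; rewrite lee_fin; exact: u0.
have nR : 1 <= n%:R :> R by rewrite ler1n.
pose h := uphalf n.
have hn : (0 < h <= n)%N by rewrite /h; lia.
pose c := 2 `^ (- `|r - 1|) : R.
have lower k : (h <= k < n.+1)%N -> c * n%:R `^ (r - 1) * best_approx g d n f <= u k.
  move=> /andP[hk kn]; apply: ler_pM => //; rewrite ?mulr_ge0 ?powR_ge0 //; last first.
    by apply: best_approx_anti.
  have nk : n%:R <= 2 * k.+1%:R :> R by rewrite -natrM ler_nat; lia.
  have kn' : k.+1%:R <= 2 * n%:R :> R by rewrite -natrM ler_nat; lia.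
  have k0 : 0 < k.+1%:R :> R by [].
  by rewrite /c powRN ler_pdivrMl ?powR_gt0 // powR_ratio //; lra.
have hs2 : (n.+1 - h)%:R * (c * n%:R `^ (r - 1) * best_approx g d n f)
    <= fine (besov_sum g d r f).
  apply: le_trans hsum; rewrite (@big_cat_nat _ _ _ h) //=; do ?lia.
  rewrite -[leLHS]add0r; apply: lerD; first exact: sumr_ge0.
  rewrite -[X in \sum_(X <= _ < _) _]add0n big_addn big_mkord.
  rewrite mulr_natl -[X in _ *+ X]card_ord -sumr_const.
  by apply: ler_sum => k _; apply: lower; have hk := ltn_ord k; lia.
have nh : n%:R <= 2 * (n.+1 - h)%:R :> R by rewrite -natrM ler_nat /h; lia.
have nr : n%:R `^ r = n%:R * n%:R `^ (r - 1).
  have [->|r0] := eqVneq r 0.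
    by rewrite powRr0 sub0r powR_inv1 // mulfV // gt_eqF //; lra.
  rewrite -[X in X * _]powRr1 // -powRD ?(gt_eqF (lt_le_trans ltr01 nR)) ?implybT //.
  by congr (_ `^ _); ring.
have cE : 2 `^ (1 + `|r - 1|) * c = 2.
  rewrite /c -powRD ?implybT //; last by rewrite pnatr_eq0 implybT.
  by rewrite addrK powRr1.
have c0 : 0 < 2 `^ (1 + `|r - 1|) :> R by rewrite powR_gt0.
apply: le_trans (ler_wpM2l (ltW c0) hs2).
have -> : 2 `^ (1 + `|r - 1|) * ((n.+1 - h)%:R * (c * n%:R `^ (r - 1) * best_approx g d n f))
  = (2 `^ (1 + `|r - 1|) * c) * (n.+1 - h)%:R * (n%:R `^ (r - 1) * best_approx g d n f).
  by ring.
rewrite cE nr.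
have -> : best_approx g d n f * (n%:R * n%:R `^ (r - 1))
  = n%:R * (n%:R `^ (r - 1) * best_approx g d n f) by ring.
by rewrite ler_wpM2r ?mulr_ge0 ?powR_ge0.
Qed.

End WeightedSpace.

(** * Hoelder bounds from polynomial approximation *)

Section HoelderBound.
Context {R : realType}.

(* The degree N is chosen of the order M z^(-1/(K+r)), which balances the two terms. *)
Lemma optimize_degree (r z A psi : R) (K M : nat) : 0 < r -> (0 < M)%N -> 0 < z <= 1 ->
  0 <= A ->
  (forall N, (M <= N)%N ->
     psi <= A * ((M%:R / N%:R) `^ r + z * (N%:R / M%:R) ^+ K)) ->
  psi <= A * (1 + 2 ^+ K) * z `^ (r / (K%:R + r)).
Proof.
move=> r0 M0 /andP[z0 z1] A0 h.
have K0 : 0 <= K%:R :> R by [].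
have Kr0 : 0 < K%:R + r by lra.
have m0 : 0 < M%:R :> R by rewrite ltr0n.
pose s := (K%:R + r)^-1.
have s0 : 0 < s by rewrite invr_gt0.
pose w := z `^ s.
have w0 : 0 < w by rewrite powR_gt0.
have w1 : w <= 1.
  apply: (@le_trans _ _ (1 `^ s)); last by rewrite powR1.
  by rewrite ge0_ler_powR ?nnegrE; do ?lra.
have W1 : 1 <= w^-1 by rewrite invf_ge1.
(* N lies between M/w and 2M/w: the lower bound gives (M/N)^r <= w^r, the upper one z (N/M)^K <= 2^K
   z w^(-K) = 2^K w^r. *)
pose N := (Num.truncn (M%:R / w)).+1.
have hN1 : M%:R / w < N%:R by exact: truncnS_gt.
have hMw : M%:R <= M%:R / w by rewrite ler_peMr // ltW.
have hN2 : N%:R <= 2 * (M%:R / w).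
  have : (Num.truncn (M%:R / w))%:R <= M%:R / w.
    by rewrite truncn_le // divr_ge0 ?ltW.
  have : 1 <= M%:R :> R by rewrite ler1n.
  by rewrite /N -natr1; lra.
have MN : (M <= N)%N by rewrite -(ler_nat R); lra.
have n0 : 0 < N%:R :> R by lra.
apply: le_trans (h N MN) _; rewrite -mulrA ler_wpM2l // mulrDl mul1r.
have zsr : z `^ (r / (K%:R + r)) = w `^ r by rewrite /w -powRrM mulrC.
have zw : z = w `^ (K%:R + r).
  by rewrite /w -powRrM mulVf ?gt_eqF // powRr1 // ltW.
rewrite zsr; apply: lerD.
  rewrite ge0_ler_powR ?nnegrE ?divr_ge0 ?(ltW r0) ?(ltW w0) //.
  by rewrite ler_pdivrMr // mulrC -ler_pdivrMr // ltW.
have -> : 2 ^+ K * w `^ r = z * (2 / w) ^+ K.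
  rewrite {1}zw powRD ?gt_eqF ?implybT // powR_mulrn ?(ltW w0) //.
  by rewrite exprMn exprVn; field; rewrite expf_neq0 // gt_eqF.
rewrite ler_wpM2l ?(ltW z0) // lerXn2r ?nnegrE ?divr_ge0 ?(ltW w0) //.
rewrite ler_pdivrMr //; apply: le_trans hN2 _.
by rewrite le_eqVlt; apply/orP; left; apply/eqP; ring.
Qed.

Variables (g d r : R).
Hypotheses (hg : 0 <= g) (hd : 0 <= d) (hr : 0 < r).

(** All that the estimate of the Hilbert transform uses about f - V f. One scale A measures both the
    size of F and the approximation error, which is A at N = M. *)
Definition approximable (F : R -> R) (A : R) (M : nat) : Prop :=
  (forall x, -1 < x < 1 -> `|F x| * jweight g d x <= A) /\
  forall N, (M <= N)%N -> exists2 q : {poly R}, (size q <= N.+1)%N &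
    forall x, -1 < x < 1 ->
      `|F x - q.[x]| * jweight g d x <= A * (M%:R / N%:R) `^ r.

(** The approximant has weighted size at most 2A, one A for F and one for the error, so
    [jweight_poly_bound] yields bounds on its values and increments without the weight. *)
Lemma approximable_poly_bound : exists C K, 0 < C /\ forall F A M N,
  (0 < M)%N -> 0 <= A -> approximable F A M -> (M <= N)%N ->
  exists q : {poly R}, forall x, -1 < x < 1 ->
    [/\ `|F x - q.[x]| * jweight g d x <= A * (M%:R / N%:R) `^ r,
        `|q.[x]| <= C * N%:R ^+ K * A &
        forall y, -1 < y < 1 -> `|q.[x] - q.[y]| <= C * N%:R ^+ K * A * `|x - y|].
Proof.
have [C [K [C0 hC]]] := jweight_poly_bound hg hd.
exists (C * 2), K; split; first by rewrite mulr_gt0.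
move=> F A M N M0 A0 [hF happ] MN.
have [q sq hq] := happ N MN; exists q => x hx.
have N0 : (0 < N)%N by exact: leq_trans MN.
have rat1 : (M%:R / N%:R) `^ r <= 1 :> R.
  apply: (@le_trans _ _ (1 `^ r)); last by rewrite powR1.
  rewrite ge0_ler_powR ?nnegrE ?divr_ge0 // ?(ltW hr) //.
  by rewrite ler_pdivrMr ?ltr0n // mul1r ler_nat.
have hq2 y : -1 < y < 1 -> `|q.[y]| * jweight g d y <= 2 * A.
  move=> hy; have -> : q.[y] = F y - (F y - q.[y]) by ring.
  have w0 := jweight_ge0 g d y.
  apply: (@le_trans _ _ ((`|F y| + `|F y - q.[y]|) * jweight g d y)).
    by rewrite ler_wpM2r // ler_normB.
  have := hF y hy; have := hq y hy.
  have : A * (M%:R / N%:R) `^ r <= A by rewrite ler_piMr.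
  by rewrite mulrDl; lra.
have hb := hC N q (2 * A) N0 (mulr_ge0 (ler0n _ _) A0) sq hq2.
have e : C * 2 * N%:R ^+ K * A = C * N%:R ^+ K * (2 * A) by ring.
rewrite e; split; [exact: hq | by apply: (hb x _).1; lra |].
move=> y hy; apply: poly_lipschitz; [|lra|lra].
by move=> z hz; exact: (hb z hz).2.
Qed.

(** In both parts a polynomial of degree N leaves an error A (M/N)^r plus a term O(A z (N/M)^K),
    with z = |x - t| M^K or z = jweight(x) M^K; [optimize_degree] balances the two. The second part
    works because the approximant is bounded without weight, so the weight itself is the small
    parameter. *)
Lemma approximable_hoelder : exists C K eta, [/\ 0 < C, 0 < eta <= 1 &
  forall F A M, (0 < M)%N -> 0 <= A -> approximable F A M ->
  (forall x t, -1 < x < 1 -> -1 < t < 1 ->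
     jweight g d t <= 2 `^ (g + d) * jweight g d x -> `|x - t| * M%:R ^+ K <= 1 ->
     `|F x - F t| * jweight g d t <= C * A * (`|x - t| * M%:R ^+ K) `^ eta) /\
  (forall x, -1 < x < 1 -> jweight g d x * M%:R ^+ K <= 1 ->
     `|F x| * jweight g d x <= C * A * (jweight g d x * M%:R ^+ K) `^ eta)].
Proof.
have [C [K [C0 hC]]] := approximable_poly_bound.
have K0 : 0 <= K%:R :> R by [].
pose W := 2 `^ g * 2 `^ d : R.
pose V := 2 `^ (g + d) : R.
have W0 : 0 < W by rewrite mulr_gt0 ?powR_gt0.
have V0 : 0 < V by rewrite powR_gt0.
pose B := V + 1 + C * (W + 1).
have B0 : 0 < B by rewrite !addr_gt0 // mulr_gt0 // addr_gt0.
exists (B * (1 + 2 ^+ K)), K, (r / (K%:R + r)); split.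
- by rewrite mulr_gt0 // addr_gt0 // exprn_gt0.
- have Kr0 : 0 < K%:R + r by move: hr; lra.
  by rewrite divr_gt0 //= ler_pdivrMr // mul1r lerDr.
move=> F A M M0 A0 hF.
have m0 : 0 < M%:R :> R by rewrite ltr0n.
have mK : 0 < M%:R ^+ K :> R by rewrite exprn_gt0.
have e : B * (1 + 2 ^+ K) * A = (B * A) * (1 + 2 ^+ K) by ring.
have BA0 : 0 <= B * A by rewrite mulr_ge0 // ltW.
have NM N : N%:R ^+ K = M%:R ^+ K * (N%:R / M%:R) ^+ K :> R.
  by rewrite -exprMn mulrCA mulfV ?mulr1 // gt_eqF.
split.
- move=> x t hx ht hxt hz.
  have [->|xt] := eqVneq x t.
    by rewrite !subrr normr0 !mul0r mulr_ge0 ?powR_ge0 // e mulr_ge0 // addr_ge0 ?exprn_ge0.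
  have d0 : 0 < `|x - t| by rewrite normr_gt0 subr_eq0.
  rewrite e; apply: (@optimize_degree r _ _ _ K M) => //; first by rewrite mulr_gt0.
  move=> N MN; have [q hq] := hC F A M N M0 A0 hF MN.
  have [q1 _ q3] := hq x hx; have [q1' _ _] := hq t ht.
  set E := (M%:R / N%:R) `^ r in q1 q1' *.
  have E0 : 0 <= E by exact: powR_ge0.
  have wt := jweight_ge0 g d t; have wx := jweight_ge0 g d x.
  have wtW : jweight g d t <= W by exact: jweight_le.
  have -> : F x - F t = (F x - q.[x]) - (F t - q.[t]) + (q.[x] - q.[t]) by ring.
  apply: (@le_trans _ _ ((`|F x - q.[x]| + `|F t - q.[t]| + `|q.[x] - q.[t]|) * jweight g d t)).
    rewrite ler_wpM2r //; apply: le_trans (ler_normD _ _) _.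
    by rewrite lerD2r; exact: ler_normB.
  rewrite [leLHS]mulrDl [X in X + _ <= _]mulrDl.
  have i1 : `|F x - q.[x]| * jweight g d t <= V * (A * E).
    apply: (@le_trans _ _ (`|F x - q.[x]| * (V * jweight g d x))); first by rewrite ler_wpM2l.
    by rewrite mulrCA ler_wpM2l ?(ltW V0).
  have i3 : `|q.[x] - q.[t]| * jweight g d t
      <= C * W * A * (`|x - t| * M%:R ^+ K * (N%:R / M%:R) ^+ K).
    apply: (@le_trans _ _ (C * N%:R ^+ K * A * `|x - t| * W)).
      by apply: ler_pM => //; exact: q3.
    by rewrite (NM N) le_eqVlt; apply/orP; left; apply/eqP; ring.
  set Z := `|x - t| * _ * _ in i3 *.
  have Z0 : 0 <= Z by rewrite /Z !mulr_ge0 ?exprn_ge0 ?divr_ge0 ?powR_ge0 //.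
  rewrite /B.
  have p1 : 0 <= A * E by exact: mulr_ge0.
  have p2 : 0 <= A * Z by exact: mulr_ge0.
  have p3 : 0 <= C * (W + 1) * (A * E) by rewrite mulr_ge0 // mulr_ge0 // ?addr_ge0 // ltW.
  have p4 : 0 <= (V + 1 + C) * (A * Z) by rewrite mulr_ge0 //; lra.
  have -> : (V + 1 + C * (W + 1)) * A * (E + Z)
    = (V * (A * E) + A * E + C * (W + 1) * (A * E))
      + ((V + 1 + C) * (A * Z) + C * W * A * Z) by ring.
  lra.
- move=> x hx hz.
  have wx := jweight_gt0 g d hx.
  rewrite e; apply: (@optimize_degree r _ _ _ K M) => //; first by rewrite mulr_gt0.
  move=> N MN; have [q hq] := hC F A M N M0 A0 hF MN.
  have [q1 q2 _] := hq x hx.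
  set E := (M%:R / N%:R) `^ r in q1 *.
  have E0 : 0 <= E by exact: powR_ge0.
  have -> : F x = (F x - q.[x]) + q.[x] by ring.
  apply: (@le_trans _ _ ((`|F x - q.[x]| + `|q.[x]|) * jweight g d x)).
    by rewrite ler_wpM2r ?(ltW wx) // ler_normD.
  rewrite mulrDl.
  have i3 : `|q.[x]| * jweight g d x
      <= C * A * (jweight g d x * M%:R ^+ K * (N%:R / M%:R) ^+ K).
    apply: (@le_trans _ _ (C * N%:R ^+ K * A * jweight g d x)).
      by rewrite ler_wpM2r // ltW.
    by rewrite (NM N) le_eqVlt; apply/orP; left; apply/eqP; ring.
  set Z := jweight g d x * _ * _ in i3 *.
  have Z0 : 0 <= Z by rewrite /Z !mulr_ge0 ?exprn_ge0 ?divr_ge0 ?powR_ge0 //.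
  rewrite /B.
  have p1 : 0 <= A * E by exact: mulr_ge0.
  have p2 : 0 <= A * Z by exact: mulr_ge0.
  have CW0 : 0 < C * W by rewrite mulr_gt0.
  have p3 : 0 <= (V + C * (W + 1)) * (A * E) by rewrite mulr_ge0 //; lra.
  have p4 : 0 <= (V + 1 + C * W) * (A * Z) by rewrite mulr_ge0 //; lra.
  have -> : (V + 1 + C * (W + 1)) * A * (E + Z)
    = (A * E + (V + C * (W + 1)) * (A * E))
      + ((V + 1 + C * W) * (A * Z) + C * A * Z) by ring.
  lra.
Qed.

End HoelderBound.

(** * The Hilbert transform away from the singularity *)

Section FarIntegral.
Context {R : realType}.
Notation mu := (@lebesgue_measure R).
Notation I11 := (`]-1, 1[%classic : set R).

Lemma measurable_half (s c : R) : s = 1 \/ s = -1 -> measurable [set x : R | c <= s * x].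
Proof.
case=> ->.
  rewrite (_ : [set _ | _] = `[c, +oo[%classic); first exact: measurable_itv.
  by apply/seteqP; split=> x /=; rewrite in_itv /= andbT mul1r.
rewrite (_ : [set _ | _] = `]-oo, (- c)%R]%classic); first exact: measurable_itv.
by apply/seteqP; split=> x /=; rewrite in_itv /= mulN1r; lra.
Qed.

(* s = 1 or s = -1 designates the endpoint nearest to t, so that s * t = |t|. *)
Variables (phi omega : R -> R) (A W B p s t h : R).
Hypotheses (hs : s = 1 \/ s = -1) (ht : 0 <= s * t < 1) (hp : 0 <= p < 1)
  (A0 : 0 <= A) (B0 : 0 <= B) (mphi : measurable_fun I11 phi)
  (momega : measurable_fun I11 omega)
  (omega0 : forall x, -1 < x < 1 -> 0 <= omega x)
  (homega : (\int[mu]_(x in I11) (omega x)%:E <= W%:E)%E)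
  (hphi : forall x, -1 < x < 1 -> `|phi x| <= A * omega x)
  (hB : forall x, -1 < x < 1 -> - 2^-1 <= s * x -> omega x <= B * (1 - s * x) `^ (- p))
  (h0 : 0 < h <= (1 - s * t) / 2).

(** With y = 1 - s x the distance of x to the endpoint s, and tau that of t, the sets read S0: y <=
    3/2 and S1: y >= 2 tau. *)
Let tau := 1 - s * t.
Let f x := `|phi x / (x - t)|.
Let E := I11 `&` [set x | h < `|x - t|].
Let S0 := [set x | - 2^-1 <= s * x].
Let S1 := [set x | 2 * tau - 1 <= (- s) * x].

Let tau0 : 0 < tau. Proof. by rewrite subr_gt0; case/andP: ht. Qed.
Let tau1 : tau <= 1. Proof. by rewrite gerBl; case/andP: ht. Qed.
Let hs' : - s = 1 \/ - s = -1. Proof. by case: hs => ->; [right | left; rewrite opprK]. Qed.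
Let mE : measurable E.
Proof. by apply: measurableI; [exact: measurable_itv | exact: measurable_dist_lt]. Qed.
Let mf : measurable_fun I11 f.
Proof.
by apply: measurableT_comp => //; apply: measurable_funM => //; exact: measurable_inv_sub.
Qed.
Let mfS S : measurable S -> S `<=` I11 -> measurable_fun S f.
Proof. by move=> mS hS; apply: measurable_funS mf => //; exact: measurable_itv. Qed.
Let mS0 : measurable S0. Proof. exact: measurable_half. Qed.
Let mS1 : measurable S1. Proof. exact: measurable_half. Qed.
Let dist x : `|x - t| = `|tau - (1 - s * x)|.
Proof.
by rewrite /tau; case: hs => ->; [congr (`|_|); ring | rewrite distrC; congr (`|_|); ring].
Qed.
Let EI x : E x -> -1 < x < 1. Proof. by case; rewrite /= in_itv. Qed.

Let f_le x c : -1 < x < 1 -> 0 < c -> c <= `|x - t| -> f x <= A * omega x * c^-1.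
Proof.
move=> hx c0 hc; rewrite /f normrM normfV; apply: ler_pM => //; first exact: hphi.
by rewrite lef_pV2 ?posrE //; exact: lt_le_trans hc.
Qed.

Let zone_eq x : 1 + (- s) * x = 1 - s * x. Proof. by rewrite mulNr. Qed.

(** Outside S0 the kernel is at most 2, giving 2AW. For y < tau/2 it is at most 2/tau, and
    integrating y^(-p) gives 2/(1 - p). For tau/2 <= y < 2 tau the density is O(tau^(-p)) and the
    kernel contributes ln (tau / h) on each side of t. The region S1 is left to X. *)
Lemma far_split X :
  (\int[mu]_(x in E `&` S0 `&` S1) (f x)%:E <= X%:E)%E ->
  (\int[mu]_(x in E) (f x)%:E <=
     (2 * A * W + A * B * tau `^ (- p) * (2 / (1 - p) + 4 * ln (tau / h)) + X)%:E)%E.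
Proof.
have ht' := ht; have hp' := hp; have h0' := h0; have tau0' := tau0; have tau1' := tau1.
move=> hX.
have f0 x : 0 <= f x by exact: normr_ge0.
have T0 : 0 <= A * B * tau `^ (- p) by rewrite !mulr_ge0 ?powR_ge0.
(* S2 is y >= tau/2 and S3 is y >= tau, the side of t away from the endpoint. *)
pose S2 := [set x : R | tau / 2 - 1 <= (- s) * x].
pose S3 := [set x : R | tau - 1 <= (- s) * x].
have mS2 : measurable S2 by exact: measurable_half.
have mS3 : measurable S3 by exact: measurable_half.
have mC (S S' : set R) : measurable S -> measurable S' -> measurable (S `&` ~` S').
  by move=> ? ?; rewrite -setDE; exact: measurableD.
set E1 := E `&` S0.
set E2 := E1 `&` ~` S1.
set E3 := E2 `&` S2.
have mE1 : measurable E1 by exact: measurableI.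
have mE2 : measurable E2 by exact: mC.
have mE3 : measurable E3 by exact: measurableI.
have nS (c x : R) : (~` [set x | c <= - s * x]) x -> - s * x < c.
  by move=> /negP; rewrite -ltNge.
have lnth : 0 <= ln (tau / h).
  by rewrite ln_ge0 // ler_pdivlMr; [rewrite /tau; lra | lra].
have P0 : (\int[mu]_(x in E `&` ~` S0) (f x)%:E <= (2 * A * W)%:E)%E.
  apply: (@int_le_dom _ _ I11 _ (fun x => 2 * A * omega x)) => //.
  - exact: mC.
  - by move=> x [[]].
  - by apply: mfS; [exact: mC | move=> x [[]]].
  - exact: measurable_funM.
  - by move=> x; rewrite /= in_itv /= => hx; rewrite !mulr_ge0 // omega0.
  - move=> x [Ex /negP]; rewrite -ltNge => hx; rewrite f0 /=.
    have -> : 2 * A * omega x = A * omega x * (2^-1)^-1 by rewrite invrK; ring.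
    apply: f_le => //; first exact: EI.
    have := ler_norm ((1 - s * x) - tau); rewrite distrC -dist /tau; lra.
  under eq_integral do rewrite EFinM.
  rewrite ge0_integralZl_EFin //.
  - by rewrite [leRHS]EFinM lee_wpmul2l ?lee_fin // mulr_ge0.
  - exact/measurable_EFinP.
  - by rewrite mulr_ge0.
have mono y c : 0 < c -> c <= y -> y `^ (- p) <= c `^ (- p).
  move=> c0 cy; rewrite !powRN lef_pV2 ?posrE ?powR_gt0 //; last lra.
  by rewrite ge0_ler_powR ?nnegrE; do ?lra; lra.
have PA : (\int[mu]_(x in E2 `&` ~` S2) (f x)%:E
    <= (A * B * tau `^ (- p) * (2 / (1 - p)))%:E)%E.
  have p1 : -1 < - p by lra.
  have tau20 : 0 <= tau / 2 by lra.
  have hz := zone_powR_gt 1 hs' p1 (lexx 0) tau20.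
  have M0 : 0 <= 2 * A * B / tau by rewrite divr_ge0 ?mulr_ge0 // ltW.
  apply: le_trans (int_le_powR hs' _ _ M0 hz _ _) _.
  - exact: mC.
  - by apply: mfS; [exact: mC | move=> x [[[[]]]]].
  - move=> x [[[/EI hx _] _] /nS]; rewrite mulNr /tau; move: hx.
    by case: hs => ->; lra.
  - move=> x [[[Ex S0x] _] /nS hx]; rewrite f0 /=.
    have {}hx : 1 - s * x < tau / 2 by move: hx; rewrite mulNr; lra.
    have hf : f x <= A * omega x * (tau / 2)^-1.
      apply: f_le; [exact: EI | lra |].
      by rewrite dist; apply: le_trans (ler_norm _); lra.
    apply: le_trans hf _; rewrite zone_eq.
    have hom := hB (EI Ex) S0x.
    have -> : 2 * A * B / tau * (1 - s * x) `^ (- p)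
      = A * (B * (1 - s * x) `^ (- p)) * (tau / 2)^-1 by field; rewrite gt_eqF.
    by rewrite ler_wpM2r ?invr_ge0 // ler_wpM2l.
  rewrite lee_fin.
  have -> : - p + 1 = 1 - p by ring.
  have h1p : 0 < 1 - p by lra.
  have e : (tau / 2) `^ (1 - p) <= tau * tau `^ (- p).
    apply: (@le_trans _ _ (tau `^ (1 - p))).
      by rewrite ge0_ler_powR ?nnegrE; do ?lra.
    by rewrite powRD ?gt_eqF ?implybT // powRr1 ?(ltW tau0).
  apply: (@le_trans _ _ (2 * A * B / tau * (tau * tau `^ (- p) / (1 - p)))).
    by rewrite ler_wpM2l // ler_wpM2r // invr_ge0 ltW.
  rewrite le_eqVlt; apply/orP; left; apply/eqP; field.
  by rewrite !gt_eqF.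
have htau : h <= tau by rewrite /tau; lra.
have PB1 : (\int[mu]_(x in E3 `&` ~` S3) (f x)%:E
    <= (2 * (A * B * tau `^ (- p)) * ln (tau / h))%:E)%E.
  have hz := zone_inv (- (s * t)) hs (_ : 0 < h) htau.
  have M0 : 0 <= 2 * (A * B * tau `^ (- p)) by rewrite mulr_ge0.
  apply: (int_le_powR hs _ _ M0 (hz _)).
  - exact: mC.
  - by apply: mfS; [exact: mC | move=> x [[[[[]]]]]].
  - by lra.
  - move=> x [[[[[Ix hx] _] _] S2x] /nS S3x].
    move: hx; rewrite /= dist ger0_norm; last by move: S3x; rewrite mulNr; lra.
    have S2x' : tau / 2 - 1 <= - s * x by [].
    by move: S2x' S3x; rewrite /tau mulNr; lra.
  - move=> x [[[[Ex S0x] _] S2x] /nS S3x]; rewrite f0 /=.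
    have {}S3x : 1 - s * x < tau by move: S3x; rewrite mulNr; lra.
    have {}S2x : tau / 2 <= 1 - s * x.
      by have := S2x : tau / 2 - 1 <= - s * x; rewrite mulNr; lra.
    have dE : `|x - t| = - (s * t) + s * x.
      by rewrite dist ger0_norm /tau; [ring | move: S3x; rewrite /tau; lra].
    have d0 : 0 < `|x - t| by case: Ex => _ /=; lra.
    have hom := hB (EI Ex) S0x.
    apply: le_trans (f_le (EI Ex) d0 (lexx _)) _.
    rewrite -dE powR_inv1; last lra.
    rewrite ler_wpM2r ?invr_ge0 // ?normr_ge0 //.
    have hy : (1 - s * x) `^ (- p) <= 2 * tau `^ (- p).
      apply: (@le_trans _ _ ((tau / 2) `^ (- p))); first by apply: mono => //; lra.
      apply: (@le_trans _ _ (2 `^ `|- p| * tau `^ (- p))); first by apply: powR_ratio; lra.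
      rewrite ler_wpM2r ?powR_ge0 // normrN ger0_norm; last by lra.
      by rewrite -[leRHS]powRr1 // ler_powR //; lra.
    apply: (@le_trans _ _ (A * (B * (2 * tau `^ (- p))))).
      by rewrite ler_wpM2l // (le_trans hom) // ler_wpM2l.
    by rewrite le_eqVlt; apply/orP; left; apply/eqP; ring.
have PB2 : (\int[mu]_(x in E3 `&` S3) (f x)%:E
    <= (2 * (A * B * tau `^ (- p)) * ln (tau / h))%:E)%E.
  have hz := zone_inv (s * t) hs' (_ : 0 < h) htau.
  have M0 : 0 <= 2 * (A * B * tau `^ (- p)) by rewrite mulr_ge0.
  apply: (int_le_powR hs' _ _ M0 (hz _)).
  - exact: measurableI.
  - by apply: mfS; [exact: measurableI | move=> x [[[[[]]]]]].
  - by lra.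
  - move=> x [[[[[Ix hx] _] /nS S1x] S2x] S3x].
    have {}S3x : tau <= 1 - s * x.
      by have := S3x : tau - 1 <= - s * x; rewrite mulNr; lra.
    move: hx; rewrite /= dist distrC ger0_norm; last lra.
    by move: S1x S3x; rewrite /tau mulNr; lra.
  - move=> x [[[[Ex S0x] _] S2x] S3x]; rewrite f0 /=.
    have {}S3x : tau <= 1 - s * x.
      by have := S3x : tau - 1 <= - s * x; rewrite mulNr; lra.
    have dE : `|x - t| = s * t + - s * x.
      by rewrite dist distrC ger0_norm /tau; [ring | move: S3x; rewrite /tau; lra].
    have d0 : 0 < `|x - t| by case: Ex => _ /=; lra.
    have hom := hB (EI Ex) S0x.
    apply: le_trans (f_le (EI Ex) d0 (lexx _)) _.
    rewrite -dE powR_inv1; last lra.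
    rewrite ler_wpM2r ?invr_ge0 // ?normr_ge0 //.
    have hy : (1 - s * x) `^ (- p) <= tau `^ (- p) by apply: mono.
    apply: (@le_trans _ _ (A * (B * tau `^ (- p)))).
      by rewrite ler_wpM2l // (le_trans hom) // ler_wpM2l.
    by rewrite mulrA; lra.
have H3 := int_le_setU mE3 mS3 (mfS mE3 _) (fun x _ => f0 x) PB2 PB1.
have {}H3 : (\int[mu]_(x in E3) (f x)%:E
    <= (A * B * tau `^ (- p) * (4 * ln (tau / h)))%:E)%E.
  apply: le_trans (H3 _) _; first by move=> x [[[[]]]].
  by rewrite lee_fin le_eqVlt; apply/orP; left; apply/eqP; ring.
have H2 := int_le_setU mE2 mS2 (mfS mE2 _) (fun x _ => f0 x) H3 PA.
have {}H2 := H2 (fun x Ex => (proj1 (proj1 (proj1 Ex)))).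
have H1 := int_le_setU mE1 mS1 (mfS mE1 _) (fun x _ => f0 x) hX H2.
have {}H1 := H1 (fun x Ex => (proj1 (proj1 Ex))).
have H0 := int_le_setU mE mS0 (mfS mE _) (fun x _ => f0 x) H1 P0.
have {}H0 := H0 (fun x Ex => (proj1 Ex)).
apply: le_trans H0 _.
by rewrite lee_fin le_eqVlt; apply/orP; left; apply/eqP; ring.
Qed.

Let ET := E `&` S0 `&` S1.
Let mET : measurable ET. Proof. by apply: measurableI => //; exact: measurableI. Qed.
Let ETI x : ET x -> -1 < x < 1. Proof. by move=> [[Ex _] _]; exact: EI. Qed.
Let mfET : measurable_fun ET f. Proof. by apply: mfS => // x /ETI; rewrite /= in_itv. Qed.

(** From y >= 2 tau on, |x - t| = y - tau >= y/2, so the singularity at t is no longer felt. *)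
Let ETP x : ET x -> [/\ -1 < x < 1, - 2^-1 <= s * x, 2 * tau <= 1 - s * x &
   f x <= 2 * `|phi x| / (1 - s * x)].
Proof.
have tau0' := tau0.
move=> [[Ex S0x] S1x]; have hx := EI Ex.
have {}S1x : 2 * tau <= 1 - s * x.
  by have := S1x : 2 * tau - 1 <= - s * x; rewrite mulNr; lra.
split=> //; have y0 : 0 < 1 - s * x by lra.
rewrite /f normrM normfV [2 * _]mulrC -mulrA ler_wpM2l //.
have -> : 2 / (1 - s * x) = ((1 - s * x) / 2)^-1 by rewrite invf_div.
rewrite lef_pV2 ?posrE ?divr_gt0 //; last by case: Ex => _ /=; have := h0; lra.
by rewrite dist distrC; apply: le_trans (ler_norm _); lra.
Qed.

Let ETub x : ET x -> 1 - s * x < 3.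
Proof. by move=> /ETP[hx h1 _ _]; lra. Qed.

(** The integrand is O(y^(-p-1)), dominated by its lower end; the resulting tau^(-p) is matched by
    the factor tau^p in u2. *)
Lemma far_tail_neg : 0 < p ->
  (\int[mu]_(x in E `&` S0 `&` S1) (f x)%:E
     <= (2 * A * B * (tau `^ (- p) / p))%:E)%E.
Proof.
move=> p0; have tau0' := tau0.
have p1 : - p - 1 < -1 by lra.
have hz := zone_powR_lt 1 3 hs' p1 tau0.
have M0 : 0 <= 2 * A * B by rewrite !mulr_ge0.
have e : - (- p - 1 + 1) = p by ring.
have e' : - p - 1 + 1 = - p by ring.
rewrite e e' in hz.
apply: (int_le_powR hs' mET mfET M0 hz) => x Ex.
  have [hx h1 h2 _] := ETP Ex; have h3 := ETub Ex.
  by rewrite zone_eq; lra.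
have [hx h1 h2 h3] := ETP Ex.
rewrite zone_eq normr_ge0 /=; apply: le_trans h3 _.
have y0 : 0 < 1 - s * x by lra.
rewrite (@powRD _ (1 - s * x)) ?(gt_eqF y0) ?implybT // powR_inv1 ?(ltW y0) // mulrA.
rewrite ler_wpM2r ?invr_ge0 ?(ltW y0) // -!mulrA ler_wpM2l //.
apply: le_trans (hphi hx) _; rewrite ler_wpM2l //; exact: hB.
Qed.

Lemma far_tail_inv (S : set R) (c : R) : p = 0 -> measurable S -> 0 < c < 3 ->
  (forall x, S x -> c < 1 - s * x) ->
  (\int[mu]_(x in E `&` S0 `&` S1 `&` S) (f x)%:E
     <= (2 * A * B * ln (3 / c))%:E)%E.
Proof.
move=> p0 mS hc hS; have tau0' := tau0.
have hz := zone_inv 1 hs' (_ : 0 < c) (_ : c <= 3).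
have M0 : 0 <= 2 * A * B by rewrite !mulr_ge0.
apply: (int_le_powR hs' _ _ M0 (hz _ _)); [exact: measurableI | | lra | lra | |].
- by apply: measurable_funS mfET => // x [].
- move=> x [Ex Sx]; have h1 := hS x Sx; have h3 := ETub Ex.
  by rewrite zone_eq; lra.
move=> x [Ex Sx]; have [hx h1 h2 h3] := ETP Ex.
rewrite zone_eq normr_ge0 /=; apply: le_trans h3 _.
have y0 : 0 < 1 - s * x by lra.
rewrite powR_inv1 ?(ltW y0) // ler_wpM2r ?invr_ge0 ?(ltW y0) // -!mulrA ler_wpM2l //.
apply: le_trans (hphi hx) _; rewrite ler_wpM2l //.
by have := hB hx h1; rewrite p0 oppr0 powRr0 mulr1.
Qed.

Lemma far_tail_log : p = 0 ->
  (\int[mu]_(x in E `&` S0 `&` S1) (f x)%:E <= (2 * A * B * ln (3 / tau))%:E)%E.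
Proof.
move=> p0; have tau0' := tau0; have tau1' := tau1.
have := @far_tail_inv S1 tau p0 mS1.
rewrite -[E `&` S0 `&` S1 `&` S1]setIA setIid; apply; first lra.
by move=> x; rewrite /S1 /= mulNr; lra.
Qed.

(** Up to y0 the decay makes 1/y integrable, as y^(theta-1); beyond y0 only ln (6 / y0) appears. The
    bound is therefore uniform in tau. *)
Lemma far_tail_decay (y0 theta D : R) : p = 0 -> 0 < y0 <= 1 -> 0 < theta -> 0 <= D ->
  (forall x, -1 < x < 1 -> 1 - s * x <= y0 ->
     `|phi x| <= A * D * ((1 - s * x) / y0) `^ theta) ->
  (\int[mu]_(x in E `&` S0 `&` S1) (f x)%:E
     <= (2 * A * D * (2 `^ theta / theta) + 2 * A * B * ln (6 / y0))%:E)%E.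
Proof.
move=> p0 hy0 th0 D0 hD; have tau0' := tau0; have y00 : 0 < y0 by lra.
pose S := [set x : R | 1 - y0 <= s * x].
have mS : measurable S by exact: measurable_half.
apply: (int_le_setU mET mS mfET (fun x _ => normr_ge0 _)).
- have t1 : -1 < theta - 1 by lra.
  have hz := zone_powR_gt 1 hs' t1 (lexx 0) (_ : 0 <= 2 * y0).
  rewrite subrK in hz.
  have M0 : 0 <= 2 * A * D / y0 `^ theta by rewrite divr_ge0 ?powR_ge0 // !mulr_ge0.
  have mES : measurable (ET `&` S) by exact: measurableI.
  apply: le_trans (int_le_powR hs' mES _ M0 (hz _) _ _) _.
  + by apply: measurable_funS mfET => // x [].
  + lra.
  + move=> x [Ex Sx]; have [hx h1 h2 _] := ETP Ex.
    by rewrite zone_eq; have : 1 - y0 <= s * x by []; lra.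
  + move=> x [Ex Sx]; have [hx h1 h2 h3] := ETP Ex.
    have yy : 1 - s * x <= y0 by have : 1 - y0 <= s * x by []; lra.
    rewrite zone_eq normr_ge0 /=; apply: le_trans h3 _.
    have yp : 0 < 1 - s * x by lra.
    rewrite (@powRD _ (1 - s * x)) ?(gt_eqF yp) ?implybT // powR_inv1 ?(ltW yp) // mulrA.
    rewrite ler_wpM2r ?invr_ge0 ?(ltW yp) //.
    have := hD x hx yy; rewrite powRM ?invr_ge0 ?(ltW yp) ?(ltW y00) //.
    rewrite -powR_inv1 ?(ltW y00) // -powRrM mulN1r powRN => h4.
    have -> : 2 * A * D / y0 `^ theta * (1 - s * x) `^ theta
      = 2 * (A * D * ((1 - s * x) `^ theta * (y0 `^ theta)^-1)) by ring.
    by rewrite ler_wpM2l.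
  rewrite lee_fin powRM ?(ltW y00) // le_eqVlt; apply/orP; left; apply/eqP; field.
  by rewrite (gt_eqF th0) gt_eqF ?powR_gt0.
- have -> : 6 / y0 = 3 / (y0 / 2) by field; rewrite gt_eqF.
  apply: far_tail_inv => //; [exact: measurableC | lra |].
  by move=> x /negP; rewrite /S /= -ltNge => hx; lra.
Qed.

End FarIntegral.

(** * The weights u1 and u2, and the local behaviour of Jacobi weights *)

Section Weights.
Context {R : realType}.
Implicit Types (a b p q s t x y z tau : R).

Lemma ppart_ge0 a : 0 <= ppart a.
Proof. by rewrite /ppart le_max lexx. Qed.

Lemma npart_ge0 a : 0 <= npart a.
Proof. by rewrite /npart le_max lexx. Qed.

Lemma ppart_npart a : a = ppart a - npart a.
Proof.
rewrite /ppart /npart; case: (leP 0 a) => h.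
  by rewrite max_l ?subr0 //; lra.
by rewrite max_r; lra.
Qed.

Lemma npart_lt1 a : -1 < a -> npart a < 1.
Proof. by move=> h; rewrite /npart gt_max ltr01 /=; lra. Qed.

Lemma jweightD a b p q x : -1 < x < 1 ->
  jweight (a + p) (b + q) x = jweight a b x * jweight p q x.
Proof.
move=> hx; have y1 : 1 - x != 0 by apply/eqP; lra.
have y2 : 1 + x != 0 by apply/eqP; lra.
by rewrite /jweight !powRD ?y1 ?y2 ?implybT //; ring.
Qed.

(** This is u = u_+ / u_-. It turns F u into the bounded F u1 times a weight whose exponents exceed
    -1 whenever a and b do. *)
Lemma jweight_split a b x : -1 < x < 1 ->
  jweight a b x = u1 a b x * jweight (- npart a) (- npart b) x.
Proof. by move=> hx; rewrite {1}(ppart_npart a) {1}(ppart_npart b) jweightD. Qed.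

Lemma uminusV a b x : -1 < x < 1 ->
  uminus a b x * jweight (- npart a) (- npart b) x = 1.
Proof.
move=> hx; rewrite /uminus -jweightD // !subrr /jweight !powRr0.
by rewrite mulr1.
Qed.

Lemma u2_den_ge1 a b t : 1 <= 1 + uplus a b (-1) * uminus a b (-1) * `|ln (1 + t)|
  + uplus a b 1 * uminus a b 1 * `|ln (1 - t)|.
Proof. by rewrite -addrA lerDl addr_ge0 // !mulr_ge0 ?jweight_ge0. Qed.

Lemma u2_ge0 a b t : 0 <= u2 a b t.
Proof.
rewrite divr_ge0 ?jweight_ge0 //; apply: le_trans (u2_den_ge1 a b t); exact: ler01.
Qed.

Lemma u2_le_uminus a b t : u2 a b t <= uminus a b t.
Proof.
have h := u2_den_ge1 a b t.
by rewrite ler_pdivrMr ?ler_peMr ?jweight_ge0 //; lra.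
Qed.

(** For a = 0 the coefficient of this logarithm is 2^|b| >= 1, by the convention 0^0 = 1. *)
Lemma u2_log_right b t : u2 0 b t <= uminus 0 b t / (1 + `|ln (1 - t)|).
Proof.
have n0 := normr_ge0 (ln (1 - t)).
rewrite ler_wpM2l ?jweight_ge0 // lef_pV2 ?posrE; last 2 first.
- by apply: lt_le_trans (u2_den_ge1 0 b t).
- by rewrite ltr_wpDr.
rewrite -addrA lerD2l; apply: (@le_trans _ _ (uplus 0 b 1 * uminus 0 b 1 * `|ln (1 - t)|)).
  rewrite ler_peMl // /uplus /uminus /jweight /ppart /npart oppr0 maxxx subrr (@powRr0 R 0) !mul1r.
  rewrite -powRD; last by rewrite (@pnatr_eq0 R 2) implybT.
  apply: (@le_trans _ _ ((1 + 1) `^ 0)); first by rewrite powRr0.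
  by rewrite ler_powR ?addr_ge0 ?le_max ?lexx //; lra.
by rewrite lerDr !mulr_ge0 ?jweight_ge0.
Qed.

Lemma u2_log_left a t : u2 a 0 t <= uminus a 0 t / (1 + `|ln (1 + t)|).
Proof.
have n0 := normr_ge0 (ln (1 + t)).
rewrite ler_wpM2l ?jweight_ge0 // lef_pV2 ?posrE; last 2 first.
- by apply: lt_le_trans (u2_den_ge1 a 0 t).
- by rewrite ltr_wpDr.
rewrite -addrA lerD2l.
apply: (@le_trans _ _ (uplus a 0 (-1) * uminus a 0 (-1) * `|ln (1 + t)|)).
  rewrite ler_peMl // /uplus /uminus /jweight /ppart /npart oppr0 maxxx opprK subrr.
  rewrite (@powRr0 R 0) !mulr1 -powRD; last by rewrite (@pnatr_eq0 R 2) implybT.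
  apply: (@le_trans _ _ ((1 + 1) `^ 0)); first by rewrite powRr0.
  by rewrite ler_powR ?addr_ge0 ?le_max ?lexx //; lra.
by rewrite lerDl !mulr_ge0 ?jweight_ge0.
Qed.

Lemma powR_lipschitz s y z : 0 < z -> `|y - z| <= z / 2 ->
  `|y `^ s - z `^ s| <= `|s| * 2 `^ `|s - 1| * z `^ s * (`|y - z| / z).
Proof.
move=> z0 hyz.
have hb x : z / 2 <= x <= 2 * z -> is_derive x (1 : R) (fun y => y `^ s) (s * x `^ (s - 1)) /\
    `|s * x `^ (s - 1)| <= `|s| * 2 `^ `|s - 1| * z `^ s / z.
  move=> hx; have x0 : 0 < x by lra.
  split; first exact: is_derive1_powR.
  rewrite normrM [`|_ `^ _|]ger0_norm ?powR_ge0 // -!mulrA ler_wpM2l //.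
  have -> : z `^ s / z = z `^ (s - 1).
    by rewrite powRB ?powRr1 ?(ltW z0) // (gt_eqF z0) implybT.
  by apply: powR_ratio; lra.
have hD := hyz; rewrite ler_norml in hD.
have cont x : z / 2 <= x <= 2 * z -> {for x, continuous (fun y => y `^ s)}.
  by move=> hx; apply: continuous_powR; lra.
have mvt u v : z / 2 <= u -> u <= v -> v <= 2 * z ->
    `|v `^ s - u `^ s| <= `|s| * 2 `^ `|s - 1| * z `^ s / z * `|v - u|.
  move=> zu uv vz.
  have du x : x \in `]u, v[ -> is_derive x (1 : R) (fun y => y `^ s) (s * x `^ (s - 1)).
    by rewrite in_itv /= => hx; apply: (hb x _).1; lra.
  have [|c + ->] := MVT_segment uv du.
    by apply: continuous_in_subspaceT => x; rewrite inE /= in_itv /= => hx; apply: cont; lra.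
  rewrite in_itv /= => hc; rewrite normrM ler_wpM2r //.
  by apply: (hb c _).2; lra.
have -> : `|s| * 2 `^ `|s - 1| * z `^ s * (`|y - z| / z)
  = `|s| * 2 `^ `|s - 1| * z `^ s / z * `|y - z| by ring.
have [yz|yz] := leP y z.
  by rewrite distrC [X in _ * X]distrC; apply: mvt => //; lra.
by apply: mvt; lra.
Qed.

(** Within half the distance from t to the endpoints, 1 - x and 1 + x stay within a factor 2 of 1 -
    t and 1 + t. *)
Lemma jweight_local_le p q x t : -1 < t < 1 -> `|x - t| <= (1 - `|t|) / 2 ->
  jweight p q x <= 2 `^ (`|p| + `|q|) * jweight p q t /\
  jweight p q t <= 2 `^ (`|p| + `|q|) * jweight p q x.
Proof.
move=> ht; rewrite ler_norml => hx.
have h1 := ler_norm t; have h2 : - t <= `|t| by rewrite -normrN ler_norm.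
have e : 2 `^ (`|p| + `|q|) = 2 `^ `|p| * 2 `^ `|q| :> R.
  by rewrite powRD // pnatr_eq0 implybT.
have hle u v : 0 < 1 - u -> 0 < 1 + u -> 1 - u <= 2 * (1 - v) -> 1 - v <= 2 * (1 - u) ->
    1 + u <= 2 * (1 + v) -> 1 + v <= 2 * (1 + u) ->
    jweight p q u <= 2 `^ (`|p| + `|q|) * jweight p q v.
  move=> *; rewrite e /jweight.
  have -> : 2 `^ `|p| * 2 `^ `|q| * ((1 - v) `^ p * (1 + v) `^ q)
    = (2 `^ `|p| * (1 - v) `^ p) * (2 `^ `|q| * (1 + v) `^ q) by ring.
  by apply: ler_pM; rewrite ?powR_ge0 // powR_ratio.
by split; apply: hle; clear - h1 h2 hx ht; lra.
Qed.

(** The variation is relative to the value at t, in units of 1 - |t|; this is the source of the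
    second term of the Hoelder constant in [weighted_hoelder]. *)
Lemma jweight_local_lipschitz p q : exists2 C : R, 0 < C & forall x t, -1 < t < 1 ->
  `|x - t| <= (1 - `|t|) / 2 ->
  `|jweight p q x - jweight p q t| <= C * jweight p q t * (`|x - t| / (1 - `|t|)).
Proof.
pose c (s : R) : R := `|s| * 2 `^ `|s - 1|.
have c0 s : 0 <= c s by rewrite mulr_ge0 ?powR_ge0.
exists (c p * 2 `^ `|q| + c q + 1); first by rewrite ltr_wpDl ?addr_ge0 ?mulr_ge0 ?powR_ge0.
move=> x t ht hx; have hx' := hx; rewrite ler_norml in hx'.
have h1 := ler_norm t; have h2 : - t <= `|t| by rewrite -normrN ler_norm.
set X1 := (1 - x) `^ p; set X2 := (1 + x) `^ q.
set T1 := (1 - t) `^ p; set T2 := (1 + t) `^ q.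
set e := `|x - t| / (1 - `|t|).
have t0 : 0 < 1 - `|t| by rewrite subr_gt0 ltr_norml.
have e0 : 0 <= e by rewrite divr_ge0 // ltW.
have T10 : 0 <= T1 by exact: powR_ge0.
have T20 : 0 <= T2 by exact: powR_ge0.
have hz z : 1 - `|t| <= z -> `|x - t| / z <= e.
  by move=> hz; rewrite ler_wpM2l // lef_pV2 ?posrE //; lra.
have d1 : `|X1 - T1| <= c p * T1 * e.
  have xe : `|(1 - x) - (1 - t)| = `|x - t| by rewrite distrC; congr (`|_|); ring.
  apply: le_trans (powR_lipschitz _ _ _) _; [lra | by rewrite xe; lra |].
  by rewrite xe ler_wpM2l ?mulr_ge0 ?c0 //; apply: hz; lra.
have d2 : `|X2 - T2| <= c q * T2 * e.
  have xe : `|(1 + x) - (1 + t)| = `|x - t| by congr (`|_|); ring.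
  apply: le_trans (powR_lipschitz _ _ _) _; [lra | by rewrite xe; lra |].
  by rewrite xe ler_wpM2l ?mulr_ge0 ?c0 //; apply: hz; lra.
have X2T2 : X2 <= 2 `^ `|q| * T2 by apply: powR_ratio; lra.
have X20 : 0 <= X2 by exact: powR_ge0.
have -> : jweight p q x - jweight p q t = (X1 - T1) * X2 + T1 * (X2 - T2).
  by rewrite /jweight -/X1 -/X2 -/T1 -/T2; ring.
apply: le_trans (ler_normD _ _) _; rewrite !normrM (ger0_norm X20) (ger0_norm T10).
rewrite /jweight -/T1 -/T2.
have i1 : `|X1 - T1| * X2 <= (c p * T1 * e) * (2 `^ `|q| * T2) by apply: ler_pM.
have i2 : T1 * `|X2 - T2| <= T1 * (c q * T2 * e) by rewrite ler_wpM2l.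
have i3 : 0 <= T1 * T2 * e by apply: mulr_ge0 => //; exact: mulr_ge0.
have -> : (c p * 2 `^ `|q| + c q + 1) * (T1 * T2) * e =
  (c p * T1 * e) * (2 `^ `|q| * T2) + T1 * (c q * T2 * e) + T1 * T2 * e by ring.
lra.
Qed.

End Weights.

(** Absorbs additive constants into the logarithm. *)
Lemma ln_nat_ge (R : realType) (M : nat) (c : R) : (2 <= M)%N -> 0 <= c -> c <= c / ln 2 * ln M%:R.
Proof.
move=> M2 c0; have l2 : 0 < ln 2 :> R by rewrite ln_gt0 ?ltr1n.
rewrite -mulrA ler_peMr // mulrC ler_pdivlMr // mul1r.
by rewrite ler_ln ?posrE ?ltr0n ?ler_nat //; exact: ltnW.
Qed.

(** * The part of the integral away from t, weighted by u2 *)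

Section HilbertBound.
Context {R : realType}.
Notation mu := (@lebesgue_measure R).
Notation I11 := (`]-1, 1[%classic : set R).
Variables (a b : R).
Hypotheses (ha : -1 < a) (hb : -1 < b).

Let omega (x : R) := jweight (- npart a) (- npart b) x.

(** Both endpoints are treated at once: al is the exponent at the endpoint s and be the opposite
    one, whose factor is replaced by a constant. *)
Lemma u1_side (s x : R) : s = 1 \/ s = -1 -> let al := if s == 1 then a else b in
  let be := if s == 1 then b else a in -1 < x < 1 ->
  [/\ u1 a b x <= 2 `^ ppart be * (1 - s * x) `^ ppart al,
      - 2^-1 <= s * x -> omega x <= 2 `^ npart be * (1 - s * x) `^ (- npart al) &
      0 <= s * x -> u2 a b x <= 2 `^ npart be * (1 - s * x) `^ npart al /\
        (al = 0 -> u2 a b x <= 2 `^ npart be / (1 + `|ln (1 - s * x)|))].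
Proof.
move=> hs al be hx.
have [e1 e2 e3] : [/\ forall p q, (if s == 1 then jweight p q x else jweight q p x)
      = (1 - s * x) `^ p * (1 + s * x) `^ q,
    u2 a b x <= uminus a b x & al = 0 -> u2 a b x <= uminus a b x / (1 + `|ln (1 - s * x)|)].
  split.
  - move=> p q; case: hs => ->; first by rewrite eqxx !mul1r.
    rewrite ifF; last by apply/negP => /eqP; lra.
    by rewrite /jweight !mulN1r opprK mulrC.
  - exact: u2_le_uminus.
  - rewrite /al; case: hs => ->; first by rewrite eqxx mul1r => ->; exact: u2_log_right.
    rewrite ifF; last by apply/negP => /eqP; lra.
    by rewrite mulN1r opprK => ->; exact: u2_log_left.
have sx : -1 < s * x < 1 by case: hs => ->; lra.
have E (f : R -> R) : jweight (f a) (f b) x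
    = (1 - s * x) `^ (f al) * (1 + s * x) `^ (f be).
  by rewrite -(e1 (f al) (f be)) /al /be; case: (s == 1).
have n1 := npart_ge0 al; have n2 := npart_ge0 be.
have p1 := ppart_ge0 al; have p2 := ppart_ge0 be.
have um : 0 <= s * x -> uminus a b x <= 2 `^ npart be * (1 - s * x) `^ npart al.
  move=> sx0; rewrite /uminus (E (@npart R)) mulrC ler_wpM2r ?powR_ge0 //.
  by rewrite ge0_ler_powR ?nnegrE; do ?lra.
split.
- rewrite /u1 /uplus (E (@ppart R)) mulrC ler_wpM2r ?powR_ge0 //.
  by rewrite ge0_ler_powR ?nnegrE; do ?lra.
- move=> sx2; rewrite /omega (E (fun c => - npart c)) mulrC ler_wpM2r ?powR_ge0 //.
  have := @powR_ratio R (- npart be) (1 + s * x) 1.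
  by rewrite normrN ger0_norm // powR1 !mulr1; apply; lra.
- move=> sx0; split; first exact: le_trans e2 (um sx0).
  move=> al0; apply: le_trans (e3 al0) _; rewrite ler_wpM2r ?invr_ge0 ?addr_ge0 //.
  apply: le_trans (um sx0) _; rewrite al0 /npart oppr0 maxxx powRr0.
  by rewrite mulr1 lexx.
Qed.

Let decays (F : R -> R) (A : R) (M K : nat) (C1 eta : R) :=
  forall x, -1 < x < 1 -> u1 a b x * M%:R ^+ K <= 1 ->
    `|F x| * u1 a b x <= C1 * A * (u1 a b x * M%:R ^+ K) `^ eta.

(** The cut-off makes ln (tau / h) = ln (2 M^K) <= (1 + K) ln M independently of t, and the factor
    tau^(-p) of [far_split] is cancelled by u2(t) = O(tau^p). *)
Lemma far_bound (s : R) (K : nat) (C1 eta : R) : s = 1 \/ s = -1 ->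
  0 < C1 -> 0 < eta ->
  exists2 C, 0 < C & forall (F : R -> R) (A : R) (M : nat) (t : R),
    0 <= s * t < 1 -> (2 <= M)%N -> 0 <= A -> measurable_fun I11 F ->
    (forall x, -1 < x < 1 -> `|F x| * u1 a b x <= A) -> decays F A M K C1 eta ->
    exists X : R, [/\ 0 <= X,
    (\int[mu]_(x in (I11 `&` [set x | ((1 - s * t) / (2 * M%:R ^+ K) < `|x - t|)%R]))
       `|F x * jweight a b x / (x - t)|%:E <= X%:E)%E &
    X * u2 a b t <= C * A * ln M%:R].
Proof.
move=> hs C10 eta0.
set al := if s == 1 then a else b; set be := if s == 1 then b else a.
have [al1 be1] : -1 < al /\ -1 < be by rewrite /al /be; case: ifP.
pose p := npart al; pose B : R := 2 `^ npart be.
have p01 : 0 <= p < 1 by rewrite /p npart_ge0 npart_lt1.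
have B0 : 0 < B by rewrite powR_gt0.
have na1 : -1 < - npart a by rewrite ltrN2 npart_lt1.
have nb1 : -1 < - npart b by rewrite ltrN2 npart_lt1.
have [W W0 hW] := int_jweight na1 nb1.
have l2 : 0 < ln 2 :> R by rewrite ln_gt0 ?ltr1n.
have K0 : 0 <= K%:R :> R by [].
have momega : measurable_fun I11 omega by exact: measurable_jweight.
have omega0 x : -1 < x < 1 -> 0 <= omega x by move=> _; exact: jweight_ge0.
have mphi (F : R -> R) : measurable_fun I11 F ->
    measurable_fun I11 (fun x => F x * jweight a b x).
  by move=> mF; apply: measurable_funM => //; exact: measurable_jweight.
have phiE (F : R -> R) x : -1 < x < 1 ->
    `|F x * jweight a b x| = `|F x| * u1 a b x * omega x.
  by move=> hx; rewrite normrM [X in _ * X]ger0_norm ?jweight_ge0 // jweight_split // mulrA.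
have hB x : -1 < x < 1 -> - 2^-1 <= s * x -> omega x <= B * (1 - s * x) `^ (- p).
  by move=> hx hsx; have [_ h _] := u1_side hs hx; exact: h.
have t1 (t : R) : 0 <= s * t < 1 -> -1 < t < 1 by case: hs => ->; lra.
have hu2 t : 0 <= s * t < 1 -> u2 a b t <= B * (1 - s * t) `^ p.
  by move=> ht; have [_ _ h] := u1_side hs (t1 t ht); case/andP: ht => /h[].
(* [tail] treats the points at distance more than 2(1 - |t|) from the endpoint s.
   There u2(t) must compensate a power of 1 - |t| when the exponent al at s is
   negative and a logarithm when al = 0; for al > 0 it compensates nothing, and
   the decay of F at the endpoint is used instead. *)
have [C3 C30 tail] : exists2 C3, 0 <= C3 & forall (F : R -> R) (A : R) (M : nat) (t h : R),
    0 <= s * t < 1 -> (2 <= M)%N -> 0 <= A -> measurable_fun I11 F ->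
    (forall x, -1 < x < 1 -> `|F x| * u1 a b x <= A) -> decays F A M K C1 eta ->
    0 < h <= (1 - s * t) / 2 ->
    exists X : R, [/\ 0 <= X,
     (\int[mu]_(x in (I11 `&` [set x | (h < `|x - t|)%R] `&` [set x | (- 2^-1 <= s * x)%R]
         `&` [set x | (2 * (1 - s * t) - 1 <= - s * x)%R]))
       `|F x * jweight a b x / (x - t)|%:E <= X%:E)%E &
     X * u2 a b t <= C3 * A * ln M%:R].
  have lM0 (M : nat) : (2 <= M)%N -> 0 <= ln M%:R :> R.
    by move=> M2; apply: ln_ge0; rewrite ler1n; exact: ltnW.
  have hphi (F : R -> R) (A : R) : (forall x, -1 < x < 1 -> `|F x| * u1 a b x <= A) ->
      forall x, -1 < x < 1 -> `|F x * jweight a b x| <= A * omega x.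
    move=> hF x hx; rewrite (phiE F x hx); apply: ler_wpM2r; [exact: omega0 | exact: hF].
  have p0 : 0 <= p by lra.
  have BB0 : 0 <= B * B by rewrite mulr_ge0 // ltW.
  have [al0|al0|al0] := ltrgt0P al.
  - have pE : p = 0 by rewrite /p /npart max_l //; lra.
    have ppE : ppart al = al by rewrite /ppart max_r // ltW.
    pose V : R := 2 `^ ppart be; have V0 : 0 < V by rewrite powR_gt0.
    have V1 : 1 <= V by rewrite -(@powRr0 R 2) ler_powR ?ppart_ge0 //; lra.
    pose D := C1 * B; have D0 : 0 <= D by rewrite mulr_ge0 ?(ltW C10) ?(ltW B0).
    pose theta := al * eta; have th0 : 0 < theta by rewrite mulr_gt0.
    pose G := 2 * D * (2 `^ theta / theta) * B + 2 * (B * B) * (ln 6 + ln V / al).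
    have ln60 : 0 <= ln 6 :> R by rewrite ln_ge0 // ler1n.
    have lnV0 : 0 <= ln V / al by rewrite divr_ge0 ?ln_ge0 // ltW.
    have G0 : 0 <= G.
      apply: addr_ge0; last by rewrite mulr_ge0 ?addr_ge0 // mulr_ge0.
      rewrite mulr_ge0 ?(ltW B0) //; apply: mulr_ge0; first by rewrite mulr_ge0.
      by rewrite divr_ge0 ?powR_ge0 // ltW.
    exists (G / ln 2 + 2 * (B * B) * (K%:R / al)).
      by rewrite addr_ge0 ?divr_ge0 ?(ltW l2) // mulr_ge0 ?divr_ge0 ?(ltW al0) // mulr_ge0.
    move=> F A M t h ht M2 A0 mF hF hdec h0.
    have m1 : 1 <= M%:R ^+ K :> R by rewrite exprn_ege1 // ler1n; exact: ltnW.
    set m := M%:R ^+ K in m1.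
    have Vm1 : 1 <= V * m by rewrite -[leLHS]mulr1 ler_pM.
    have Vm0 : 0 < V * m by exact: lt_le_trans Vm1.
    (* The distance at which the bound V y^al for u1 equals 1/m: closer to the endpoint the decay
       hypothesis applies. Being a negative power of V M^K, it makes ln (6 / y0) of order ln M. *)
    pose y0 := (V * m) `^ (- al^-1).
    have y00 : 0 < y0 by rewrite powR_gt0.
    have y01 : 0 < y0 <= 1.
      rewrite y00 /= /y0 powRN invf_le1 ?powR_gt0 //.
      by rewrite -(@powRr0 R (V * m)) ler_powR // invr_ge0 ltW.
    have y0al : y0 `^ al * (V * m) = 1.
      rewrite /y0 -powRrM mulNr mulVf ?gt_eqF // powR_inv1 ?(ltW Vm0) //.
      by rewrite mulVf // gt_eqF.
    have hD x : -1 < x < 1 -> 1 - s * x <= y0 ->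
        `|F x * jweight a b x| <= A * D * ((1 - s * x) / y0) `^ theta.
      move=> hx hy; have sx0 : 0 <= s * x by clear - hy y01; lra.
      have y1 : 0 < 1 - s * x.
        by rewrite subr_gt0; case/andP: hx => ? ?; case: hs => ->; rewrite ?mul1r // mulN1r ltrNl.
      have [hu1 hom _] := u1_side hs hx; rewrite -/al -/be -/V -/p ppE in hu1 hom.
      have z1 : u1 a b x * m <= ((1 - s * x) / y0) `^ al.
        apply: (@le_trans _ _ (V * (1 - s * x) `^ al * m)).
          by rewrite ler_wpM2r // (le_trans ler01).
        rewrite powRM ?invr_ge0 ?(ltW y1) ?(ltW y00) // -powR_inv1 ?(ltW y00) //.
        rewrite -powRrM mulN1r powRN.
        have -> : V * (1 - s * x) `^ al * m = (1 - s * x) `^ al * (V * m) by ring.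
        rewrite ler_wpM2l ?powR_ge0 // -[leRHS]mul1r -y0al.
        by rewrite mulrAC mulfV ?mul1r // gt_eqF ?powR_gt0.
      have q0 : 0 <= (1 - s * x) / y0 by rewrite divr_ge0 ?(ltW y1) ?(ltW y00).
      have q1 : ((1 - s * x) / y0) `^ al <= 1.
        apply: (@le_trans _ _ (1 `^ al)); last by rewrite powR1.
        by rewrite ge0_ler_powR ?nnegrE ?(ltW al0) // ler_pdivrMr // mul1r.
      have hd := hdec x hx (le_trans z1 q1).
      have omB : omega x <= B.
        apply: le_trans (hom (le_trans _ sx0)) _;
          by rewrite ?oppr_le0 ?invr_ge0 // pE oppr0 powRr0 mulr1.
      rewrite phiE //.
      have -> : A * D * ((1 - s * x) / y0) `^ theta
         = (C1 * A * ((1 - s * x) / y0) `^ theta) * B by rewrite /D; ring.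
      apply: ler_pM => //; [by rewrite mulr_ge0 ?jweight_ge0 | exact: omega0 |].
      apply: le_trans hd _; rewrite ler_wpM2l ?mulr_ge0 ?(ltW C10) //.
      rewrite /theta powRrM ge0_ler_powR ?nnegrE ?powR_ge0 ?(ltW eta0) //.
      by rewrite mulr_ge0 ?jweight_ge0 //; lra.
    have hX := far_tail_decay hs ht A0 (ltW B0) (mphi F mF) (hphi F A hF) hB h0 pE y01 th0 D0 hD.
    have AD0 : 0 <= 2 * A * D by apply: mulr_ge0 => //; exact: mulr_ge0.
    have AB0 : 0 <= 2 * A * B by apply: mulr_ge0 (ltW B0); exact: mulr_ge0.
    have ly : ln (6 / y0) = ln 6 + ln V / al + K%:R / al * ln M%:R.
      rewrite ln_div ?posrE // /y0 ln_powR lnM ?posrE //; last exact: lt_le_trans m1.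
      rewrite /m lnXn ?ltr0n; last exact: ltnW.
      by rewrite -mulr_natl; ring.
    have ly0 : 0 <= ln (6 / y0).
      by case/andP: y01 => _ h1; rewrite ln_ge0 // ler_pdivlMr // mul1r (le_trans h1) // ler1n.
    eexists; split; last 2 first.
    + exact: hX.
    + have uB : u2 a b t <= B.
        by have := hu2 t ht; rewrite pE powRr0 mulr1.
      have i1 := ln_nat_ge M2 G0.
      apply: (@le_trans _ _ ((2 * A * D * (2 `^ theta / theta) + 2 * A * B * ln (6 / y0)) * B)).
        apply: ler_wpM2l => //; apply: addr_ge0; apply: mulr_ge0 => //.
        * by rewrite divr_ge0 ?powR_ge0 // ltW.
      have -> : (2 * A * D * (2 `^ theta / theta) + 2 * A * B * ln (6 / y0)) * B
        = A * G + A * (2 * (B * B) * (K%:R / al) * ln M%:R).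
        by rewrite ly /G; ring.
      have -> : (G / ln 2 + 2 * (B * B) * (K%:R / al)) * A * ln M%:R
        = A * (G / ln 2 * ln M%:R) + A * (2 * (B * B) * (K%:R / al) * ln M%:R) by ring.
      by rewrite lerD2r ler_wpM2l.
    + apply: addr_ge0; apply: mulr_ge0 => //.
      * by rewrite divr_ge0 ?powR_ge0 // ltW.
  - have pE : p = - al by rewrite /p /npart max_r //; lra.
    have pp : 0 < p by lra.
    have c0 : 0 <= 2 * (B * B) / p by rewrite divr_ge0 ?mulr_ge0 // ltW.
    exists (2 * (B * B) / p / ln 2); first by rewrite divr_ge0 // ltW.
    move=> F A M t h ht M2 A0 mF hF hdec h0.
    have tau0 : 0 < 1 - s * t by case/andP: ht => _ h1; rewrite subr_gt0.
    have hX := far_tail_neg hs ht A0 (ltW B0) (mphi F mF) (hphi F A hF) hB h0 pp.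
    eexists; split; last 2 first.
    + exact: hX.
    + have i1 := ln_nat_ge M2 c0.
      have tpp : (1 - s * t) `^ (- p) * (1 - s * t) `^ p = 1.
        by rewrite powRN mulVf // gt_eqF ?powR_gt0.
      apply: (@le_trans _ _ (2 * A * B * ((1 - s * t) `^ (- p) / p) * (B * (1 - s * t) `^ p))).
        apply: ler_wpM2l; last exact: hu2.
        by rewrite mulr_ge0 ?divr_ge0 ?powR_ge0 // !mulr_ge0 // ltW.
      have -> : 2 * A * B * ((1 - s * t) `^ (- p) / p) * (B * (1 - s * t) `^ p)
        = A * (2 * (B * B) / p) * ((1 - s * t) `^ (- p) * (1 - s * t) `^ p) by ring.
      rewrite tpp mulr1.
      have -> : 2 * (B * B) / p / ln 2 * A * ln M%:R
        = A * (2 * (B * B) / p / ln 2 * ln M%:R) by ring.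
      by rewrite ler_wpM2l.
    + by rewrite mulr_ge0 ?divr_ge0 ?powR_ge0 // !mulr_ge0 // ltW.
  - have pE : p = 0 by rewrite /p al0 /npart oppr0 maxxx.
    have c0 : 0 <= 4 * (B * B) by rewrite mulr_ge0.
    exists (4 * (B * B) / ln 2); first by rewrite divr_ge0 // ltW.
    move=> F A M t h ht M2 A0 mF hF hdec h0.
    have tau0 : 0 < 1 - s * t by case/andP: ht => _ h1; rewrite subr_gt0.
    have hX := far_tail_log hs ht A0 (ltW B0) (mphi F mF) (hphi F A hF) hB h0 pE.
    set tau := 1 - s * t in tau0 hX *.
    have tau1 : tau <= 1 by case/andP: ht => h1 _; rewrite gerBl.
    (* Brought to the form of the denominator of u2, which cancels it. *)
    have ly : ln (3 / tau) <= 2 * (1 + `|ln tau|).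
      rewrite ln_div ?posrE //.
      have h3 : ln 3 <= 2 :> R.
        have := @le_ln1Dx R 2; rewrite (_ : 1 + 2 = 3); last ring.
        by apply; exact: lt_trans (ltrN10 _) _.
      by have := ler_norm (- ln tau); rewrite normrN; have := normr_ge0 (ln tau); lra.
    have ly0 : 0 <= ln (3 / tau).
      by rewrite ln_ge0 // ler_pdivlMr // mul1r (le_trans tau1) // ler1n.
    eexists; split; last 2 first.
    + exact: hX.
    + have i1 := ln_nat_ge M2 c0.
      have [_ _ hh] := u1_side hs (t1 t ht).
      have st0 : 0 <= s * t by case/andP: ht.
      have := (hh st0).2 al0; rewrite -/be -/B -/tau => hu.
      have d0 : 0 < 1 + `|ln tau| by rewrite ltr_wpDr.
      apply: (@le_trans _ _ (2 * A * B * (2 * (1 + `|ln tau|)) * (B / (1 + `|ln tau|)))).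
        apply: ler_pM => //; [by rewrite !mulr_ge0 ?(ltW B0) | exact: u2_ge0 |].
        by rewrite ler_wpM2l // !mulr_ge0 ?(ltW B0).
      have -> : 2 * A * B * (2 * (1 + `|ln tau|)) * (B / (1 + `|ln tau|)) = A * (4 * (B * B)).
        by field; rewrite gt_eqF.
      have -> : 4 * (B * B) / ln 2 * A * ln M%:R = A * (4 * (B * B) / ln 2 * ln M%:R) by ring.
      by rewrite ler_wpM2l.
    + by rewrite !mulr_ge0 ?(ltW B0).
(* The first summand collects the terms without logarithm, the second the ln (tau / h) pieces, C3
   the tail; the 1 ensures positivity. *)
pose C := (2 * W * B + B * B * (2 / (1 - p))) / ln 2 + 4 * (B * B) * (1 + K%:R) + C3 + 1.
have p1 : 0 < 1 - p by lra.
have c1 : 0 <= 2 * W * B + B * B * (2 / (1 - p)).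
  apply: addr_ge0; first by rewrite !mulr_ge0 ?(ltW B0).
  by apply: mulr_ge0; [rewrite mulr_ge0 ?(ltW B0) | rewrite divr_ge0 ?(ltW p1)].
have c2 : 0 <= 4 * (B * B) * (1 + K%:R) by rewrite !mulr_ge0 ?addr_ge0 ?(ltW B0).
exists C; first by rewrite ltr_wpDl // !addr_ge0 // divr_ge0 // ltW.
move=> F A M t ht M2 A0 mF hF hdec.
have m1 : 1 <= M%:R ^+ K :> R by rewrite exprn_ege1 // ler1n; exact: ltnW.
set m := M%:R ^+ K in m1 *.
pose tau := 1 - s * t; pose h := tau / (2 * m).
have tau0 : 0 < tau by case/andP: ht => _ h1; rewrite subr_gt0.
have tau1 : tau <= 1 by case/andP: ht => h0 _; rewrite gerBl.
have m20 : 0 < 2 * m by rewrite mulr_gt0 // (lt_le_trans _ m1).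
have h0 : 0 < h <= (1 - s * t) / 2.
  by rewrite divr_gt0 //= -/tau ler_wpM2l ?(ltW tau0) // lef_pV2 ?posrE // ler_peMr.
have [X3 [X30 hX3 uX3]] := tail F A M t h ht M2 A0 mF hF hdec h0.
have hphi x : -1 < x < 1 -> `|F x * jweight a b x| <= A * omega x.
  by move=> hx; rewrite phiE // ler_wpM2r ?omega0 // hF.
have := far_split hs ht p01 A0 (ltW B0) (mphi F mF) momega omega0 hW hphi hB h0 hX3.
rewrite -/tau => hX.
have T0 : 0 <= A * B * tau `^ (- p) by rewrite !mulr_ge0 ?powR_ge0 ?(ltW B0).
have lM0 : 0 <= ln M%:R :> R by rewrite ln_ge0 // ler1n; exact: ltnW.
have hln : ln (tau / h) <= (1 + K%:R) * ln M%:R.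
  have -> : tau / h = 2 * m by rewrite /h invf_div mulrCA mulfV ?mulr1 // gt_eqF.
  rewrite lnM ?posrE //; last exact: lt_le_trans m1.
  rewrite /m lnXn ?ltr0n; last exact: ltnW.
  by rewrite mulrDl mul1r mulr_natl lerD2r ler_ln ?posrE ?ltr0n ?ler_nat //; exact: ltnW.
have hln0 : 0 <= ln (tau / h).
  case/andP: h0 => hp0 hle; rewrite ln_ge0 // ler_pdivlMr // mul1r (le_trans hle) //.
  by rewrite -/tau ler_piMr ?(ltW tau0) // invf_le1 // ler1n.
have G0 : 0 <= 2 / (1 - p) + 4 * ln (tau / h).
  by rewrite addr_ge0 ?mulr_ge0 // invr_ge0 ltW.
eexists; split; last 2 first.
- exact: hX.
- have u0 := u2_ge0 a b t; have hu := hu2 t ht; rewrite -/tau in hu.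
  have tp1 : tau `^ p <= 1.
    apply: (@le_trans _ _ (1 `^ p)); last by rewrite powR1.
    by case/andP: p01 => p0 _; rewrite ge0_ler_powR ?nnegrE ?(ltW tau0).
  have uB : u2 a b t <= B.
    by apply: le_trans hu _; rewrite ler_piMr // ltW.
  have tpp : tau `^ (- p) * tau `^ p = 1.
    by rewrite powRN mulVf // gt_eqF ?powR_gt0.
  have uT : A * B * tau `^ (- p) * u2 a b t <= A * (B * B).
    apply: (@le_trans _ _ (A * B * tau `^ (- p) * (B * tau `^ p))); first by rewrite ler_wpM2l.
    have -> : A * B * tau `^ (- p) * (B * tau `^ p)
      = A * (B * B) * (tau `^ (- p) * tau `^ p) by ring.
    by rewrite tpp mulr1.
  rewrite mulrDl mulrDl.
  have i1 : 2 * A * W * u2 a b t <= A * (2 * W * B).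
    have -> : A * (2 * W * B) = 2 * A * W * B by ring.
    by rewrite ler_wpM2l // !mulr_ge0.
  have i2 : A * B * tau `^ (- p) * (2 / (1 - p) + 4 * ln (tau / h)) * u2 a b t
     <= A * (B * B) * (2 / (1 - p) + 4 * ((1 + K%:R) * ln M%:R)).
    rewrite mulrAC; apply: ler_pM => //; first by rewrite mulr_ge0.
    by rewrite lerD2l ler_wpM2l.
  have i3 := ln_nat_ge M2 c1.
  have i4 : A * (2 * W * B + B * B * (2 / (1 - p)))
     <= A * ((2 * W * B + B * B * (2 / (1 - p))) / ln 2 * ln M%:R) by rewrite ler_wpM2l.
  have i5 : 0 <= A * ln M%:R by rewrite mulr_ge0.
  rewrite /C; set c := (2 * W * B + B * B * (2 / (1 - p))) / ln 2 in i4 *.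
  have -> : (c + 4 * (B * B) * (1 + K%:R) + C3 + 1) * A * ln M%:R
    = A * (c * ln M%:R) + A * (B * B) * (4 * ((1 + K%:R) * ln M%:R))
      + C3 * A * ln M%:R + A * ln M%:R by ring.
  have e5 : A * (2 * W * B + B * B * (2 / (1 - p))) =
    A * (2 * W * B) + A * (B * B) * (2 / (1 - p)) by ring.
  rewrite e5 in i4; rewrite [leRHS]mulrDr in i2.
  apply: le_trans (lerD (lerD i1 i2) uX3) _.
  apply: le_trans (_ : _ <= A * (c * ln M%:R) + A * (B * B) * (4 * ((1 + K%:R) * ln M%:R))
      + C3 * A * ln M%:R) _; last by rewrite lerDl.
  by rewrite lerD2r addrA lerD2r.
- by rewrite !addr_ge0 ?mulr_ge0 ?powR_ge0 ?(ltW B0) ?divr_ge0 ?(ltW p1).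
Qed.

End HilbertBound.

(** * Principal value of an approximable function *)

Section HilbertCore.
Context {R : realType}.
Notation mu := (@lebesgue_measure R).
Notation I11 := (`]-1, 1[%classic : set R).
Variables (a b r : R).

Lemma integrable_weighted (F : R -> R) (A : R) : -1 < a -> -1 < b ->
  measurable_fun I11 F -> (forall x, -1 < x < 1 -> `|F x| * u1 a b x <= A) ->
  mu.-integrable I11 (EFin \o (fun x => F x * jweight a b x)).
Proof.
move=> ha hb mF hA; have mI : measurable I11 by exact: measurable_itv.
have na1 : -1 < - npart a by rewrite ltrN2 npart_lt1.
have nb1 : -1 < - npart b by rewrite ltrN2 npart_lt1.
have A0 : 0 <= A.
  apply: le_trans (hA 0 _); last lra.
  by apply: mulr_ge0 => //; exact: jweight_ge0.
apply: (@le_integrable _ _ _ mu I11 mI _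
   (fun x => (A%:E * (jweight (- npart a) (- npart b) x)%:E)%E)).
- by apply/measurable_EFinP; apply: measurable_funM => //; exact: measurable_jweight.
- move=> x; rewrite /= in_itv /= => hx; rewrite lee_fin jweight_split //.
  have v0 : 0 <= jweight (- npart a) (- npart b) x by exact: jweight_ge0.
  have v1 : 0 <= u1 a b x by exact: jweight_ge0.
  rewrite (normrM (F x)) (ger0_norm (mulr_ge0 v1 v0)) (ger0_norm (mulr_ge0 A0 v0)) mulrA.
  by rewrite ler_wpM2r // hA.
- by apply: integrableZl => //; exact: integrable_jweight.
Qed.

Hypotheses (ha : -1 < a) (hb : -1 < b) (hr : 0 < r).

(** The increment of F u is (F x - F t) u(x) + F t (u(x) - u(t)). [approximable_hoelder] bounds the
    first term and the relative Lipschitz bound the second; in each, a factor u1(t) is used up and 1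
    / u_-(t) remains. *)
Lemma weighted_hoelder : exists C K eta, [/\ 0 < C, 0 < eta <= 1,
  (forall F A M x t, (0 < M)%N -> 0 <= A ->
    approximable (ppart a) (ppart b) r F A M -> -1 < t < 1 ->
    `|x - t| <= (1 - `|t|) / (2 * M%:R ^+ K) ->
    `|F x * jweight a b x - F t * jweight a b t| <=
      C * A * jweight (- npart a) (- npart b) t
        * ((M%:R ^+ K) `^ eta + (1 - `|t|)^-1 `^ eta) * `|x - t| `^ eta) &
  forall F A M x, (0 < M)%N -> 0 <= A ->
    approximable (ppart a) (ppart b) r F A M -> -1 < x < 1 ->
    u1 a b x * M%:R ^+ K <= 1 ->
    `|F x| * u1 a b x <= C * A * (u1 a b x * M%:R ^+ K) `^ eta].
Proof.
have [C [K [eta [C0 heta hH]]]] := approximable_hoelder (ppart_ge0 a) (ppart_ge0 b) hr.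
have [L L0 hL] := jweight_local_lipschitz a b.
pose V : R := 2 `^ (`|a| + `|b|).
have V0 : 0 < V by rewrite powR_gt0.
have eta0 : 0 < eta by case/andP: heta.
have eta1 : eta <= 1 by case/andP: heta.
have VC0 : 0 < V * C by rewrite mulr_gt0.
exists (V * C + L + C), K, eta; split=> //.
- by rewrite !addr_gt0.
- move=> F A M x t M0 A0 hF ht hx.
  have m1 : 1 <= M%:R ^+ K :> R by rewrite exprn_ege1 // ler1n.
  set m := M%:R ^+ K in m1 hx *.
  set tau := 1 - `|t| in hx *.
  have tau0 : 0 < tau by rewrite subr_gt0 ltr_norml.
  set w := jweight (- npart a) (- npart b) t.
  have w0 : 0 <= w by exact: jweight_ge0.
  have [->|xt] := eqVneq x t.
    rewrite subrr normr0 !mulr_ge0 ?addr_ge0 ?powR_ge0 //; exact: ltW.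
  set z := `|x - t| in hx *.
  have z0 : 0 < z by rewrite normr_gt0 subr_eq0.
  have m0 : 0 < m by exact: lt_le_trans m1.
  have hx2 : z <= tau / 2.
    apply: le_trans hx _; rewrite ler_wpM2l ?(ltW tau0) // lef_pV2 ?posrE ?mulr_gt0 //.
    by rewrite ler_peMr.
  have zm : z * m <= 1.
    have h1 : z * m <= tau / 2.
      have -> : tau / 2 = tau / (2 * m) * m by field; rewrite gt_eqF.
      by rewrite ler_wpM2r // ltW.
    apply: le_trans h1 _; rewrite ler_pdivrMr // mul1r /tau.
    by have := normr_ge0 t; lra.
  have hx11 : -1 < x < 1.
    move: hx2; rewrite /z /tau ler_norml; have := ler_norm t; have := ler_norm (- t).
    by rewrite normrN; move: ht; lra.
  have [lF _] := hH F A M M0 A0 hF.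
  have [_ lg] := jweight_local_le (ppart a) (ppart b) ht hx2.
  rewrite (ger0_norm (ppart_ge0 a)) (ger0_norm (ppart_ge0 b)) in lg.
  have {lF} := lF x t hx11 ht lg zm; rewrite -/z -/m => lF.
  have [lu _] := jweight_local_le a b ht hx2; rewrite -/V in lu.
  have {hL} := hL x t ht hx2; rewrite -/z -/tau => lL.
  have uE : jweight a b t = u1 a b t * w by rewrite jweight_split.
  have u10 : 0 <= u1 a b t by exact: jweight_ge0.
  have hFt : `|F t| * u1 a b t <= A by exact: hF.1.
  (* The Lipschitz term is weakened to the exponent eta; this is where eta <= 1 matters. *)
  have zt : z / tau <= (z / tau) `^ eta.
    apply: ger1_powR => //; rewrite divr_gt0 //= ler_pdivrMr // mul1r.
    by apply: le_trans hx2 _; rewrite ler_pdivrMr // ler_peMr ?(ltW tau0) // ler1n.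
  rewrite powRM ?(ltW z0) ?invr_ge0 ?(ltW tau0) // in zt.
  rewrite powRM ?(ltW z0) ?(ltW m0) // in lF.
  have -> : F x * jweight a b x - F t * jweight a b t
    = (F x - F t) * jweight a b x + F t * (jweight a b x - jweight a b t) by ring.
  apply: le_trans (ler_normD _ _) _.
  rewrite (normrM (F x - F t)) (normrM (F t)) (ger0_norm (jweight_ge0 a b x)).
  have i1 : `|F x - F t| * jweight a b x <= V * C * A * w * (m `^ eta * z `^ eta).
    apply: (@le_trans _ _ (`|F x - F t| * (V * jweight a b t))); first by rewrite ler_wpM2l.
    have -> : `|F x - F t| * (V * jweight a b t) = V * w * (`|F x - F t| * u1 a b t).
      by rewrite uE; ring.
    have -> : V * C * A * w * (m `^ eta * z `^ eta)
      = V * w * (C * A * (z `^ eta * m `^ eta)) by ring.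
    by rewrite ler_wpM2l // mulr_ge0 // ltW.
  have i2 : `|F t| * `|jweight a b x - jweight a b t|
      <= L * A * w * (tau^-1 `^ eta * z `^ eta).
    apply: (@le_trans _ _ (`|F t| * (L * jweight a b t * (z / tau)))); first by rewrite ler_wpM2l.
    have -> : `|F t| * (L * jweight a b t * (z / tau))
        = L * w * (`|F t| * u1 a b t) * (z / tau) by rewrite uE; ring.
    have -> : L * A * w * (tau^-1 `^ eta * z `^ eta)
        = L * w * A * (z `^ eta * tau^-1 `^ eta) by ring.
    have Lw : 0 <= L * w by rewrite mulr_ge0 // ltW.
    apply: ler_pM => //; last by rewrite ler_wpM2l.
      by apply: mulr_ge0 => //; rewrite mulr_ge0.
    by rewrite divr_ge0 ?(ltW z0) ?(ltW tau0).
  apply: le_trans (lerD i1 i2) _.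
  set P1 := m `^ eta; set P2 := tau^-1 `^ eta; set Z := z `^ eta.
  have P10 : 0 <= P1 by exact: powR_ge0.
  have P20 : 0 <= P2 by exact: powR_ge0.
  have Z0 : 0 <= Z by exact: powR_ge0.
  have AwZ : 0 <= A * w * Z by apply: mulr_ge0 => //; exact: mulr_ge0.
  rewrite -subr_ge0.
  have -> : (V * C + L + C) * A * w * (P1 + P2) * Z
     - (V * C * A * w * (P1 * Z) + L * A * w * (P2 * Z))
    = (V * C * P2 + L * P1 + C * (P1 + P2)) * (A * w * Z) by ring.
  by rewrite mulr_ge0 // !addr_ge0 // mulr_ge0 ?addr_ge0 // ltW.
- move=> F A M x M0 A0 hF hx hz.
  have [_ h] := hH F A M M0 A0 hF.
  apply: le_trans (h x hx hz) _.
  rewrite ler_wpM2r ?powR_ge0 // ler_wpM2r // lerDr.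
  by rewrite addr_ge0 // ltW.
Qed.

(** [principal_value] with h = (1 - |t|) / (2 M^K) leaves a far integral, handled by [far_bound] at
    the endpoint nearest to t, and a Hoelder term of size O(A / u_-(t)), for which u2 <= u_-
    suffices. *)
Lemma hilbert_bound : exists2 C, 0 < C &
  forall (F : R -> R) (A : R) (M : nat) (t : R), (2 <= M)%N -> 0 <= A ->
  (forall x : R, -1 < x < 1 -> {for x, continuous F}) ->
  approximable (ppart a) (ppart b) r F A M -> -1 < t < 1 ->
  exists2 L, truncated (fun x => F x * jweight a b x) t e @[e --> 0^'+] --> L &
    `|L| * u2 a b t <= C * A * ln M%:R.
Proof.
have [C1 [K [eta [C10 heta hH hD]]]] := weighted_hoelder.
have eta0 : 0 < eta by case/andP: heta.
have [Cr Cr0 hCr] := far_bound ha hb K (or_introl (erefl (1 : R))) C10 eta0.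
have [Cl Cl0 hCl] := far_bound ha hb K (or_intror (erefl (-1 : R))) C10 eta0.
have l2 : 0 < ln 2 :> R by rewrite ln_gt0 ?ltr1n.
have c0 : 0 <= C1 * 4 / eta by rewrite divr_ge0 ?mulr_ge0 // ltW.
exists (Cr + Cl + C1 * 4 / eta / ln 2).
  by rewrite ltr_wpDr ?addr_gt0 // divr_ge0 // ltW.
move=> F A M t M2 A0 cF hF ht.
have M0 : (0 < M)%N by exact: ltnW.
have mF : measurable_fun I11 F.
  apply: open_continuous_measurable_fun; first exact: itv_open.
  by move=> x; rewrite inE /= in_itv /=; exact: cF.
have hA : forall x, -1 < x < 1 -> `|F x| * u1 a b x <= A by exact: hF.1.
have m1 : 1 <= M%:R ^+ K :> R by rewrite exprn_ege1 // ler1n.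
set m := M%:R ^+ K in m1 *.
have m0 : 0 < m by exact: lt_le_trans m1.
pose tau := 1 - `|t|; pose h := tau / (2 * m).
have tau0 : 0 < tau by rewrite subr_gt0 ltr_norml.
have tau1 : tau <= 1 by rewrite gerBl.
have h0 : 0 < h by rewrite divr_gt0 ?mulr_gt0.
have htau : h < tau.
  rewrite ltr_pdivrMr ?mulr_gt0 // ltr_pMr //.
  by apply: (@lt_le_trans _ _ (1 * 2)); rewrite ?mul1r ?ltr1n // ler_peMr.
have [th1 th2] : -1 < t - h /\ t + h < 1.
  move: htau; rewrite /tau; have := ler_norm t; have := ler_norm (- t).
  by rewrite normrN; split; lra.
have lM0 : 0 <= ln M%:R :> R by rewrite ln_ge0 // ler1n.
pose phi x := F x * jweight a b x.
have iphi : mu.-integrable I11 (EFin \o phi) by exact: integrable_weighted hA.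
have [X [X0 hX uX]] : exists X : R, [/\ 0 <= X,
    (\int[mu]_(x in (I11 `&` [set x | (h < `|x - t|)%R])) `|phi x / (x - t)|%:E <= X%:E)%E &
    X * u2 a b t <= (Cr + Cl) * A * ln M%:R].
  have AM0 : 0 <= A * ln M%:R by rewrite mulr_ge0.
  have [t0|t0] := leP 0 t.
    have ht' : 0 <= 1 * t < 1 by rewrite mul1r t0; case/andP: ht.
    have [X [X0 hX uX]] := hCr F A M t ht' M2 A0 mF hA (fun x => hD F A M x M0 A0 hF).
    exists X; split=> //; first by move: hX; rewrite mul1r -[X in 1 - X]ger0_norm.
    by apply: le_trans uX _; rewrite -!mulrA ler_wpM2r // lerDl ltW.
  have ht' : 0 <= -1 * t < 1.
    by rewrite mulN1r oppr_ge0 (ltW t0) /= ltrNl; case/andP: ht.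
  have [X [X0 hX uX]] := hCl F A M t ht' M2 A0 mF hA (fun x => hD F A M x M0 A0 hF).
  exists X; split=> //; first by move: hX; rewrite mulN1r -[X in 1 - X]ltr0_norm.
  by apply: le_trans uX _; rewrite -!mulrA ler_wpM2r // lerDr ltW.
set w := jweight (- npart a) (- npart b) t in hH.
have w0 : 0 <= w by exact: jweight_ge0.
pose A1 := C1 * A * w * (m `^ eta + tau^-1 `^ eta).
have A10 : 0 <= A1 by rewrite !mulr_ge0 ?addr_ge0 ?powR_ge0 // ltW.
have hphi x : `|x - t| <= h -> `|phi x - phi t| <= A1 * `|x - t| `^ eta.
  by move=> hx; exact: (hH F A M x t M0 A0 hF ht hx).
have [L cL bL] := principal_value th1 th2 h0 eta0 A10 iphi hphi.
exists L => //.
have u20 := u2_ge0 a b t.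
have hR : \int[mu]_(x in I11 `&` [set x | h < `|x - t|]) `|phi x / (x - t)| <= X.
  have I0 : (0 <= \int[mu]_(x in (I11 `&` [set x | (h < `|x - t|)%R]))
      `|phi x / (x - t)|%:E)%E by apply: integral_ge0 => x _; rewrite lee_fin.
  rewrite -lee_fin /Rintegral fineK // ge0_fin_numE //.
  exact: le_lt_trans hX (ltry X).
(* Since 2 h = tau / m, multiplying m^eta + tau^(-eta) by (2 h)^eta gives tau^eta + m^(-eta) <= 2: h
   is chosen to neutralise both terms at once. *)
have hA1 : A1 * ((2 * h) `^ eta / eta) * 2 <= C1 * 4 / eta * A * w.
  have e1 : 2 * h = tau * m^-1 by rewrite /h; field; rewrite gt_eqF.
  have e2 : (m `^ eta + tau^-1 `^ eta) * (2 * h) `^ eta = tau `^ eta + m^-1 `^ eta.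
    have hh : 0 <= 2 * h by apply: mulr_ge0 => //; exact: ltW.
    rewrite mulrDl -!powRM ?hh ?invr_ge0 ?(ltW m0) ?(ltW tau0) //.
    congr (_ `^ _ + _ `^ _); rewrite e1; field; rewrite gt_eqF //.
    by rewrite gt_eqF.
  have e3 : tau `^ eta + m^-1 `^ eta <= 2.
    have le1 y : 0 <= y -> y <= 1 -> y `^ eta <= 1.
      move=> y0 y1; apply: (@le_trans _ _ (1 `^ eta)); last by rewrite powR1.
      by rewrite ge0_ler_powR ?nnegrE ?(ltW eta0).
    apply: (@le_trans _ _ (1 + 1)); last by rewrite le_eqVlt; apply/orP; left; apply/eqP; ring.
    by apply: lerD; apply: le1; rewrite ?(ltW tau0) ?invr_ge0 ?(ltW m0) ?invf_le1.
  rewrite [leLHS](_ : _ = C1 * A * w / eta * 2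
      * ((m `^ eta + tau^-1 `^ eta) * (2 * h) `^ eta)); last by rewrite /A1; ring.
  rewrite e2 [leRHS](_ : _ = C1 * A * w / eta * 2 * 2); last by ring.
  rewrite ler_wpM2l //; apply: mulr_ge0 => //; apply: divr_ge0; last exact: ltW.
  by apply: mulr_ge0 => //; apply: mulr_ge0 => //; exact: ltW.
have bL2 : `|L| <= X + C1 * 4 / eta * A * w by apply: le_trans bL _; exact: lerD.
apply: (le_trans (ler_wpM2r u20 bL2)); rewrite mulrDl.
have i2 : C1 * 4 / eta * A * w * u2 a b t <= C1 * 4 / eta / ln 2 * ln M%:R * A.
  have h1 : w * u2 a b t <= 1.
    by rewrite -(uminusV a b ht) mulrC ler_wpM2r // u2_le_uminus.
  apply: (@le_trans _ _ (C1 * 4 / eta * A * 1)).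
    by rewrite -mulrA ler_wpM2l // mulr_ge0.
  by rewrite mulr1 ler_wpM2r // ln_nat_ge.
have -> : (Cr + Cl + C1 * 4 / eta / ln 2) * A * ln M%:R
  = (Cr + Cl) * A * ln M%:R + C1 * 4 / eta / ln 2 * ln M%:R * A by ring.
exact: lerD.
Qed.

End HilbertCore.

(** * Approximation of the error f - V f *)

Section VPApproximation.
Context {R : realType}.
Variables (alpha beta c1 c2 : R) (p : nat -> {poly R}) (g d r : R).
Hypotheses (halpha : -1 < alpha) (hbeta : -1 < beta) (hc1 : 1 < c1)
  (hp : orthonormal_jacobi alpha beta p) (hg : 0 <= g) (hd : 0 <= d) (hr : 0 < r).
Hypothesis hV : exists C : R, forall (n m : nat) (f : R -> R),
  comparable_indices c1 c2 n m -> C0 g d f ->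
  wnorm g d (VP p n m f) <= C * wnorm g d f.

(** The condition c1 > 1 keeps n - m, the degree up to which V reproduces polynomials, a fixed
    proportion of n. *)
Lemma comparable_gap n m : comparable_indices c1 c2 n m ->
  [/\ (0 < m)%N, (m < n)%N & (1 - c1^-1) * n%:R <= (n - m)%:R].
Proof.
case=> m0 /andP[h1 _]; have c10 : 0 < c1 by have := hc1; lra.
have m0R : 0 < m%:R :> R by rewrite ltr0n.
have mn : (m < n)%N.
  by rewrite -(ltr_nat R); apply: lt_le_trans h1; rewrite ltr_pMl.
split=> //; rewrite natrB ?(ltnW mn) // mulrBl mul1r lerD2l lerN2.
by rewrite ler_pdivlMl.
Qed.

(** S lies strictly above the sum because the infimum defining the best approximation is not known
    to be attained. *)
Lemma besov_approx (f : R -> R) (S : R) n : besov r g d f ->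
  fine (besov_sum g d r f) < S -> (0 < n)%N ->
  exists2 q : {poly R}, (size q <= n.+1)%N & forall x, -1 < x < 1 ->
    `|f x - q.[x]| * jweight g d x <= 2 `^ (1 + `|r - 1|) * S / n%:R `^ r.
Proof.
move=> hf hS n0; have nr0 : 0 < n%:R `^ r :> R by apply: powR_gt0; rewrite ltr0n.
apply: (best_approx_lt hg hd hf.1).
rewrite ltr_pdivlMr //; apply: le_lt_trans (besov_decay hg hd hf n0) _.
by rewrite ltr_pM2l // powR_gt0.
Qed.

(** With q of degree n - m close to f and G = f - q, reproduction gives F = G - V G. For N >= 2n,
    subtracting V f from an approximant of f does not raise its degree above N, so F inherits the
    rate of f. *)
Lemma VP_error_approximable : exists2 C, 0 < C & forall n m (f : R -> R) S,
  comparable_indices c1 c2 n m -> besov r g d f ->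
  fine (besov_sum g d r f) < S -> 0 <= S ->
  approximable g d r (fun x => f x - VP p n m f x) (C * S / n%:R `^ r) (2 * n).
Proof.
have [C hC] := hV.
pose ka := 1 - c1^-1.
have ka0 : 0 < ka by rewrite subr_gt0 invf_lt1 //; have := hc1; lra.
pose D : R := 2 `^ (1 + `|r - 1|).
have D0 : 0 < D by rewrite powR_gt0.
pose k := ka `^ r; have k0 : 0 < k by rewrite powR_gt0.
have C1 : 0 < 1 + (1 + `|C|) by rewrite !ltr_pwDl.
(* The first factor accounts for G and V G, with 1 + |C| in place of C whose sign is unknown; D
   comes from [besov_decay], and k^-1 from passing from n - m to n. *)
exists ((1 + (1 + `|C|)) * D * (1 + k^-1)).
  by rewrite !mulr_gt0 // ltr_pwDl // invr_ge0 ltW.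
move=> n m f S hnm hf hS S0.
have [m0 mn gap] := comparable_gap hnm.
have n0 : (0 < n)%N by exact: leq_ltn_trans mn.
have nr0 : 0 < n%:R `^ r :> R by apply: powR_gt0; rewrite ltr0n.
have DS0 : 0 <= D * S / n%:R `^ r by apply: divr_ge0 (ltW nr0); apply: mulr_ge0 => //; exact: ltW.
split.
- move=> x hx; have g0 : (0 < n - m)%N by rewrite subn_gt0.
  have [q sq hq] := besov_approx hf hS g0.
  have gr0 : 0 < (n - m)%:R `^ r :> R by apply: powR_gt0; rewrite ltr0n.
  set del := _ / _ `^ r in hq.
  have del0 : 0 <= del by apply: divr_ge0 (ltW gr0); apply: mulr_ge0 => //; exact: ltW.
  have hdel : del <= k^-1 * (D * S / n%:R `^ r).
    rewrite /del -/D.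
    have -> : k^-1 * (D * S / n%:R `^ r) = D * S / (k * n%:R `^ r).
      by rewrite invfM; ring.
    apply: ler_wpM2l; first by apply: mulr_ge0 => //; exact: ltW.
    rewrite lef_pV2 ?posrE ?mulr_gt0 // /k -powRM ?(ltW ka0) //.
    by rewrite ge0_ler_powR ?nnegrE ?(ltW hr) // mulr_ge0 // ltW.
  pose G y := f y - q.[y].
  have cG : C0 g d G by exact: C0B_poly hf.1.
  have wG : wnorm g d G <= del by exact: wnorm_le.
  have wG0 : 0 <= wnorm g d G by exact: wnorm_ge0.
  have VPG y : VP p n m G y = VP p n m f y - q.[y].
    by rewrite (VPB halpha hbeta hp) (VP_reproduce halpha hbeta hp) // ltnW.
  have [Q _ hQ] := VP_poly halpha hbeta hp n m G.
  have cVG : C0 g d (VP p n m G) by rewrite hQ; exact: C0_poly.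
  have hVG : `|VP p n m G x| * jweight g d x <= (1 + `|C|) * del.
    apply: le_trans (wnorm_ub hg hd cVG hx) _; apply: le_trans (hC n m G hnm cG) _.
    apply: (@le_trans _ _ ((1 + `|C|) * wnorm g d G)).
      by rewrite ler_wpM2r // ler_wpDl // ler_norm.
    by rewrite ler_wpM2l // addr_ge0.
  have -> : f x - VP p n m f x = G x - VP p n m G x by rewrite VPG /G; ring.
  apply: (@le_trans _ _ ((`|G x| + `|VP p n m G x|) * jweight g d x)).
    by rewrite ler_wpM2r ?jweight_ge0 // ler_normB.
  rewrite mulrDl; apply: le_trans (lerD (hq x hx) hVG) _.
  rewrite [leLHS](_ : _ = (1 + (1 + `|C|)) * del); last by rewrite /del; ring.
  rewrite -!mulrA ler_wpM2l ?(ltW C1) // mulrCA.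
  apply: le_trans hdel _.
  rewrite [leRHS](_ : _ = (1 + k^-1) * (D * S / n%:R `^ r)); last by ring.
  by rewrite ler_wpM2r // lerDr.
- move=> N MN; have N0 : (0 < N)%N by apply: leq_trans MN; rewrite muln_gt0.
  have [q sq hq] := besov_approx hf hS N0.
  have [Q sQ hQ] := VP_poly halpha hbeta hp n m f.
  exists (q - Q).
    apply: leq_trans (size_polyD _ _) _; rewrite geq_max sq size_polyN.
    apply: leq_trans sQ _; apply: leq_trans (leqW MN).
    by rewrite mul2n -addnn leq_add2l ltnW.
  move=> x hx; rewrite hQ hornerD hornerN.
  have -> : f x - Q.[x] - (q.[x] - Q.[x]) = f x - q.[x] by ring.
  apply: le_trans (hq x hx) _; rewrite -/D.
  have Nr0 : 0 < N%:R `^ r :> R by apply: powR_gt0; rewrite ltr0n.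
  have e : ((2 * n)%:R / N%:R) `^ r = 2 `^ r * n%:R `^ r / N%:R `^ r :> R.
    by rewrite powRM ?invr_ge0 // natrM powRM // -powR_inv1 // -powRrM mulN1r powRN.
  rewrite e.
  have -> : (1 + (1 + `|C|)) * D * (1 + k^-1) * S / n%:R `^ r
      * (2 `^ r * n%:R `^ r / N%:R `^ r)
    = ((1 + (1 + `|C|)) * (1 + k^-1) * 2 `^ r) * (D * S / N%:R `^ r).
    by field; rewrite !gt_eqF.
  rewrite ler_peMl //; first by apply: divr_ge0 (ltW Nr0); apply: mulr_ge0 => //; exact: ltW.
  have a1 : 1 <= 2 `^ r :> R by rewrite -[leLHS](@powRr0 R 2) ler_powR ?(ltW hr) // ler1n.
  have a2 : 1 <= 1 + k^-1 by rewrite lerDl invr_ge0 ltW.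
  have a3 : 1 <= 1 + (1 + `|C|) by rewrite lerDl addr_ge0.
  rewrite -[leLHS]mulr1; apply: ler_pM => //.
  by rewrite -[leLHS]mulr1; apply: ler_pM.
Qed.

End VPApproximation.

(** * From truncated integrals to the Hilbert transforms of f and V f *)

Section TruncatedTransforms.
Context {R : realType}.
Notation mu := (@lebesgue_measure R).
Notation I11 := (`]-1, 1[%classic : set R).
Variables (a b : R).

Lemma measurable_continuous_I11 (f : R -> R) :
  (forall x : R, -1 < x < 1 -> {for x, continuous f}) -> measurable_fun I11 f.
Proof.
move=> cf; apply: open_continuous_measurable_fun; first exact: itv_open.
by move=> x; rewrite inE /= in_itv /=; exact: cf.
Qed.

Lemma truncated_hilbertE (f : R -> R) t e : measurable_fun I11 f ->
  truncated_hilbert a b f t e = truncated (fun x => f x * jweight a b x) t e.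
Proof.
move=> mf; rewrite /truncated_hilbert Rintegral_setI_oo.
- by apply: eq_Rintegral => x _; rewrite mulrAC.
- exact: measurable_dist_le.
apply: (measurable_funS (E := I11)); [exact: measurable_itv | exact: subIsetl |].
apply: measurable_funM; last exact: measurable_jweight.
by apply: measurable_funM => //; exact: measurable_inv_sub.
Qed.

Lemma truncatedD (phi psi : R -> R) t e : 0 < e ->
  mu.-integrable I11 (EFin \o phi) -> mu.-integrable I11 (EFin \o psi) ->
  truncated (fun x => phi x + psi x) t e = truncated phi t e + truncated psi t e.
Proof.
move=> e0 iphi ipsi.
have mE : measurable (I11 `&` [set x | e <= `|x - t|]).
  by apply: measurableI; [exact: measurable_itv | exact: measurable_dist_le].
have h xi : mu.-integrable I11 (EFin \o xi) ->
    mu.-integrable (I11 `&` [set x | e <= `|x - t|]) (EFin \o (fun x => xi x / (x - t))).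
  by apply: (integrable_div_dist e0) => // x [].
rewrite /truncated -RintegralD; [|exact: mE|exact: h|exact: h].
by apply: eq_Rintegral => x _; rewrite mulrDl.
Qed.

(** Makes [hilbert_bound] applicable to V f itself, for the existence of its principal value. The
    shift by 2 guarantees M >= 2 even for the zero polynomial. *)
Lemma approximable_poly (g d r : R) (q : {poly R}) : 0 <= g -> 0 <= d ->
  approximable g d r (horner q) (wnorm g d (horner q)) (size q).+2.
Proof.
move=> hg hd; have cq := C0_poly hg hd q.
split=> [x hx|N MN]; first exact: wnorm_ub.
exists q; first by apply: leq_trans (leqW MN); rewrite !leqW.
move=> x _; rewrite subrr normr0 mul0r.
by apply: mulr_ge0; [exact: wnorm_ge0 | exact: powR_ge0].
Qed.

End TruncatedTransforms.

Lemma besov_sum_lt_norm (R : realType) (g d r e : R) (f : R -> R) : 0 <= g -> 0 <= d ->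
  C0 g d f -> 0 < e ->
  0 <= besov_norm r g d f /\ fine (besov_sum g d r f) < besov_norm r g d f + e.
Proof.
move=> hg hd hf e0.
have s0 : 0 <= fine (besov_sum g d r f).
  apply: fine_ge0; apply: nneseries_ge0 => k _ _; rewrite lee_fin.
  by rewrite mulr_ge0 ?powR_ge0 //; exact: best_approx_ge0.
have w0 := wnorm_ge0 hg hd hf.
rewrite /besov_norm; split; first exact: addr_ge0.
by rewrite addrAC ltrDr ltr_wpDl.
Qed.

(** Convergence for f is not assumed: it follows by adding the truncated integrals of f - v and v,
    equal to those of f for every positive cut-off. *)
Lemma hilbert_sub (R : realType) (a b : R) (f v : R -> R) (t L1 L2 : R) :
  -1 < a -> -1 < b ->
  C0 (ppart a) (ppart b) f -> C0 (ppart a) (ppart b) v ->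
  truncated (fun x => (f x - v x) * jweight a b x) t e @[e --> 0^'+] --> L1 ->
  truncated (fun x => v x * jweight a b x) t e @[e --> 0^'+] --> L2 ->
  [/\ hilbert_exists a b f t, hilbert_exists a b v t &
      hilbert a b f t - hilbert a b v t = L1].
Proof.
move=> ha hb hf hv h1 h2.
have cont (h : R -> R) : C0 (ppart a) (ppart b) h ->
    forall x : R, -1 < x < 1 -> {for x, continuous h}.
  by case=> ch _ _ _ _ x hx; apply: ch; rewrite in_itv.
have meas h (hh : C0 (ppart a) (ppart b) h) := measurable_continuous_I11 (cont _ hh).
have int (h : R -> R) : C0 (ppart a) (ppart b) h ->
    (@lebesgue_measure R).-integrable `]-1, 1[ (EFin \o (fun x => h x * jweight a b x)).
  move=> hh; apply: integrable_weighted (meas _ hh) _ => //.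
  by move=> x hx; apply: wnorm_ub => //; exact: ppart_ge0.
have hfv : C0 (ppart a) (ppart b) (fun x => f x - v x) by exact: C0B.
have e2 : truncated_hilbert a b v t e @[e --> 0^'+] --> L2.
  rewrite (_ : (fun e => _) = truncated (fun x => v x * jweight a b x) t) //.
  by apply/funext => e; rewrite truncated_hilbertE //; exact: meas.
have e1 : truncated_hilbert a b f t e @[e --> 0^'+] --> L1 + L2.
  apply: cvg_trans (cvgD h1 h2); apply: near_eq_cvg.
  near=> e; rewrite truncated_hilbertE; last exact: meas.
  have e0 : 0 < e by near: e; exact: nbhs_right_gt.
  apply: etrans (esym (truncatedD t e0 (int _ hfv) (int _ hv))) _.
  by congr truncated; apply/funext => x; rewrite -mulrDl subrK.
split; [by apply/cvg_ex; exists (L1 + L2)|by apply/cvg_ex; exists L2|].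
by rewrite /hilbert (cvg_lim _ e1) // (cvg_lim _ e2) // addrK.
Unshelve. all: by end_near. Qed.

Unset Implicit Arguments.

Theorem corollary4p3 (R : realType) (a b alpha beta c1 c2 : R)
  (ha : -1 < a) (hb : -1 < b) (halpha : -1 < alpha) (hbeta : -1 < beta)
  (hc1 : 1 < c1) (hc2 : c1 <= c2)
  (p : nat -> {poly R}) (hp : orthonormal_jacobi alpha beta p)
  (hV : exists C : R, forall (n m : nat) (f : R -> R),
      comparable_indices c1 c2 n m ->
      C0 (ppart a) (ppart b) f ->
      wnorm (ppart a) (ppart b) (VP p n m f)
        <= C * wnorm (ppart a) (ppart b) f)
  (r : R) (hr : 0 < r) :
  exists2 C : R, 0 < C &
    forall (n m : nat) (f : R -> R) (t : R),
      comparable_indices c1 c2 n m ->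
      besov r (ppart a) (ppart b) f ->
      -1 < t < 1 ->
      [/\ hilbert_exists a b f t,
          hilbert_exists a b (VP p n m f) t &
          VP_error a b p n m f t * u2 a b t
            <= C * `|f t - VP p n m f t| * u1 a b t
               + C * (ln n%:R / n%:R `^ r)
                   * besov_norm r (ppart a) (ppart b) f].
Proof.
have hg := ppart_ge0 a; have hd := ppart_ge0 b.
have [C3 C30 hC3] := VP_error_approximable halpha hbeta hc1 hp hg hd hr hV.
have [C4 C40 hC4] := hilbert_bound ha hb hr.
(* The factor 2 comes from ln (2n) <= 2 ln n, as n >= 2. *)
have Cpos : 0 < C4 * C3 * 2 by rewrite !mulr_gt0.
exists (C4 * C3 * 2) => // n m f t hnm hf ht.
have [m0 mn _] := comparable_gap hc1 hnm.
have n2 : (2 <= n)%N by exact: leq_ltn_trans mn.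
have nr0 : 0 < n%:R `^ r :> R by rewrite powR_gt0 // ltr0n (leq_trans _ n2).
have [Q _ hQ] := VP_poly halpha hbeta hp n m f.
have cQ := C0_poly hg hd Q.
have cf : forall x : R, -1 < x < 1 -> {for x, continuous f}.
  by case: hf => -[ch _ _ _ _] _ x hx; apply: ch; rewrite in_itv.
have ctsQ : forall x : R, {for x, continuous (horner Q)} by exact: continuous_horner.
have [L2 h2 _] := hC4 (horner Q) _ (size Q).+2 t isT (wnorm_ge0 hg hd cQ)
  (fun x _ => ctsQ x) (approximable_poly r Q hg hd) ht.
(* The slack e supplies the strict inequality demanded by [VP_error_approximable]. The limit does
   not depend on e, so e is sent to 0 at the end by uniqueness of limits. *)
have main e : 0 < e -> exists2 L1,
    truncated (fun x => (f x - VP p n m f x) * jweight a b x) t e @[e --> 0^'+] --> L1 &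
    `|L1| * u2 a b t <= C4 * C3 * 2 * (ln n%:R / n%:R `^ r)
                        * (besov_norm r (ppart a) (ppart b) f + e).
  move=> e0; have [N0 hS] := besov_sum_lt_norm r hg hd hf.1 e0.
  have S0 : 0 <= besov_norm r (ppart a) (ppart b) f + e by rewrite addr_ge0 // ltW.
  have hF := hC3 n m f _ hnm hf hS S0.
  have A0 : 0 <= C3 * (besov_norm r (ppart a) (ppart b) f + e) / n%:R `^ r.
    by apply: divr_ge0 (ltW nr0); apply: mulr_ge0 => //; exact: ltW.
  have M2 : (2 <= 2 * n)%N by rewrite leq_pmulr // (leq_trans _ n2).
  have cF : forall x : R, -1 < x < 1 -> {for x, continuous (fun y => f y - VP p n m f y)}.
    by move=> x hx; rewrite hQ; apply: continuousB; [exact: cf | exact: ctsQ].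
  have [L1 h1 hL1] := hC4 _ _ _ _ M2 A0 cF hF ht.
  exists L1 => //; apply: le_trans hL1 _.
  have lnM : ln (2 * n)%:R <= 2 * ln n%:R :> R.
    rewrite natrM lnM ?posrE ?ltr0n ?(leq_trans _ n2) // mulr_natl [leRHS]mulr2n lerD2r.
    by rewrite ler_ln ?posrE ?ltr0n ?(leq_trans _ n2) // ler_nat.
  apply: le_trans (ler_wpM2l _ lnM) _; first by apply: mulr_ge0 => //; exact: ltW.
  by rewrite le_eqVlt; apply/orP; left; apply/eqP; ring.
have [L1 h1 _] := main 1 ltr01.
have cVP : C0 (ppart a) (ppart b) (VP p n m f) by rewrite hQ.
rewrite -hQ in h2.
have [ex1 ex2 hL] := hilbert_sub ha hb hf.1 cVP h1 h2.
split => //; rewrite /VP_error /VP_quadrature hL.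
apply: (@le_trans _ _ (C4 * C3 * 2 * (ln n%:R / n%:R `^ r) * besov_norm r (ppart a) (ppart b) f)).
  have ln0 : 0 <= C4 * C3 * 2 * (ln n%:R / n%:R `^ r).
    apply: mulr_ge0; first exact: ltW.
    by apply: divr_ge0 (ltW nr0); apply: ln_ge0; rewrite ler1n (leq_trans _ n2).
  apply/ler_addgt0Pr => e e0.
  set K := C4 * C3 * 2 * _ in ln0 main *.
  (* Dividing the slack by K + 1 instead of K requires only K >= 0. *)
  have K0 : 0 < K + 1 by rewrite ltr_wpDl.
  have [L h hLe] := main (e / (K + 1)) (divr_gt0 e0 K0).
  rewrite (cvg_unique _ h1 h) //; apply: le_trans hLe _.
  rewrite mulrDr lerD2l mulrCA ler_piMr ?(ltW e0) // ler_pdivrMr // mul1r lerDl.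
  exact: ler01.
by rewrite lerDr mulr_ge0 ?jweight_ge0 // mulr_ge0 // ltW.
Qed.
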